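(* Let $\mathbf{k}$ be an algebraically closed field of characteristic $0$ and let $U$ be a $\mathbf{k}$-vector space of dimension $3$. Let $R=\operatorname{Sym}(\operatorname{Sym}^3U)$, let $Y\subseteq \operatorname{Sym}^3(U^* )$ be the variety of ternary cubics that are products of three linear forms, let $J\subset R$ be the ideal of $Y$, let $B=\bigoplus_{m\ge 0}\operatorname{Sym}^3(\operatorname{Sym}^m U)$, and let $C=B/\mathbf{k}[Y]$. Then: (a) The module $C$ is isomorphic to $(\det U)^{\otimes 2}(-2)$, i.e. it is the one-dimensional representation $(\det U)^{\otimes 2}$ concentrated in degree $2$. (b) The ideal $J$ is generated by the Brill equations, i.e., by the representation $\mathbf{S}_{(7,3,2)}U$ in degree $4$.
   Context: $R$ is the coordinate ring of the affine space $\operatorname{Sym}^3(U^* )$, graded with $\operatorname{Sym}^3U$ in degree $1$, and $\mathbf{k}[Y]=R/J$. Let $A=\bigoplus_{m\ge0}(\operatorname{Sym}^mU)^{\otimes 3}\subset\operatorname{Sym}(U)^{\otimes 3}$, graded by $m$, with $\mathfrak{S}_3$ permuting tensor factors; $B=A^{\mathfrak{S}_3}=\bigoplus_{m\ge 0}\operatorname{Sym}^3(\operatorname{Sym}^mU)$ (symmetric tensors are identified with symmetric powers). The inclusion of $\operatorname{Sym}^3U$ as symmetric tensors in $U^{\otimes 3}=A_1$ induces a graded ring homomorphism $R\to B$, dual to $(\ell_1,\ell_2,\ell_3)\mapsto\ell_1\ell_2\ell_3$, with kernel $J$ and image $\mathbf{k}[Y]$; $C$ is its cokernel, a graded $\mathbf{GL}(U)$-equivariant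 $R$-module. $\det U=\bigwedge^3U$, and $\mathbf{S}_\lambda$ denotes the Schur functor. Brill equations (for general $d$ and $U$, here $d=3$): regard $f\in\operatorname{Sym}^d(U^* )$ as a polynomial function on $U$ and write $f(z+tx)=\sum_{j=0}^dt^jf_j(x,z)$ for $x,z\in U$. Let $p_d(e_1,\dots,e_d)$ be the polynomial expressing the $d$-th power sum in terms of elementary symmetric polynomials, and put $Q_f(x,z)=f(z)^d\,p_d\big(f_1(x,z)/f(z),\dots,f_d(x,z)/f(z)\big)$, which is a polynomial of degree $d$ in $x$ and $d(d-1)$ in $z$, viewed in $\operatorname{Sym}^d(U^* )\otimes\operatorname{Sym}^{d(d-1)}(U^* )$. Let $\pi\colon\operatorname{Sym}^d(U^* )\otimes\operatorname{Sym}^d(U^* )\to\mathbf{S}_{(d,d)}(U^* )$ be the $\mathbf{GL}(U)$-equivariant projection (unique up to scalar). Brill's equations are the coordinates of $(\pi\otimes\mathrm{id})(f\otimes Q_f)\in\mathbf{S}_{(d,d)}(U^* )\otimes\operatorname{Sym}^{d(d-1)}(U^* )$; they are polynomials of degree $d+1$ in the coefficients of $f$. For $d=3$ and $\dim U\ge3$ they span a copy of $\mathbf{S}_{(7,3,2)}U$ in $R_4=\operatorname{Sym}^4(\operatorname{Sym}^3U)$. *)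

(* Defs.v *)
From HB Require Import structures.
From mathcomp Require Import all_boot all_order all_fingroup all_algebra.
From mathcomp Require Import generic_quotient.
From mathcomp Require Import mpoly.
From mathcomp Require Import boolp.

Set Implicit Arguments.
Unset Strict Implicit.
Unset Printing Implicit Defensive.

Import GRing.Theory.
Local Open Scope ring_scope.
Local Open Scope quotient_scope.

(* U is a k-vector space with a basis e = (u_0, ..., u_(n-1)), and U^v is its
   dual: Sym(U) is {mpoly k[n]}, and so is Sym(U^v), in the dual basis.  *)

Section LinearSpan.
Variables (K : nzRingType) (V : lmodType K).

Definition lspan (S : V -> Prop) (v : V) : Prop :=
  exists (r : nat) (a : 'I_r -> K) (s : 'I_r -> V),
    (forall i, S (s i)) /\ v = \sum_(i < r) a i *: s i.

End LinearSpan.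

Definition ideal_gen (S : comNzRingType) (G : S -> Prop) (x : S) : Prop :=
  exists (r : nat) (a s : 'I_r -> S),
    (forall i, G (s i)) /\ x = \sum_(i < r) a i * s i.

(* The subspaces V of E and W of F are isomorphic as representations of the
   group of the g : G such that GL g, acting through actE and actF. *)
Definition rep_iso (k : nzRingType) (E F : lmodType k) (G : Type)
    (GL : G -> Prop) (actE : G -> E -> E) (actF : G -> F -> F)
    (V : E -> Prop) (W : F -> Prop) : Prop :=
  exists phi : E -> F,
    [/\ forall a u v, V u -> V v -> phi (a *: u + v) = a *: phi u + phi v,
        forall u, V u -> W (phi u),
        forall u v, V u -> V v -> phi u = phi v -> u = v,
        forall w, W w -> exists2 u, V u & phi u = w
      & forall g u, GL g -> V u -> phi (actE g u) = actF g (phi u)].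

Section GeneralLinear.
Variables (k : fieldType) (U : vectType k) (n : nat) (e : n.-tuple U).

Definition inGL (g : 'End(U)) : Prop := lker g == 0%VS.

Definition gl_mx (g : 'End(U)) : 'M[k]_n := \matrix_(i, j) coord e i (g e`_j).

(* The matrix, in the dual basis, of the contragredient action on U^v. *)
Definition gl_dual_mx (g : 'End(U)) : 'M[k]_n := (gl_mx (g^-1)%VF)^T.

Definition linform (l : 'Hom(U, k^o)) : {mpoly k[n]} :=
  \sum_(a < n) l e`_a *: 'X_a.

End GeneralLinear.

(* Sym(U)^{(x) d} is the polynomial ring on the d * n variables xvar i a,
   where xvar i a is u_a in the i-th tensor factor. *)
Section TensorPowerOfSym.
Variables (k : fieldType) (d n : nat).

Local Notation T := {mpoly k[d * n]}.

Definition xvar (i : 'I_d) (a : 'I_n) : T := 'X_(mxvec_index i a).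

Definition bsubst (L : 'M[T]_(d, n)) (p : T) : T :=
  p \mPo [tuple mxvec L 0 l | l < d * n].

Definition gact (M : 'M[k]_n) (p : T) : T :=
  bsubst (\matrix_(i, a) \sum_b M b a *: xvar i b) p.

Definition bperm (s : 'S_d) (p : T) : T :=
  bsubst (\matrix_(i, a) xvar (s i) a) p.

Definition bdeg (i : 'I_d) (m : 'X_{1..d * n}) : nat :=
  (\sum_(a < n) m (mxvec_index i a))%N.

Lemma bdeg0 i : bdeg i 0%MM = 0%N.
Proof. by rewrite /bdeg big1 // => a _; rewrite mnm0E. Qed.

Lemma bdegD i : {morph bdeg i : m1 m2 / (m1 + m2)%MM >-> (m1 + m2)%N}.
Proof.
by move=> m1 m2; rewrite /bdeg -big_split; apply: eq_bigr => a _; rewrite mnmDE.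
Qed.

HB.instance Definition _ i :=
  isMeasure.Build (d * n)%N (bdeg i) (bdeg0 i) (bdegD i).

(* Membership in Sym^{c 0}(U) (x) ... (x) Sym^{c (d-1)}(U). *)
Definition multihomog (c : 'I_d -> nat) (p : T) : Prop :=
  forall i, p \is (c i).-homog for (bdeg i).

(* A is the sum over m of (Sym^m U)^{(x) d}, and B its ring of invariants. *)
Definition Apred : {pred T} := fun p =>
  all (fun m => [forall i, forall j, bdeg i m == bdeg j m]) (msupp p).
Definition Bpred : {pred T} := fun p =>
  (p \in Apred) && [forall s, bperm s p == p].

End TensorPowerOfSym.

Arguments xvar {k d n}.

(* The Schur functor S_la(U), as the image of
     (x)_j Lambda^{la'_j} U -> U^{(x) |la|} -> (x)_i Sym^{la_i} U,
   where la' is the conjugate partition: u_{c 0} /\ ... /\ u_{c (h-1)} in the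
   j-th column goes to the h x h minor on the first h rows and on the columns
   c 0, ..., c (h-1) of the generic matrix (xvar i a). *)
Section SchurFunctor.
Variables (k : fieldType) (n : nat) (la : seq nat).

Definition colheight (j : nat) : nat := count (fun l => j < l)%N la.

Definition colrow j (i : 'I_(colheight j)) : 'I_(size la) :=
  widen_ord (count_size _ _) i.

Definition colminor j (c : nat -> 'I_n) : {mpoly k[size la * n]} :=
  \det (\matrix_(i < colheight j, i' < colheight j) xvar (colrow i) (c i')).

Definition schur : {mpoly k[size la * n]} -> Prop :=
  lspan (fun p => exists t : nat -> nat -> 'I_n,
                    p = \prod_(j < head 0%N la) colminor j (t j)).

End SchurFunctor.

(* R = Sym(Sym^d U): the variables are indexed by the sorted words
   t = (t_0 <= ... <= t_(d-1)) in [basis n d], t standing for the monomial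
   u_{t_0} ... u_{t_(d-1)} of Sym^d U. *)
Section CoordinateRing.
Variables (k : fieldType) (d n : nat).

Definition word (l : 'I_#|basis n d|) : d.-tuple 'I_n := enum_val l.

Local Notation Rring := {mpoly k[#|basis n d|]}.

Definition gactR (M : 'M[k]_n) (F : Rring) : Rring :=
  F \mPo [tuple \sum_l' (\prod_(i < d) \sum_b M b (tnth (word l) i) *: 'X_b
                           : {mpoly k[n]})@_(s2m (word l')) *: 'X_l'
         | l < #|basis n d|].

(* u_{t_0} ... u_{t_(d-1)}, as a function of f in Sym^d(U^v), is the value at
   (u_{t_0}, ..., u_{t_(d-1)}) of the polarisation of f (so that u^d has value
   f(u)), that is, d!^-1 times the corresponding iterated derivative of f. *)
Definition polar (f : {mpoly k[n]}) (l : 'I_#|basis n d|) : k :=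
  (d`!%:R)^-1 * (f^`M[s2m (word l)])@_0%MM.

Definition evalR (F : Rring) (f : {mpoly k[n]}) : k := F.@[polar f].

(* The symmetric tensor corresponding to the variable l of R. *)
Definition symtensor (l : 'I_#|basis n d|) : {mpoly k[d * n]} :=
  (d`!%:R)^-1 *: \sum_(s : 'S_d) \prod_(i < d) xvar i (tnth (word l) (s i)).

Definition RtoA (F : Rring) : {mpoly k[d * n]} :=
  F \mPo [tuple symtensor l | l < #|basis n d|].

End CoordinateRing.

Lemma comp_mpolyA (k : comNzRingType) (a b c : nat) (p : {mpoly k[a]})
    (u : a.-tuple {mpoly k[b]}) (v : b.-tuple {mpoly k[c]}) :
  (p \mPo u) \mPo v = p \mPo [tuple tnth u i \mPo v | i < a].
Proof.
rewrite (comp_mpolyE p) (comp_mpolyE p) linear_sum /=; apply: eq_bigr => m _.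
rewrite linearZ /= rmorph_prod /=; congr (_ *: _); apply: eq_bigr => i _.
by rewrite rmorphXn /= tnth_mktuple.
Qed.

(* The underlying space of (det U)^{(x) 2}; R (for the given d and n) acts on
   it below through R/R_+ = k. *)
Definition det2 (k : fieldType) (d n : nat) : Type := k.
HB.instance Definition _ (k : fieldType) (d n : nat) :=
  GRing.Zmodule.on (det2 k d n).

Section InvariantRing.
Variables (k : fieldType) (d n : nat).

Local Notation T := {mpoly k[d * n]}.
Local Notation Rring := {mpoly k[#|basis n d|]}.
Local Notation A := (@Apred k d n).
Local Notation B := (@Bpred k d n).

Lemma bsubstX (L : 'M[T]_(d, n)) i a : bsubst L (xvar i a) = L i a.
Proof. by rewrite /bsubst comp_mpolyXU -tnth_nth tnth_mktuple mxvecE. Qed.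

Lemma bsubst_comp (L1 L2 : 'M[T]_(d, n)) (p : T) :
  bsubst L1 (bsubst L2 p) = bsubst (\matrix_(i, a) bsubst L1 (L2 i a)) p.
Proof.
rewrite /bsubst comp_mpolyA; congr (_ \mPo _); apply: eq_from_tnth => l.
rewrite !tnth_mktuple; case/mxvec_indexP: l => i a.
by rewrite !mxvecE mxE.
Qed.

Lemma gact_bperm (M : 'M[k]_n) (s : 'S_d) (p : T) :
  bperm s (gact M p) = gact M (bperm s p).
Proof.
rewrite /gact /bperm !bsubst_comp; congr (bsubst _ p).
apply/matrixP => i a; rewrite !mxE bsubstX mxE /bsubst linear_sum /=.
apply: eq_bigr => b _; rewrite linearZ /=; congr (_ *: _).
by rewrite -/(bsubst _ (xvar i b)) bsubstX mxE.
Qed.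

Lemma AP (p : T) : reflect
  (forall m i j, m \in msupp p -> bdeg i m = bdeg j m) (p \in A).
Proof.
apply: (iffP allP) => [H m i j /H /forallP /(_ i) /forallP /(_ j) /eqP //|H m mp].
by apply/forallP => i; apply/forallP => j; apply/eqP/H.
Qed.

Lemma BP (p : T) : reflect (p \in A /\ forall s, bperm s p = p) (p \in B).
Proof.
apply: (iffP andP) => -[Ap Hp]; split=> //; last by apply/forallP => s; apply/eqP.
by move=> s; apply/eqP; move/forallP: Hp.
Qed.

Lemma A_homog (c : nat) (p : T) : multihomog (fun=> c) p -> p \in A.
Proof. by move=> H; apply/AP => m i j mp; rewrite !(dhomogP _ _ _ (H _) m mp). Qed.

Lemma A_subring : subring_closed A.
Proof.
split=> [|p q /AP Hp /AP Hq|p q /AP Hp /AP Hq]; apply/AP => m i j.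
- by rewrite msupp1 inE => /eqP ->; rewrite !bdeg0.
- by move=> /msuppB_le; rewrite mem_cat => /orP[/Hp|/Hq]; apply.
move=> /msuppM_le /allpairsP[[m1 m2] /= [/Hp H1 /Hq H2 ->]].
by rewrite !bdegD (H1 i j) (H2 i j).
Qed.
HB.instance Definition _ := GRing.isSubringClosed.Build T A A_subring.

Lemma A_scale c (p : T) : p \in A -> c *: p \in A.
Proof. by move=> /AP Hp; apply/AP => m i j /msuppZ_le /Hp. Qed.

Lemma B_subring : subring_closed B.
Proof.
split=> [|p q|p q].
- by apply/BP; split=> [|s]; [apply: rpred1 | apply: rmorph1].
- move=> /BP[Ap Hp] /BP[Aq Hq]; apply/BP; split=> [|s]; first exact: rpredB.
  by rewrite /bperm /bsubst rmorphB /=; congr (_ - _); [apply: Hp | apply: Hq].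
move=> /BP[Ap Hp] /BP[Aq Hq]; apply/BP; split=> [|s]; first exact: rpredM.
by rewrite /bperm /bsubst rmorphM /=; congr (_ * _); [apply: Hp | apply: Hq].
Qed.
HB.instance Definition _ := GRing.isSubringClosed.Build T B B_subring.

Lemma B_scale c (p : T) : p \in B -> c *: p \in B.
Proof.
move=> /BP[Ap Hp]; apply/BP; split=> [|s]; first exact: A_scale.
by rewrite /bperm /bsubst linearZ /=; congr (_ *: _); apply: Hp.
Qed.

Lemma multihomogM (c c' : 'I_d -> nat) (p q : T) :
  multihomog c p -> multihomog c' q ->
  multihomog (fun i => c i + c' i)%N (p * q).
Proof. by move=> Hp Hq i; apply: dhomogM. Qed.

Lemma multihomog_prod (I : finType) (c : I -> 'I_d -> nat) (F : I -> T) :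
  (forall l, multihomog (c l) (F l)) ->
  multihomog (fun i => \sum_l c l i)%N (\prod_l F l).
Proof.
move=> HF i; elim/big_rec2: _ => [|l p q _ Hp]; first exact: dhomog1.
by apply: dhomogM => //; apply: HF.
Qed.

Lemma mxvec_index_inj (i i' : 'I_d) (a b : 'I_n) :
  (mxvec_index i a == mxvec_index i' b) = (i == i') && (a == b).
Proof.
apply/eqP/andP => [|[/eqP -> /eqP ->] //].
case: (curry_mxvec_bij d n) => f K _ E.
have := K (i, a) (erefl _); rewrite /= E (K (i', b) (erefl _)).
by case=> -> ->; rewrite !eqxx.
Qed.

Lemma xvar_homog i a : multihomog (fun i' => i == i' : nat) (xvar i a : T).
Proof.
move=> i'; rewrite dhomogX /= /bdeg; apply/eqP.
under eq_bigr => b _ do rewrite mnm1E mxvec_index_inj.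
case: (i == i') => /=; last by rewrite big1.
by rewrite (bigD1 a) //= eqxx big1 // => b; rewrite eq_sym => /negbTE ->.
Qed.

Lemma gact_A (M : 'M[k]_n) (p : T) : p \in A -> gact M p \in A.
Proof.
move=> /AP Hp; rewrite /gact /bsubst comp_mpolyE big_seq.
apply: rpred_sum => m /Hp Hm; apply: A_scale.
rewrite (reindex _ (curry_mxvec_bij d n)) /=.
suff H : multihomog (fun i : 'I_d => bdeg i m) (\prod_(j : 'I_d * 'I_n)
    (\sum_b M b j.2 *: xvar j.1 b : T) ^+ m (mxvec_index j.1 j.2)).
  have [i0 _|d0] := pickP (@predT 'I_d); last first.
    by apply/AP => m' i; move: (d0 i) => /=.
  apply: (@A_homog (bdeg i0 m)) => i; rewrite (Hm i0 i).
  move: (H i); congr (is_true (_ \is _)); apply: eq_bigr => -[j a] _ /=.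
  by rewrite tnth_mktuple mxvecE mxE.
have -> : (fun i : 'I_d => bdeg i m) = fun i =>
    (\sum_(j : 'I_d * 'I_n) (j.1 == i) * m (mxvec_index j.1 j.2))%N.
  apply: funext => i; rewrite -(pair_bigA _ (fun j a =>
    (j == i) * m (mxvec_index j a))%N) /= (bigD1 i) //=.
  rewrite [X in (_ + X)%N]big1 ?addn0 => [|j].
    by apply: eq_bigr => a _; rewrite eqxx mul1n.
  by move=> /negbTE E; rewrite big1 // => a _; rewrite E.
apply: (@multihomog_prod _ (fun j i => (j.1 == i) * m (mxvec_index j.1 j.2))%N).
move=> [i a] i' /=.
by apply: dhomogMn; apply: rpred_sum => b _; apply/dhomogZ/xvar_homog.
Qed.

Lemma gact_B (M : 'M[k]_n) (p : T) : p \in B -> gact M p \in B.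
Proof.
move=> /BP[Ap Hp]; apply/BP; split=> [|s]; first exact: gact_A.
by rewrite gact_bperm Hp.
Qed.

Lemma symtensor_B l : symtensor k l \in B.
Proof.
apply: B_scale; apply/BP; split=> [|s].
  apply: rpred_sum => s _; apply: (@A_homog 1) => i.
  have := @multihomog_prod _ (fun j i => j == i : nat)
            (fun j => xvar j (tnth (word l) (s j)))
            (fun j => xvar_homog j _) i.
  suff -> : (\sum_(j < d) (j == i))%N = 1%N by [].
  by rewrite (bigD1 i) //= eqxx big1 // => j /negbTE ->.
rewrite /bperm /bsubst linear_sum /= [RHS](reindex_inj (mulgI s^-1%g)) /=.
apply: eq_bigr => s' _; rewrite rmorph_prod /= [RHS](reindex_inj (@perm_inj _ s)).
apply: eq_bigr => i _; rewrite permM permK.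
by rewrite -/(bsubst _ (xvar i _)) bsubstX mxE.
Qed.

Lemma RtoA_B (F : Rring) : RtoA F \in B.
Proof.
rewrite /RtoA comp_mpolyE; apply: rpred_sum => m _; apply: B_scale.
by apply: rpred_prod => l _; rewrite rpredX // tnth_mktuple symtensor_B.
Qed.

(* B as a ring, as an R-module through R -> B, and with its GL-action. *)
Record Bring := MkB { Bval :> T; _ : Bval \in B }.
HB.instance Definition _ := [isSub for Bval].
HB.instance Definition _ := [Choice of Bring by <:].
HB.instance Definition _ := [SubChoice_isSubComNzRing of Bring by <:].

Definition RtoB (F : Rring) : Bring := MkB (RtoA_B F).

Lemma RtoB_zmod : zmod_morphism RtoB.
Proof. by move=> F G; apply/val_inj; rewrite /= /RtoA rmorphB. Qed.
HB.instance Definition _ := GRing.isZmodMorphism.Build Rring Bring RtoB RtoB_zmod.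

Lemma RtoB_monoid : monoid_morphism RtoB.
Proof.
by split=> [|F G]; apply/val_inj; rewrite /= /RtoA (rmorph1, rmorphM).
Qed.
HB.instance Definition _ :=
  GRing.isMonoidMorphism.Build Rring Bring RtoB RtoB_monoid.

Definition Bscale (F : Rring) (b : Bring) : Bring := RtoB F * b.

Fact BscaleA F G b : Bscale F (Bscale G b) = Bscale (F * G) b.
Proof. by rewrite /Bscale rmorphM mulrA. Qed.
Fact Bscale1 : left_id 1 Bscale.
Proof. by move=> b; rewrite /Bscale rmorph1 mul1r. Qed.
Fact BscaleDr : right_distributive Bscale +%R.
Proof. by move=> F b c; rewrite /Bscale mulrDr. Qed.
Fact BscaleDl b : {morph Bscale^~ b : F G / F + G}.
Proof. by move=> F G; rewrite /Bscale rmorphD mulrDl. Qed.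
HB.instance Definition _ :=
  GRing.Zmodule_isLmodule.Build Rring Bring BscaleA Bscale1 BscaleDr BscaleDl.

Definition gactB (M : 'M[k]_n) (b : Bring) : Bring := MkB (gact_B M (valP b)).

Definition Bgraded (m : nat) (b : Bring) : Prop := multihomog (fun=> m) (val b).

(* The image k[Y] of R -> B, and C = B / k[Y]. *)
Definition kY : {pred Bring} := fun b => `[< exists F, b = RtoB F >].

Lemma kYP b : reflect (exists F, b = RtoB F) (b \in kY).
Proof. exact: asboolP. Qed.

Lemma kY_zmod : zmod_closed kY.
Proof.
split=> [|b c /kYP[F ->] /kYP[G ->]]; apply/kYP; first by exists 0; rewrite rmorph0.
by exists (F - G); rewrite rmorphB.
Qed.
HB.instance Definition _ := GRing.isZmodClosed.Build Bring kY kY_zmod.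

Lemma kY_scale F b : b \in kY -> F *: b \in kY.
Proof. by move=> /kYP[G ->]; apply/kYP; exists (F * G); rewrite rmorphM. Qed.

Definition Cmod : Type := Quotient.quot kY.
HB.instance Definition _ := GRing.Zmodule.on Cmod.

Definition toC (b : Bring) : Cmod := \pi_(Quotient.quot kY) b.

Lemma toCD : {morph toC : b c / b + c}.
Proof. exact: raddfD. Qed.

Lemma toC_eq b c : toC b = toC c <-> b - c \in kY.
Proof. by rewrite Quotient.idealrBE; split=> [/eqP|/eqP]. Qed.

Lemma toC_surj c : exists b, c = toC b.
Proof. by exists (repr (c : Quotient.quot kY)); rewrite /toC reprK. Qed.

Definition Cscale (F : Rring) (c : Cmod) : Cmod :=
  toC (F *: repr (c : Quotient.quot kY)).

Lemma Cscale_toC F b : Cscale F (toC b) = toC (F *: b).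
Proof.
apply/toC_eq; rewrite -scalerBr; apply: kY_scale.
by apply/toC_eq; rewrite /toC reprK.
Qed.

Fact CscaleA F G c : Cscale F (Cscale G c) = Cscale (F * G) c.
Proof. by case: (toC_surj c) => b ->; rewrite !Cscale_toC scalerA. Qed.
Fact Cscale1 : left_id 1 Cscale.
Proof. by move=> c; case: (toC_surj c) => b ->; rewrite Cscale_toC scale1r. Qed.
Fact CscaleDr : right_distributive Cscale +%R.
Proof.
move=> F c c'; case: (toC_surj c) (toC_surj c') => b -> [b' ->].
by rewrite -toCD !Cscale_toC scalerDr toCD.
Qed.
Fact CscaleDl c : {morph Cscale^~ c : F G / F + G}.
Proof.
by move=> F G; case: (toC_surj c) => b ->; rewrite !Cscale_toC scalerDl toCD.
Qed.
HB.instance Definition _ :=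
  GRing.Zmodule_isLmodule.Build Rring Cmod CscaleA Cscale1 CscaleDr CscaleDl.

Definition Cgraded (m : nat) (c : Cmod) : Prop :=
  exists2 b, Bgraded m b & c = toC b.

Local Notation det2 := (det2 k d n).

Definition det2_scale (F : Rring) (x : det2) : det2 := F@_0%MM * x :> k.

Fact det2_scaleA F G x :
  det2_scale F (det2_scale G x) = det2_scale (F * G) x.
Proof. by rewrite /det2_scale mulrA -rmorphM. Qed.
Fact det2_scale1 : left_id 1 det2_scale.
Proof. by move=> x; rewrite /det2_scale rmorph1 mul1r. Qed.
Fact det2_scaleDr : right_distributive det2_scale +%R.
Proof. by move=> F x y; rewrite /det2_scale mulrDr. Qed.
Fact det2_scaleDl x : {morph det2_scale^~ x : F G / F + G}.
Proof. by move=> F G; rewrite /det2_scale rmorphD mulrDl. Qed.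
HB.instance Definition _ := GRing.Zmodule_isLmodule.Build Rring det2
  det2_scaleA det2_scale1 det2_scaleDr det2_scaleDl.

Definition gact_det2 (M : 'M[k]_n) (x : det2) : det2 := \det M ^+ 2 * x :> k.

(* The twist (-2) puts it in degree 2. *)
Definition det2_graded (m : nat) (x : det2) : Prop := m <> 2%N -> x = 0.

End InvariantRing.

Section Brill.
Variables (k : fieldType) (U : vectType k) (d n : nat) (e : n.-tuple U).

Local Notation Rring := {mpoly k[#|basis n d|]}.

(* The products of d linear forms, in Sym^d(U^v), and their ideal. *)
Definition Y (f : {mpoly k[n]}) : Prop :=
  exists l : 'I_d -> 'Hom(U, k^o), f = \prod_(i < d) linform e (l i).

Definition J (F : Rring) : Prop := forall f, Y f -> evalR F f = 0.

(* p_d; see power_sum_polyE. *)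
Definition power_sum : {mpoly k[d]} := \sum_(i < d) 'X_i ^+ d.

Definition power_sum_poly : {mpoly k[d]} := symf power_sum.

Lemma power_sum_polyE :
  power_sum = power_sum_poly \mPo [tuple mesym d k i.+1 | i < d].
Proof.
apply: symfP; apply/issymP => s; rewrite linear_sum /= [RHS](reindex_inj (@perm_inj _ s)).
apply: eq_bigr => i _; rewrite rmorphXn /=; congr (_ ^+ d).
by rewrite /msym mmapX mmap1U.
Qed.

(* Sym(U^v) (x) Sym(U^v) (x) Sym(U^v), as the polynomials in z whose
   coefficients are polynomials in y = (xvar0 a)_a and x = (xvar1 a)_a. *)
Local Notation Syx := {mpoly k[2 * n]}.
Local Notation Syxz := {mpoly {mpoly k[2 * n]}[n]}.

Definition xvar0 (a : 'I_n) : Syx := xvar (0 : 'I_2) a.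
Definition xvar1 (a : 'I_n) : Syx := xvar (1 : 'I_2) a.

(* f(z + t x), as a polynomial in t, and its coefficient f_j(x, z). *)
Definition shift (f : {mpoly k[n]}) : {poly Syxz} :=
  mmap (fun c : k => (c%:MP%:MP)%:P) (fun a => ('X_a)%:P + ((xvar1 a)%:MP)%:P * 'X) f.

Definition fcoef (f : {mpoly k[n]}) (j : nat) : Syxz := (shift f)`_j.

(* f(z)^d p_d(f_1(x,z)/f(z), ..., f_d(x,z)/f(z)): every monomial of p_d has
   degree at most d, so the exponent below is not truncated. *)
Definition Qbrill (f : {mpoly k[n]}) : Syxz :=
  \sum_(m <- msupp power_sum_poly)
    (power_sum_poly@_m)%:MP%:MP * fcoef f 0 ^+ (d - mdeg m)
      * \prod_(i < d) fcoef f i.+1 ^+ m i.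

(* f (x) Q_f, that is, f(y) Q_f(x, z). *)
Definition brill_tensor (f : {mpoly k[n]}) : Syxz :=
  (f \mPo [tuple xvar0 a | a < n])%:MP * Qbrill f.

(* pi : Sym^d(U^v) (x) Sym^d(U^v) -> S_(d,d)(U^v) is an equivariant projection
   (its values outside of Sym^d (x) Sym^d play no role). *)
Definition brill_projection (pi : {linear Syx -> Syx}) : Prop :=
  let SdSd (p : Syx) := multihomog (fun _ : 'I_2 => d) p in
  let Sdd : Syx -> Prop := @schur k n [:: d; d] in
  [/\ forall p, SdSd p -> Sdd (pi p),
      forall q, Sdd q -> exists2 p, SdSd p & pi p = q
    & forall g p, inGL g -> SdSd p ->
        pi (gact (gl_dual_mx e g) p) = gact (gl_dual_mx e g) (pi p)].

(* F is a coordinate of (pi (x) id)(f (x) Q_f), as a function of f. *)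
Definition brill_eq (pi : {linear Syx -> Syx}) (F : Rring) : Prop :=
  exists (mz : 'X_{1..n}) (myx : 'X_{1..2 * n}), forall f : {mpoly k[n]},
    f \is d.-homog -> evalR F f = (map_mpoly pi (brill_tensor f))@_mz@_myx.

End Brill.

(* Main.v *)
Require Import Defs.
From HB Require Import structures.
From mathcomp Require Import all_boot fingroup perm all_algebra.
From mathcomp Require Import mpoly ring zify.

(** Let X_l be the coefficients of the generic ternary cubic f, that is, the
    variables of R, and let h_l be those of its Hessian, which are cubic forms
    in the X_l. The Hessian is a covariant of weight 2, and a triangle is
    proportional to its Hessian; so on a product of three linear forms with
    determinant delta one has h_l = omega X_l, where omega = delta^2 / 18
    spans a copy of (det U)^2 in degree 2 of B (RtoA_hess). Both parts of the
    theorem come from the following description of B.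

    - B is generated by 1 and omega as an R-module (B_inC). It is spanned by the
      translates of the power sums of the six terms of delta, and these are
      polynomials in the coefficients of the product and in delta^2; omega^2 is
      given by Aronhold's invariant of degree 4 (omega2_R).
    - The relations are generated by h_l = omega X_l (muv_inj). Modulo the seven
      linear forms theta that vanish on the cubics (x^2 + y^2 + z^2) l, the
      module defined by these relations has dimensions 1, 3, 7, 3, 1 in degrees
      0, ..., 4; by the graded Nakayama lemma (Zspan_all) its Hilbert function
      is at most that of a free module over k[theta] with these generators,
      which is the Hilbert function of B (Hilbert_identity).

    Since X_l omega is the image of h_l, the cokernel of R -> B is spanned by
    omega, and omega is not in the image, as the relations begin in degree 3:
    this is (a). An F in the kernel J of R -> B is a sum of the a_l h_l where
    the sum of the a_l X_l is 0; by exactness of the Koszul complex, J is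
    generated by the brackets X_l h_l' - X_l' h_l (kernel_bracket).

    For (b), these brackets are compared with the Brill equations. Equivariance
    under the torus and then under GL(U) forces the projection onto S_(3,3) to
    be a multiple of the third transvectant (brill_projectionE). An identity of
    polynomials in the frame (y, x, z) then shows that Brill's form is
    det(y, x, z)^2 times the bracket of y z^2 and x z^2, up to a constant
    (brill_at_bracket). Polarization and apolarity of a binary cubic form with
    its Hessian covariant show that the brackets Phi(a, b) of a^3 and a^2 b,
    the Brill equations, and all brackets have the same span (Phi_brackets,
    brill_membership).

    Finally S_(7,3,2) is spanned by the delta^2 a^4 (a /\ b) (schur_psi). A
    polynomial map of degree (5, 1) that vanishes for a = b factors through
    a^4 (a /\ b), which gives an equivariant map onto the span of the Phi(a, b)
    (intertwiner_ex). It is injective, as shown by evaluation at the translates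
    of a deformation of z0^2 z1 (phi_inj). *)

Set Implicit Arguments.
Unset Strict Implicit.
Unset Printing Implicit Defensive.

Import GRing.Theory.
Local Open Scope ring_scope.


(** * Subspaces and interpolation *)

Section Subspaces.
Variables (k : fieldType) (V : lmodType k).

Definition subspace (W : V -> Prop) : Prop :=
  W 0 /\ forall a u v, W u -> W v -> W (a *: u + v).

Variables (W : V -> Prop) (sW : subspace W).

Lemma subspaceD u v : W u -> W v -> W (u + v).
Proof. by move=> Wu Wv; rewrite -[u]scale1r; apply: sW.2. Qed.

Lemma subspaceZ a u : W u -> W (a *: u).
Proof. by move=> Wu; rewrite -[_ *: _]addr0; apply: sW.2 => //; apply: sW.1. Qed.

Lemma subspaceB u v : W u -> W v -> W (u - v).
Proof. by move=> Wu Wv; rewrite addrC -scaleN1r; apply: sW.2. Qed.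

Lemma subspace_sum (I : Type) (r : seq I) (P : pred I) (F : I -> V) :
  (forall i, P i -> W (F i)) -> W (\sum_(i <- r | P i) F i).
Proof. by move=> WF; apply: big_ind => //; [apply: sW.1 | apply: subspaceD]. Qed.

Lemma lspan_min (S : V -> Prop) :
  (forall u, S u -> W u) -> forall v, lspan S v -> W v.
Proof.
move=> SW v [r [a [s [Ss ->]]]].
by apply: subspace_sum => i _; apply/subspaceZ/SW.
Qed.

End Subspaces.

Section Lspan.
Variables (k : fieldType) (V : lmodType k) (S : V -> Prop).

Lemma lspan_mem v : S v -> lspan S v.
Proof.
move=> Sv; exists 1%N, (fun=> 1), (fun=> v); split=> //.
by rewrite big_ord1 scale1r.
Qed.

Lemma lspan_subspace : subspace (lspan S).
Proof.
split.
  by exists 0%N, (fun=> 0), (fun=> 0); split; [case | rewrite big_ord0].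
move=> c u v [r [a [s [Ss ->]]]] [r' [a' [s' [Ss' ->]]]].
exists (r + r')%N, (fun i => match split i with inl j => c * a j | inr j => a' j end),
  (fun i => match split i with inl j => s j | inr j => s' j end).
split=> [i|]; first by case: (split i).
rewrite big_split_ord scaler_sumr /=; congr (_ + _); apply: eq_bigr => i _.
  by rewrite -[lshift _ _]/(unsplit (inl i)) unsplitK scalerA.
by rewrite -[rshift _ _]/(unsplit (inr i)) unsplitK.
Qed.

End Lspan.

Section Interpolation.
Variables (k : fieldType) (chark : [pchar k] =i pred0).

Lemma natk_neq0 n : (n.+1%:R : k) != 0.
Proof. by move/pcharf0P: chark => ->. Qed.

Variables (V : lmodType k) (W : V -> Prop) (sW : subspace W).

(** In characteristic 0 a Vandermonde matrix at 1, 2, ..., n is invertible, so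
    the coefficients of a curve lying in a subspace are combinations of its
    points. *)
Lemma curve_coef_mem n (w : 'I_n -> V) :
    (forall c : k, c != 0 -> W (\sum_(i < n) c ^+ i *: w i)) ->
  forall i, W (w i).
Proof.
move=> Wc i; pose a : 'rV[k]_n := \row_j j.+1%:R.
pose M := Vandermonde n a.
have uM : M \in unitmx.
  rewrite unitmxE unitfE det_Vandermonde; apply/prodf_neq0 => j _.
  apply/prodf_neq0 => l lj; rewrite !mxE.
  rewrite -(subnK (ltnW lj : j.+1 <= l.+1)%N) natrD addrK.
  by rewrite subSS -(subnSK lj) natk_neq0.
have -> : w i = \sum_(j < n) invmx M j i *: \sum_(l < n) a 0 j ^+ l *: w l.
  under eq_bigr => j _ do rewrite scaler_sumr.
  rewrite exchange_big /= (bigD1 i) //= [X in _ + X]big1 ?addr0.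
    under eq_bigr => j _ do rewrite scalerA.
    rewrite -scaler_suml -[LHS]scale1r; congr (_ *: _).
    have := congr1 (fun A : 'M_n => A i i) (mulmxV uM); rewrite !mxE eqxx mulr1n => <-.
    by apply: eq_bigr => j _; rewrite mulrC [M i j]mxE.
  move=> l nli; under eq_bigr => j _ do rewrite scalerA.
  rewrite -scaler_suml.
  have := congr1 (fun A : 'M_n => A l i) (mulmxV uM).
  rewrite !mxE (negbTE nli) /= => E.
  rewrite (eq_bigr (fun j => M l j * invmx M j i)) ?E ?scale0r // => j _.
  by rewrite mulrC [M l j]mxE.
apply: subspace_sum => // j _; apply: subspaceZ => //; apply: Wc.
by rewrite mxE natk_neq0.
Qed.

(** Uniqueness of the expansion in base D. *)
Lemma digits_inj n D (f g : 'I_n -> nat) :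
    (forall i, f i < D)%N -> (forall i, g i < D)%N ->
    (\sum_i f i * D ^ i)%N = (\sum_i g i * D ^ i)%N -> f =1 g.
Proof.
elim: n f g => [|n IHn] f g fD gD; first by move=> _ [].
have D0 : (0 < D)%N by apply: leq_ltn_trans (fD ord0).
have tail (u : 'I_n.+1 -> nat) : (\sum_i u i * D ^ i =
    u ord0 + D * \sum_(i < n) u (lift ord0 i) * D ^ i)%N.
  rewrite big_ord_recl /= expn0 muln1 big_distrr /=; congr (_ + _)%N.
  by apply: eq_bigr => i _; rewrite expnS mulnCA.
rewrite !tail => E.
have E0 : f ord0 = g ord0.
  have := congr1 (modn^~ D) E.
  by rewrite ![(f _ + _)%N]addnC ![(g _ + _)%N]addnC ![(D * _)%N]mulnC !modnMDl !modn_small.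
move: E; rewrite E0 => /addnI /eqP; rewrite eqn_pmul2l // => /eqP E.
have {}IHn := IHn _ _ (fun i => fD (lift ord0 i)) (fun i => gD (lift ord0 i)) E.
by move=> i; case: (unliftP ord0 i) => [j|] ->.
Qed.

(** The several-variable form follows by substituting x_i := x^(D^i), which
    separates the monomials with exponents less than D. *)
Lemma family_coef_mem n (s : seq 'X_{1..n}) (w : 'X_{1..n} -> V) : uniq s ->
    (forall c : 'I_n -> k, W (\sum_(m <- s) (\prod_i c i ^+ m i) *: w m)) ->
  forall m, m \in s -> W (w m).
Proof.
move=> us Wc m0 m0s; pose D := (\max_(m <- s) mdeg m).+1.
pose e (m : 'X_{1..n}) := (\sum_i m i * D ^ i)%N.
have mD m : m \in s -> forall i, (m i < D)%N.
  move=> ms i; rewrite ltnS; apply: leq_trans (leq_bigmax_seq _ ms isT).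
  by rewrite mdegE (bigD1 i) //= leq_addr.
pose N := (\max_(m <- s) e m).+1.
have eN m : m \in s -> (e m < N)%N.
  move=> ms; rewrite ltnS; exact: (@leq_bigmax_seq _ s xpredT e m ms isT).
pose u (l : 'I_N) : V := \sum_(m <- s | e m == l) w m.
suff: W (u (Ordinal (eN _ m0s))).
  rewrite /u big_mkcond /= (bigD1_seq m0) //= eqxx big_seq_cond big1 ?addr0 //.
  move=> m /andP[ms /eqP nm]; case: eqP => // E; case: nm.
  by apply/mnmP/(@digits_inj n D) => //; apply: mD.
apply: curve_coef_mem => c _.
have := Wc (fun i => c ^+ (D ^ i)%N).
congr W; rewrite [RHS](eq_bigr (fun l : 'I_N => \sum_(m <- s | e m == l) c ^+ l *: w m)).
  rewrite (exchange_big_dep xpredT) //= big_seq [RHS]big_seq.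
  apply: eq_bigr => m ms; rewrite (big_pred1 (Ordinal (eN m ms))) => [|l].
    by congr (_ *: _); rewrite /e /= -prodrXr; apply: eq_bigr => i _; rewrite -exprM mulnC.
  by rewrite /= eq_sym -val_eqE.
by move=> l _; rewrite scaler_sumr.
Qed.

End Interpolation.

Section Vanishing.
Variables (k : fieldType) (chark : [pchar k] =i pred0).

Lemma meval_inj n (p q : {mpoly k[n]}) :
  (forall c, p.@[c] = q.@[c]) -> p = q.
Proof.
move=> E; apply/eqP; rewrite -subr_eq0; apply/eqP/mpolyP => m; rewrite mcoeff0.
case: (boolP (m \in msupp (p - q))) => [|/memN_msupp_eq0 //].
apply: (@family_coef_mem _ chark k^o (fun x => x = 0) _ n _
  (fun m => (p - q)@_m : k^o)) => //.
  by split=> // a u v -> ->; rewrite scaler0 addr0.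
move=> c; under eq_bigr => i _ do rewrite [_ *: _]mulrC.
by rewrite -mevalE mevalB E subrr.
Qed.

Variables (S : comAlgType k) (W : S -> Prop) (sW : subspace W).

(** This is how a property of all numerical values of a polynomial passes to
    its coefficients. *)
Lemma mcoeff_mem n (P : {mpoly S[n]}) :
    (forall c : 'I_n -> k, W (P.@[fun i => (c i)%:A])) ->
  forall m, W P@_m.
Proof.
move=> WP m; case: (boolP (m \in msupp P)) => [|/memN_msupp_eq0 ->]; last exact: sW.1.
apply: (@family_coef_mem _ chark _ W sW n _ (fun m => P@_m)) => // c.
have := WP c; congr W; rewrite mevalE; apply: eq_bigr => m' _.
rewrite -mulr_algr; congr (_ * _); rewrite -[RHS]/(in_alg S _) rmorph_prod.
by apply: eq_bigr => i _; rewrite rmorphXn.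
Qed.

End Vanishing.


(** * Mixed determinants *)

Notation i0 := (@Ordinal 3 0 isT).
Notation i1 := (@Ordinal 3 1 isT).
Notation i2 := (@Ordinal 3 2 isT).

Lemma big3 (R : Type) (idx : R) (op : Monoid.law idx) (F : 'I_3 -> R) :
  \big[op/idx]_(i < 3) F i = op (op (F i0) (F i1)) (F i2).
Proof.
rewrite !big_ord_recl big_ord0 Monoid.mulm1 Monoid.mulmA.
by congr (op (op (F _) (F _)) (F _)); apply: val_inj.
Qed.

Lemma sum3 (V : nmodType) (F : 'I_3 -> V) : \sum_(i < 3) F i = F i0 + F i1 + F i2.
Proof. exact: big3. Qed.

Lemma prod3 (R : pzSemiRingType) (F : 'I_3 -> R) :
  \prod_(i < 3) F i = F i0 * F i1 * F i2.
Proof. exact: big3. Qed.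

Lemma forall3 (P : 'I_3 -> Prop) : P i0 -> P i1 -> P i2 -> forall i, P i.
Proof.
move=> P0 P1 P2 [[|[|[|//]]] lt_i].
- by rewrite (_ : Ordinal _ = i0) //; apply: val_inj.
- by rewrite (_ : Ordinal _ = i1) //; apply: val_inj.
- by rewrite (_ : Ordinal _ = i2) //; apply: val_inj.
Qed.

(** Ten sorted triples are enough for a statement about symmetric tensors. *)
Lemma sym3_ind (P : 'I_3 -> 'I_3 -> 'I_3 -> Prop) :
    (forall x y z, P y x z -> P x y z) -> (forall x y z, P x z y -> P x y z) ->
    P i0 i0 i0 -> P i0 i0 i1 -> P i0 i0 i2 -> P i0 i1 i1 -> P i0 i1 i2 ->
    P i0 i2 i2 -> P i1 i1 i1 -> P i1 i1 i2 -> P i1 i2 i2 -> P i2 i2 i2 ->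
  forall x y z, P x y z.
Proof.
move=> C1 C2 P000 P001 P002 P011 P012 P022 P111 P112 P122 P222.
by apply: forall3; apply: forall3; apply: forall3; auto.
Qed.

Section MixedDet.
Variable S : comNzRingType.
Implicit Types A B C M : 'M[S]_3.

Lemma det3 A : \det A =
  A i0 i0 * (A i1 i1 * A i2 i2 - A i1 i2 * A i2 i1)
  - A i0 i1 * (A i1 i0 * A i2 i2 - A i1 i2 * A i2 i0)
  + A i0 i2 * (A i1 i0 * A i2 i1 - A i1 i1 * A i2 i0).
Proof.
rewrite (expand_det_row _ i0) big3 /cofactor !(expand_det_row _ ord0) /=.
rewrite !big_ord_recl !big_ord0 /cofactor !det_mx11 !mxE /=.
rewrite (_ : lift i0 ord0 = i1); last exact: val_inj.
rewrite (_ : lift i1 ord0 = i0); last exact: val_inj.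
rewrite (_ : lift i2 ord0 = i0); last exact: val_inj.
rewrite (_ : lift i0 (lift ord0 0) = i2); last exact: val_inj.
rewrite (_ : lift i1 (lift ord0 0) = i2); last exact: val_inj.
rewrite (_ : lift i2 (lift ord0 0) = i1); last exact: val_inj.
rewrite (_ : lift i0 (lift (lift ord0 ord0) 0) = i1); last exact: val_inj.
rewrite (_ : lift i1 (lift (lift ord0 ord0) 0) = i0); last exact: val_inj.
rewrite (_ : lift i2 (lift (lift ord0 ord0) 0) = i0); last exact: val_inj.
rewrite /bump /=; ring.
Qed.

(** The complete polarization of the determinant, so that
    mixdet A A A = 6 * det A. *)
Definition mixdet A B C : S :=
  \det (A + B + C) - \det (A + B) - \det (A + C) - \det (B + C)
  + \det A + \det B + \det C.

Lemma mixdetC12 A B C : mixdet A B C = mixdet B A C.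
Proof. by rewrite /mixdet (addrC B A); ring. Qed.

Lemma mixdetC23 A B C : mixdet A B C = mixdet A C B.
Proof. by rewrite /mixdet (addrC C B) -!addrA (addrC C B); ring. Qed.

(** This form is small enough for polynomial identities to be checked by
    expansion. *)
Lemma mixdetE A B C (d := fun A B C : 'M[S]_3 =>
    A i0 i0 * (B i1 i1 * C i2 i2 - B i1 i2 * C i2 i1)
    - A i0 i1 * (B i1 i0 * C i2 i2 - B i1 i2 * C i2 i0)
    + A i0 i2 * (B i1 i0 * C i2 i1 - B i1 i1 * C i2 i0)) :
  mixdet A B C = d A B C + d A C B + d B A C + d B C A + d C A B + d C B A.
Proof. by rewrite /mixdet !det3 !mxE /d; ring. Qed.

Lemma mixdet_linear B C a A A' :
  mixdet (a *: A + A') B C = a * mixdet A B C + mixdet A' B C.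
Proof. by rewrite !mixdetE !mxE; ring. Qed.

Lemma mixdet_congr M A B C :
  mixdet (M^T *m A *m M) (M^T *m B *m M) (M^T *m C *m M)
    = \det M ^+ 2 * mixdet A B C.
Proof.
rewrite /mixdet -!mulmxDl -!mulmxDr !det_mulmx !det_tr; ring.
Qed.

End MixedDet.


(** * Ternary cubics as symmetric tensors, and their Hessians *)

Section CubicTensors.
Variable S : comNzRingType.

Definition tensor3 : Type := 'I_3 -> 'I_3 -> 'I_3 -> S.

Implicit Types (F : tensor3) (M : 'M[S]_3).

Definition sym3 F : Prop :=
  forall i j l, F i j l = F j i l /\ F i j l = F i l j.

(** The tensor F in the frame of the columns of M. *)
Definition trans3 M F : tensor3 := fun i j l =>
  \sum_a \sum_b \sum_c M a i * M b j * M c l * F a b c.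

Definition slice F l : 'M[S]_3 := \matrix_(i, j) F i j l.

(** The polarization of 6 times the determinant of the matrix of the linear
    forms F i j l z_l: a multiple of the classical Hessian cubic. *)
Definition hess F : tensor3 := fun i j l =>
  mixdet (slice F i) (slice F j) (slice F l).

Lemma hess_sym F : sym3 (hess F).
Proof.
by move=> i j l; split; rewrite /hess; [rewrite mixdetC12 | rewrite mixdetC23].
Qed.

Lemma trans3_sym M F : sym3 F -> sym3 (trans3 M F).
Proof.
move=> sF i j l; split; rewrite /trans3.
  rewrite exchange_big /=; apply: eq_bigr => a _; apply: eq_bigr => b _.
  by apply: eq_bigr => c _; rewrite (sF b a c).1 (mulrC (M b i)).
apply: eq_bigr => a _; rewrite exchange_big /=; apply: eq_bigr => b _.
by apply: eq_bigr => c _; rewrite (sF a c b).2; congr (_ * _); rewrite mulrAC.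
Qed.

Lemma slice_trans3 M F l :
  slice (trans3 M F) l = M^T *m (\sum_c M c l *: slice F c) *m M.
Proof.
apply/matrixP => i j; rewrite !mxE /trans3 exchange_big /=.
apply: eq_bigr => b _; rewrite mxE big_distrl /=; apply: eq_bigr => a _.
rewrite summxE big_distrr big_distrl /=; apply: eq_bigr => c _.
by rewrite !mxE; ring.
Qed.

Lemma mixdet_sum (x : 'I_3 -> S) (A : 'I_3 -> 'M[S]_3) B C :
  mixdet (\sum_c x c *: A c) B C = \sum_c x c * mixdet (A c) B C.
Proof.
have -> : \sum_c x c *: A c = x i0 *: A i0 + (x i1 *: A i1 + (x i2 *: A i2 + 0)).
  by rewrite sum3 addr0 addrA.
have E0 : mixdet 0 B C = 0 by rewrite /mixdet !add0r det0; ring.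
by rewrite !mixdet_linear E0 sum3 addr0 addrA.
Qed.

(** The Hessian is a covariant of weight 2: each of its slices is transformed
    by congruence. *)
Lemma hess_trans3 M F i j l :
  hess (trans3 M F) i j l = \det M ^+ 2 * trans3 M (hess F) i j l.
Proof.
rewrite /hess !slice_trans3 mixdet_congr; congr (_ * _).
rewrite mixdet_sum; apply: eq_bigr => a _.
rewrite mixdetC12 mixdet_sum big_distrr /=; apply: eq_bigr => b _.
rewrite mixdetC12 mixdetC23 mixdetC12 mixdet_sum !big_distrr /=.
apply: eq_bigr => c _.
by rewrite -[in LHS]mixdetC12 -[in LHS]mixdetC23; ring.
Qed.

Lemma trans3_comp M N F i j l : trans3 N (trans3 M F) i j l = trans3 (M *m N) F i j l.
Proof.
rewrite /trans3.
under eq_bigr => a _ do under eq_bigr => b _ do under eq_bigr => c _ do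
  rewrite big_distrr /=.
under eq_bigr => a _ do under eq_bigr => b _ do rewrite exchange_big /=.
under eq_bigr => a _ do rewrite exchange_big /=.
rewrite exchange_big /=; apply: eq_bigr => a _.
under eq_bigr => a' _ do under eq_bigr => b _ do under eq_bigr => c _ do
  rewrite big_distrr /=.
under eq_bigr => a' _ do under eq_bigr => b _ do rewrite exchange_big /=.
under eq_bigr => a' _ do rewrite exchange_big /=.
rewrite exchange_big /=; apply: eq_bigr => b _.
under eq_bigr => a' _ do under eq_bigr => b' _ do under eq_bigr => c' _ do
  rewrite big_distrr /=.
under eq_bigr => a' _ do under eq_bigr => b' _ do rewrite exchange_big /=.
under eq_bigr => a' _ do rewrite exchange_big /=.
rewrite exchange_big /=; apply: eq_bigr => c _.
by rewrite !mxE !sum3; ring.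
Qed.

Lemma hess_scale x F i j l :
  hess (fun i j l => x * F i j l) i j l = x ^+ 3 * hess F i j l.
Proof.
have E a : slice (fun i j l => x * F i j l) a = x *: slice F a.
  by apply/matrixP => u v; rewrite !mxE.
rewrite /hess !E /mixdet -!scalerDr !detZ; ring.
Qed.

Section Symmetric.
Variables (F : tensor3) (sF : sym3 F).

Let s100 : F i1 i0 i0 = F i0 i0 i1. Proof. by rewrite (sF _ _ _).1 (sF _ _ _).2. Qed.
Let s010 : F i0 i1 i0 = F i0 i0 i1. Proof. by rewrite (sF _ _ _).2. Qed.
Let s200 : F i2 i0 i0 = F i0 i0 i2. Proof. by rewrite (sF _ _ _).1 (sF _ _ _).2. Qed.
Let s020 : F i0 i2 i0 = F i0 i0 i2. Proof. by rewrite (sF _ _ _).2. Qed.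
Let s110 : F i1 i1 i0 = F i0 i1 i1. Proof. by rewrite (sF _ _ _).2 (sF _ _ _).1. Qed.
Let s101 : F i1 i0 i1 = F i0 i1 i1. Proof. by rewrite (sF _ _ _).1. Qed.
Let s220 : F i2 i2 i0 = F i0 i2 i2. Proof. by rewrite (sF _ _ _).2 (sF _ _ _).1. Qed.
Let s202 : F i2 i0 i2 = F i0 i2 i2. Proof. by rewrite (sF _ _ _).1. Qed.
Let s211 : F i2 i1 i1 = F i1 i1 i2. Proof. by rewrite (sF _ _ _).1 (sF _ _ _).2. Qed.
Let s121 : F i1 i2 i1 = F i1 i1 i2. Proof. by rewrite (sF _ _ _).2. Qed.
Let s221 : F i2 i2 i1 = F i1 i2 i2. Proof. by rewrite (sF _ _ _).2 (sF _ _ _).1. Qed.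
Let s212 : F i2 i1 i2 = F i1 i2 i2. Proof. by rewrite (sF _ _ _).1. Qed.
Let s021 : F i0 i2 i1 = F i0 i1 i2. Proof. by rewrite (sF _ _ _).2. Qed.
Let s102 : F i1 i0 i2 = F i0 i1 i2. Proof. by rewrite (sF _ _ _).1. Qed.
Let s120 : F i1 i2 i0 = F i0 i1 i2. Proof. by rewrite (sF _ _ _).2 (sF _ _ _).1. Qed.
Let s201 : F i2 i0 i1 = F i0 i1 i2. Proof. by rewrite (sF _ _ _).1 (sF _ _ _).2. Qed.
Let s210 : F i2 i1 i0 = F i0 i1 i2. Proof. by rewrite (sF i2 _ _).2 s201. Qed.

Definition sorted3 := (s100, s010, s200, s020, s110, s101, s220, s202, s211, s121,
  s221, s212, s021, (s102, s120, s201, s210)).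

End Symmetric.

Lemma sym3_ext F G : sym3 F -> sym3 G ->
    F i0 i0 i0 = G i0 i0 i0 -> F i0 i0 i1 = G i0 i0 i1 -> F i0 i0 i2 = G i0 i0 i2 ->
    F i0 i1 i1 = G i0 i1 i1 -> F i0 i1 i2 = G i0 i1 i2 -> F i0 i2 i2 = G i0 i2 i2 ->
    F i1 i1 i1 = G i1 i1 i1 -> F i1 i1 i2 = G i1 i1 i2 -> F i1 i2 i2 = G i1 i2 i2 ->
    F i2 i2 i2 = G i2 i2 i2 -> forall i j l, F i j l = G i j l.
Proof.
move=> sF sG E1 E2 E3 E4 E5 E6 E7 E8 E9 E10; apply: forall3; apply: forall3; apply: forall3;
  by rewrite ?(sorted3 sF) ?(sorted3 sG).
Qed.

(** The polarization of 6 z0 z1 z2. *)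
Definition triangle : tensor3 := fun i j l =>
  ((i != j) && (j != l) && (i != l))%:R.

Lemma triangle_sym : sym3 triangle.
Proof. by rewrite /sym3; apply: forall3; apply: forall3; apply: forall3. Qed.

(** A triangle is proportional to its Hessian; by covariance this gives the
    same for every product of three linear forms. *)
Lemma hess_triangle i j l : hess triangle i j l = 2 * triangle i j l.
Proof.
move: i j l; apply: (sym3_ext (G := fun i j l => 2 * triangle i j l)).
- exact: hess_sym.
- by move=> i j l; rewrite -(triangle_sym i j l).1 -(triangle_sym i j l).2.
all: rewrite /hess !mixdetE !mxE /triangle /=; ring.
Qed.

Section SymmetricIdentities.
Variables (F : tensor3) (sF : sym3 F).

(** On the line spanned by the first two vectors of a frame, F and its Hessian
    are apolar. *)
Lemma hess_apolar :
  F i0 i0 i0 * hess F i1 i1 i1 - 3 * F i0 i0 i1 * hess F i0 i1 i1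
  + 3 * F i0 i1 i1 * hess F i0 i0 i1 - F i1 i1 i1 * hess F i0 i0 i0 = 0.
Proof. rewrite /hess !mixdetE !mxE !(sorted3 sF); ring. Qed.

(** Here Q is the polarization in x of the form Q_F(x, z) of Brill, in a frame
    (y, x, z). *)
Lemma brill_hess (Q := fun i j l => 27 * F i2 i2 i * F i2 i2 j * F i2 i2 l
      - 9 * F i2 i2 i2 * (F i2 i2 i * F i2 j l + F i2 i2 j * F i2 i l
                          + F i2 i2 l * F i2 i j) + 3 * F i2 i2 i2 ^+ 2 * F i j l) :
  2 * (F i0 i0 i0 * Q i1 i1 i1 - 3 * F i0 i0 i1 * Q i0 i1 i1
  + 3 * F i0 i1 i1 * Q i0 i0 i1 - F i1 i1 i1 * Q i0 i0 i0)
  = 27 * (F i0 i2 i2 * hess F i1 i2 i2 - F i1 i2 i2 * hess F i0 i2 i2).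
Proof. rewrite /Q /hess !mixdetE !mxE !(sorted3 sF); ring. Qed.

End SymmetricIdentities.
End CubicTensors.


(** * The variables of R as a symmetric tensor *)

Section TensorMorphisms.
Variables (S S' : comNzRingType) (phi : {rmorphism S -> S'}).

Lemma trans3_map M (F : tensor3 S) i j l :
  phi (trans3 M F i j l) = trans3 (map_mx phi M) (fun i j l => phi (F i j l)) i j l.
Proof.
rewrite /trans3 rmorph_sum; apply: eq_bigr => a _.
rewrite rmorph_sum; apply: eq_bigr => b _.
rewrite rmorph_sum; apply: eq_bigr => c _.
by rewrite !rmorphM !mxE.
Qed.

Lemma hess_map (F : tensor3 S) i j l :
  phi (hess F i j l) = hess (fun i j l => phi (F i j l)) i j l.
Proof.
rewrite /hess /mixdet !(rmorphD, rmorphN) /=.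
have E a : slice (fun i j l => phi (F i j l)) a = map_mx phi (slice F a).
  by apply/matrixP => u v; rewrite !mxE.
by rewrite !E -!map_mxD !det_map_mx.
Qed.

End TensorMorphisms.

Lemma eq_trans3 (S : comNzRingType) (M : 'M[S]_3) (F G : tensor3 S) i j l :
  (forall a b c, F a b c = G a b c) -> trans3 M F i j l = trans3 M G i j l.
Proof.
move=> E; apply: eq_bigr => a _; apply: eq_bigr => b _; apply: eq_bigr => c _.
by rewrite E.
Qed.

Lemma eq_hess (S : comNzRingType) (F G : tensor3 S) i j l :
  (forall a b c, F a b c = G a b c) -> hess F i j l = hess G i j l.
Proof.
move=> E; have Es a : slice F a = slice G a by apply/matrixP => u v; rewrite !mxE.
by rewrite /hess !Es.
Qed.

Lemma trans3Z (S : comNzRingType) (M : 'M[S]_3) (F : tensor3 S) x i j l :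
  trans3 M (fun i j l => x * F i j l) i j l = x * trans3 M F i j l.
Proof.
rewrite big_distrr /=; apply: eq_bigr => a _.
rewrite big_distrr /=; apply: eq_bigr => b _.
rewrite big_distrr /=; apply: eq_bigr => c _.
by rewrite mulrCA.
Qed.

(** A permutation of three letters is a triple of distinct letters. *)
Lemma sum_S3 (V : nmodType) (G : 'I_3 -> 'I_3 -> 'I_3 -> V) :
  \sum_(s : 'S_3) G (s i0) (s i1) (s i2) =
  \sum_a \sum_b \sum_c G a b c *+ ((a != b) && (b != c) && (a != c)).
Proof.
pose P (p : 'I_3 * ('I_3 * 'I_3)) :=
  [&& p.1 != p.2.1, p.2.1 != p.2.2 & p.1 != p.2.2].
pose h (s : 'S_3) := (s i0, (s i1, s i2)).
pose g p := odflt (1%g : 'S_3) [pick s | h s == p].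
have gK : {in P, cancel g h}.
  move=> [a [b c]] /and3P[/= ab bc ac]; rewrite /g.
  case: pickP => [s /eqP //|] /=.
  pose f : {ffun 'I_3 -> 'I_3} := [ffun x => tnth [tuple a; b; c] x].
  have injf : injective f.
    move=> x y; rewrite !ffunE; move: x y; apply: forall3; apply: forall3;
    rewrite ?(tnth_nth i0) //= => E; move: ab bc ac; by rewrite ?E ?eqxx.
  by move/(_ (perm injf)); rewrite /h !permE !ffunE !(tnth_nth i0) /= eqxx.
have hinj : injective h.
  by move=> s t [E0 E1 E2]; apply/permP; apply: forall3.
have hK : cancel h g.
  move=> s; rewrite /g; case: pickP => [t /eqP /hinj //|/(_ s)].
  by rewrite eqxx.
have Ph s : P (h s) by rewrite /P /= !(inj_eq perm_inj).
transitivity (\sum_(p | P p) G p.1 p.2.1 p.2.2).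
  rewrite (reindex h) /=; first by apply: eq_big => // s; rewrite Ph.
  by exists g => [s _|p Pp]; [apply: hK | apply: gK].
rewrite big_mkcond -(pair_bigA _ (fun a p =>
  if P (a, p) then G a p.1 p.2 else 0)) /=; apply: eq_bigr => a _.
rewrite -(pair_bigA _ (fun b c => if P (a, (b, c)) then G a b c else 0)) /=.
apply: eq_bigr => b _; apply: eq_bigr => c _; rewrite /P /= andbA.
by case: ifP.
Qed.

Section CubicForms.
Variable k : fieldType.

Local Notation T := {mpoly k[3 * 3]}.
Local Notation Rring := {mpoly k[#|basis 3 3|]}.

Let le_ord (a b : 'I_3) := (a <= b)%N.

Definition sort3 (i j l : 'I_3) : 3.-tuple 'I_3 :=
  [tuple of sort le_ord [:: i; j; l]].

Lemma sort3_basis i j l : sort3 i j l \in basis 3 3.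
Proof.
rewrite inE /= sorted_map; apply: sort_sorted => a b; exact: leq_total.
Qed.

Definition idx3 i j l : 'I_#|basis 3 3| :=
  enum_rank_in (sort3_basis i0 i0 i0) (sort3 i j l).

Lemma word_idx3 i j l : word (idx3 i j l) = sort3 i j l.
Proof. by rewrite /word enum_rankK_in ?sort3_basis. Qed.

Lemma le_ord_trans : transitive le_ord. Proof. by move=> a b c; apply: leq_trans. Qed.
Lemma le_ord_anti : antisymmetric le_ord.
Proof. by move=> a b E; apply/val_inj/anti_leq. Qed.
Lemma le_ord_total : total le_ord. Proof. by move=> a b; apply: leq_total. Qed.

Lemma idx3_perm i j l i' j' l' :
  perm_eq [:: i; j; l] [:: i'; j'; l'] -> idx3 i j l = idx3 i' j' l'.
Proof.
move=> E; congr enum_rank_in; apply: val_inj => /=.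
exact/(perm_sortP le_ord_total le_ord_trans le_ord_anti).
Qed.

Lemma idx3_word l :
  l = idx3 (tnth (word l) i0) (tnth (word l) i1) (tnth (word l) i2).
Proof.
apply: enum_val_inj; rewrite -/(word _) -/(word (idx3 _ _ _)) word_idx3.
apply: val_inj => /=.
have E : val (word l) = [:: tnth (word l) i0; tnth (word l) i1; tnth (word l) i2].
  by rewrite !(tnth_nth i0); case: (word l) => -[|a [|b [|c []]]].
rewrite -E (sorted_sort le_ord_trans) //; have := enum_valP l.
by rewrite inE /= sorted_map.
Qed.

Lemma s2m_idx3 i j l : s2m (word (idx3 i j l)) = (U_(i) + U_(j) + U_(l))%MM.
Proof.
rewrite word_idx3; apply/mnmP => a; rewrite mnmE !mnmDE !mnm1E /=.
have /seq.permP -> : perm_eq (sort le_ord [:: i; j; l]) [:: i; j; l] by rewrite perm_sort.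
by rewrite /= addn0 addnA.
Qed.

Definition X3 : tensor3 Rring := fun i j l => 'X_(idx3 i j l).

Lemma X3_sym : sym3 X3.
Proof.
move=> i j l; split; congr ('X_ _); apply: idx3_perm; apply/seq.permP => a /=.
  by rewrite addnCA.
by congr addn; rewrite addnCA.
Qed.

Definition X9 : 'M[T]_3 := \matrix_(q, a) xvar q a.

(** The map R -> A sends the generic cubic to the product of the three rows of
    X9, seen as linear forms. *)
Lemma RtoA_X3 i j l : RtoA (X3 i j l) = (6%:R^-1)%:MP * trans3 X9 (triangle _) i j l.
Proof.
rewrite /RtoA comp_mpolyXU -tnth_nth tnth_mktuple /symtensor mul_mpolyC.
congr (_ *: _).
have : perm_eq (word (idx3 i j l)) [tuple i; j; l].
  by rewrite word_idx3 /= perm_sort.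
case/tuple_permP => p Ep.
have {}Ep q : tnth (word (idx3 i j l)) q = tnth [tuple i; j; l] (p q).
  by rewrite (tnth_nth i0) Ep -tnth_nth tnth_mktuple.
rewrite (reindex_inj (mulIg p^-1%g)) /=.
under eq_bigr => s _ do under eq_bigr => q _ do rewrite Ep permM permKV.
rewrite (reindex_inj invg_inj) /=.
under eq_bigr => s _ do rewrite (reindex_inj (@perm_inj _ s)) /=.
under eq_bigr => s _ do under eq_bigr => q _ do rewrite permK.
under eq_bigr => s _ do rewrite prod3 !(tnth_nth i0) /=.
rewrite (sum_S3 (fun a b c => xvar a i * xvar b j * xvar c l)).
apply: eq_bigr => a _; apply: eq_bigr => b _; apply: eq_bigr => c _.
by rewrite !mxE mulr_natr.
Qed.

End CubicForms.


(** * The general linear group, and the invariant omega *)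

Section StructureMaps.
Variables (k : fieldType) (d n : nat).

HB.instance Definition _ := GRing.LRMorphism.copy (@RtoA k d n)
  (comp_mpoly [tuple symtensor k l | l < #|basis n d|]).
HB.instance Definition _ (L : 'M[{mpoly k[d * n]}]_(d, n)) :=
  GRing.LRMorphism.copy (bsubst L) (comp_mpoly [tuple mxvec L 0 l | l < d * n]).
HB.instance Definition _ (M : 'M[k]_n) :=
  GRing.LRMorphism.copy (@gact k d n M) (bsubst _).
HB.instance Definition _ (s : 'S_d) :=
  GRing.LRMorphism.copy (@bperm k d n s) (bsubst _).
HB.instance Definition _ (M : 'M[k]_n) :=
  GRing.LRMorphism.copy (@gactR k d n M) (comp_mpoly
   [tuple \sum_l' (\prod_(i < d) \sum_b M b (tnth (word l) i) *: 'X_b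
                           : {mpoly k[n]})@_(s2m (word l')) *: 'X_l'
         | l < #|basis n d|]).

Lemma gact_xvar (M : 'M[k]_n) i a :
  gact M (xvar i a : {mpoly k[d * n]}) = \sum_b M b a *: xvar i b.
Proof. by rewrite /gact bsubstX mxE. Qed.

Lemma bperm_xvar (s : 'S_d) i a :
  bperm s (xvar i a : {mpoly k[d * n]}) = xvar (s i) a.
Proof. by rewrite /bperm bsubstX mxE. Qed.

End StructureMaps.

Section Dictionary.
Variables (k : fieldType) (chark : [pchar k] =i pred0).

Local Notation T := {mpoly k[3 * 3]}.
Local Notation Rring := {mpoly k[#|basis 3 3|]}.
Local Notation X3 := (X3 k).
Local Notation X9 := (X9 k).

Lemma mpoly_ext_X n (S : comNzRingType) (f g : {rmorphism {mpoly k[n]} -> S}) :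
  (forall c, f c%:MP = g c%:MP) -> (forall i, f 'X_i = g 'X_i) -> f =1 g.
Proof.
move=> fg fgX p; rewrite (mpolyE p) !rmorph_sum; apply: eq_bigr => m _.
rewrite -mul_mpolyC !rmorphM fg; congr (_ * _).
rewrite mpolyXE_id !rmorph_prod; apply: eq_bigr => i _.
by rewrite !rmorphXn fgX.
Qed.

Lemma R_ext (S : comNzRingType) (f g : {rmorphism Rring -> S}) :
  (forall c, f c%:MP = g c%:MP) ->
  (forall i j l, f (X3 i j l) = g (X3 i j l)) -> f =1 g.
Proof. by move=> fg fgX; apply: mpoly_ext_X => // l; rewrite (idx3_word l) fgX. Qed.

Lemma gact_X9 (M : 'M[k]_3) : map_mx (gact M) X9 = X9 *m map_mx (@mpolyC _ k) M.
Proof.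
apply/matrixP => q a; rewrite !mxE gact_xvar; apply: eq_bigr => b _.
by rewrite !mxE mulrC mul_mpolyC.
Qed.

Lemma bperm_X9 (s : 'S_3) : map_mx (bperm s) X9 = row_perm s X9.
Proof. by apply/matrixP => q a; rewrite !mxE bperm_xvar. Qed.

Lemma gactR_X3 (M : 'M[k]_3) i j l :
  gactR M (X3 i j l) = trans3 (map_mx (@mpolyC _ k) M) X3 i j l.
Proof.
rewrite /gactR comp_mpolyXU -tnth_nth tnth_mktuple.
have -> : \prod_(q < 3) (\sum_b M b (tnth (word (idx3 i j l)) q) *: 'X_b : {mpoly k[3]})
   = \sum_a \sum_b \sum_c (M a i * M b j * M c l) *: 'X_[U_(a) + U_(b) + U_(c)].
  transitivity (\prod_(q <- word (idx3 i j l)) (\sum_b M b q *: 'X_b : {mpoly k[3]})).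
    by rewrite big_tuple.
  have : perm_eq (word (idx3 i j l)) [:: i; j; l] by rewrite word_idx3 /= perm_sort.
  move=> Ew; rewrite (perm_big _ Ew) /= !big_cons big_nil mulr1 mulr_suml.
  apply: eq_bigr => a _; rewrite mulrA [X in X * _]mulr_sumr mulr_suml.
  apply: eq_bigr => b _; rewrite mulr_sumr; apply: eq_bigr => c _.
  by rewrite !mpolyXD -!mul_mpolyC !mpolyCM; ring.
under eq_bigr => l' _.
  rewrite linear_sum /= scaler_suml; under eq_bigr => a _.
    rewrite linear_sum /= scaler_suml; under eq_bigr => b _.
      rewrite linear_sum /= scaler_suml; under eq_bigr => c _ do
        rewrite mcoeffZ mcoeffX -s2m_idx3 (inj_in_eq (@inj_s2m 3 3)) ?enum_valP //.
      over.
    over.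
  over.
rewrite exchange_big /=; apply: eq_bigr => a _.
rewrite exchange_big /=; apply: eq_bigr => b _.
rewrite exchange_big /=; apply: eq_bigr => c _.
rewrite (bigD1 (idx3 a b c)) //= big1 => [|l' /negbTE nl].
  by rewrite eqxx mulr1 addr0 !mxE -!mpolyCM mul_mpolyC.
by rewrite (inj_eq enum_val_inj) eq_sym nl mulr0 scale0r.
Qed.

Lemma RtoA_gactR (M : 'M[k]_3) (F : Rring) : RtoA (gactR M F) = gact M (RtoA F).
Proof.
suff E : @RtoA k 3 3 \o gactR M =1 gact M \o @RtoA k 3 3 by exact: E.
apply: R_ext => [c|i j l] /=.
  by rewrite /gact /bsubst /RtoA /gactR !comp_mpolyC.
rewrite gactR_X3 trans3_map /= RtoA_X3 rmorphM /= trans3_map.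
rewrite {1}/gact /bsubst comp_mpolyC.
rewrite (@eq_trans3 _ _ _ (fun i j l => (6%:R^-1)%:MP * trans3 X9 (triangle _) i j l));
  last exact: RtoA_X3.
rewrite trans3Z; congr (_ * _); rewrite trans3_comp gact_X9.
rewrite (_ : map_mx _ (map_mx _ M) = map_mx (@mpolyC _ k) M).
  by apply: eq_trans3 => a b c; rewrite /triangle rmorph_nat.
by apply/matrixP => u v; rewrite !mxE /RtoA comp_mpolyC.
Qed.

(** The normalization makes RtoA_hess hold with coefficient 1. *)
Definition omega : T := (18%:R^-1)%:MP * \det X9 ^+ 2.

(** hess_triangle, transported by hess_trans3. *)
Lemma RtoA_hess i j l : RtoA (hess X3 i j l) = omega * RtoA (X3 i j l).
Proof.
rewrite hess_map (@eq_hess _ _ (fun i j l => (6%:R^-1)%:MP * trans3 X9 (triangle _) i j l));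
  last exact: RtoA_X3.
rewrite hess_scale hess_trans3 (@eq_trans3 _ _ _ (fun i j l => 2 * triangle _ i j l));
  last exact: hess_triangle.
rewrite trans3Z RtoA_X3 /omega.
have -> : (18%:R^-1 : k) = 2 * (6%:R^-1) ^+ 2.
  have := natk_neq0 chark 17; have := natk_neq0 chark 5; move=> *; field.
  by rewrite natk_neq0 // natk_neq0.
rewrite mpolyCM rmorphXn /= mpolyC_nat; ring.
Qed.

Lemma gact_omega (M : 'M[k]_3) : gact M omega = (\det M ^+ 2) *: omega.
Proof.
rewrite /omega rmorphM rmorphXn /= -det_map_mx gact_X9 det_mulmx det_map_mx.
by rewrite {1}/gact /bsubst comp_mpolyC -mul_mpolyC rmorphXn /=; ring.
Qed.

Lemma bperm_omega s : bperm s omega = omega.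
Proof.
rewrite /omega rmorphM rmorphXn /= -det_map_mx bperm_X9 {1}/bperm /bsubst comp_mpolyC.
rewrite row_permE det_mulmx det_perm exprMn -signr_odd -exprM mulnC exprM sqrrN.
by rewrite !expr1n mul1r.
Qed.

End Dictionary.


(** * Powers of linear forms span *)

Section PowersSpan.
Variables (k : fieldType) (chark : [pchar k] =i pred0).

Definition lin_form n (l : 'I_n -> k) : {mpoly k[n]} := \sum_a l a *: 'X_a.

(** By induction on the degree m, l^m * l' is the coefficient of t in
    (l + t l')^(m+1), up to m + 1. *)
Lemma powers_span n m (W : {mpoly k[n]} -> Prop) : subspace W ->
  (forall l, W (lin_form l ^+ m)) -> forall g, g \is m.-homog -> W g.
Proof.
elim: m W => [|m IHm] W sW Wl g gh.
  have -> : g = g@_0%MM *: (lin_form (fun=> 0) ^+ 0).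
    rewrite expr0 alg_mpolyC; apply/mpolyP => u; rewrite mcoeffC.
    case: (eqVneq u 0%MM) => [->|nu]; first by rewrite mulr1.
    by rewrite mulr0; apply: (dhomog_nemf_coeff gh); rewrite mdeg_eq0.
  exact: subspaceZ.
have WX a h : h \is m.-homog -> W (h * 'X_a).
  apply: (IHm (fun h => W (h * 'X_a))) => [|l].
    split; first by rewrite mul0r; apply: sW.1.
    by move=> c u v Wu Wv; rewrite mulrDl -scalerAl; apply: sW.2.
  pose w (i : 'I_m.+2) := lin_form l ^+ (m.+1 - i) * 'X_a ^+ i *+ 'C(m.+1, i).
  have := @curve_coef_mem _ chark _ W sW _ w _ (Ordinal (isT : 1 < m.+2)%N).
  rewrite /w /= subn1 bin1 expr1 -scaler_nat => H.
  rewrite -[X in W X](scalerK (natk_neq0 chark m)); apply: subspaceZ => //.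
  apply: H => c _; have := Wl (fun b => l b + (a == b)%:R * c).
  have -> : lin_form (fun b => l b + (a == b)%:R * c) = lin_form l + c *: 'X_a.
    rewrite /lin_form; under eq_bigr => b _ do rewrite scalerDl.
    rewrite big_split /=; congr (_ + _); rewrite (bigD1 a) //= eqxx mul1r big1 ?addr0 // => b nb.
    by rewrite eq_sym (negbTE nb) mul0r scale0r.
  rewrite exprDn; congr W; apply: eq_bigr => i _.
  by rewrite exprZn -scalerAr scalerMnr.
rewrite (mpolyE g) big_seq; apply: subspace_sum => // u ug; apply: subspaceZ => //.
have du : mdeg u = m.+1 by apply: (dhomogP _ _ _ gh).
have [a ua] : exists a, u a != 0%N.
  case: (pickP (fun a => u a != 0%N)) => [a ua|u0]; first by exists a.
  by move: du; rewrite mdegE big1 // => a _; apply/eqP; move: (u0 a) => /= /negbFE.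
rewrite -(submK (_ : U_(a) <= u)%MM) ?lep1mP // mpolyXD; apply: WX.
rewrite dhomogX -(eqn_add2r 1) -[1%N](mdeg1 a) -mdegD submK ?lep1mP //.
by rewrite du mdeg1 addn1.
Qed.

Definition row_lin d n (q : 'I_d) (l : 'I_n -> k) : {mpoly k[d * n]} :=
  \sum_a l a *: xvar q a.

(** The factors are treated one at a time by powers_span. *)
Lemma multipowers_span d n (c : 'I_d -> nat) (W : {mpoly k[d * n]} -> Prop) :
    subspace W -> (forall l : 'I_d -> 'I_n -> k, W (\prod_q row_lin q (l q) ^+ c q)) ->
  forall p, multihomog c p -> W p.
Proof.
move=> sW Wl p ph.
pose psi (q : 'I_d) (g : {mpoly k[n]}) : {mpoly k[d * n]} :=
  g \mPo [tuple xvar q a | a < n].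
have psil q l : psi q (lin_form l) = row_lin q l.
  rewrite /psi /lin_form linear_sum; apply: eq_bigr => a _.
  by rewrite linearZ /= comp_mpolyXU -tnth_nth tnth_mktuple.
suff H (A : {set 'I_d}) (G : 'I_d -> {mpoly k[n]}) :
    (forall q, G q \is (c q).-homog) ->
    (forall q, q \notin A -> exists l, G q = lin_form l ^+ c q) ->
  W (\prod_q psi q (G q)).
  rewrite (mpolyE p) big_seq; apply: subspace_sum => // m mp; apply: subspaceZ => //.
  pose G (q : 'I_d) : {mpoly k[n]} := 'X_[[multinom m (mxvec_index q a) | a < n]].
  have -> : 'X_[m] = \prod_q psi q (G q).
    rewrite mpolyXE_id (reindex _ (curry_mxvec_bij d n)) /=.
    rewrite [RHS](eq_bigr (fun q => \prod_a 'X_(mxvec_index q a) ^+ m (mxvec_index q a))).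
      by rewrite pair_bigA; apply: eq_bigr => -[].
    move=> q _; rewrite /psi comp_mpolyX; apply: eq_bigr => a _.
    by rewrite tnth_mktuple mnmE.
  apply: (H setT) => [q|q]; last by rewrite inE.
  rewrite dhomogX /= mdegE -(dhomogP _ _ _ (ph q) m mp) /bdeg.
  by apply/eqP/eq_bigr => a _; rewrite mnmE.
have [N leAN] := ubnP #|A|; elim: N A G leAN => // N IHN A G leAN Gh Gl.
have [A0|[q0 q0A]] := set_0Vmem A.
  have /fin_all_exists[l El] q : exists l, G q = lin_form l ^+ c q.
    by apply: Gl; rewrite A0 inE.
  under eq_bigr => q _ do rewrite El /psi rmorphXn /= -/(psi q _) psil.
  exact: Wl.
pose G' g q := if q == q0 then g else G q.
have G'E g : \prod_q psi q (G' g q) = psi q0 g * \prod_(q | q != q0) psi q (G q).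
  rewrite (bigD1 q0) //= /G' eqxx; congr (_ * _).
  by apply: eq_bigr => q /negbTE ->.
pose W' g := W (\prod_q psi q (G' g q)).
suff: W' (G q0).
  by rewrite /W' /G'; congr W; apply: eq_bigr => q _; case: eqP => // ->.
apply: (@powers_span _ (c q0) W') => [|l|//].
  split; first by rewrite /W' G'E /psi linear0 mul0r; apply: sW.1.
  move=> a u v; rewrite /W' !G'E /psi linearP /= mulrDl -scalerAl => Wu Wv.
  exact: sW.2.
apply: (IHN (A :\ q0)) => [|q|q].
- by move: leAN; rewrite (cardsD1 q0 A) q0A add1n ltnS.
- rewrite /G'; case: eqP => [->|//]; rewrite -[X in X.-homog]mul1n.
  apply: dhomogMn; apply: rpred_sum => a _; apply: rpredZ.
  by rewrite dhomogX /= mdeg1.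
rewrite /G' !inE; case: eqP => [-> _|_ /= /Gl //]; by exists l.
Qed.

End PowersSpan.


(** * Six products attached to a 3 x 3 matrix *)

(** Aronhold's invariant of degree 4 of a ternary cubic. *)
Definition aronhold (S : comNzRingType) (F : tensor3 S) : S :=
  F i0 i0 i0 * F i0 i1 i1 * F i1 i1 i2 * F i2 i2 i2
  - 3 * F i0 i0 i0 * F i0 i1 i1 * F i1 i2 i2 * F i1 i2 i2
  - 2 * F i0 i0 i0 * F i0 i1 i2 * F i1 i1 i1 * F i2 i2 i2
  + 6 * F i0 i0 i0 * F i0 i1 i2 * F i1 i1 i2 * F i1 i2 i2
  + F i0 i0 i0 * F i0 i2 i2 * F i1 i1 i1 * F i1 i2 i2
  - 3 * F i0 i0 i0 * F i0 i2 i2 * F i1 i1 i2 * F i1 i1 i2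
  + 2 * F i0 i0 i1 * F i0 i0 i1 * F i1 i2 i2 * F i1 i2 i2
  + 4 * F i0 i0 i1 * F i0 i0 i2 * F i1 i1 i1 * F i2 i2 i2
  - 8 * F i0 i0 i1 * F i0 i0 i2 * F i1 i1 i2 * F i1 i2 i2
  + F i0 i0 i1 * F i0 i1 i1 * F i0 i2 i2 * F i1 i2 i2
  - 4 * F i0 i0 i1 * F i0 i1 i2 * F i0 i1 i2 * F i1 i2 i2
  + 6 * F i0 i0 i1 * F i0 i1 i2 * F i0 i2 i2 * F i1 i1 i2
  - 3 * F i0 i0 i1 * F i0 i2 i2 * F i0 i2 i2 * F i1 i1 i1
  + 2 * F i0 i0 i2 * F i0 i0 i2 * F i1 i1 i2 * F i1 i1 i2
  - 3 * F i0 i0 i2 * F i0 i1 i1 * F i0 i1 i1 * F i2 i2 i2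
  + 6 * F i0 i0 i2 * F i0 i1 i1 * F i0 i1 i2 * F i1 i2 i2
  + F i0 i0 i2 * F i0 i1 i1 * F i0 i2 i2 * F i1 i1 i2
  - 4 * F i0 i0 i2 * F i0 i1 i2 * F i0 i1 i2 * F i1 i1 i2
  + 2 * F i0 i1 i1 * F i0 i1 i1 * F i0 i2 i2 * F i0 i2 i2
  - 4 * F i0 i1 i1 * F i0 i1 i2 * F i0 i1 i2 * F i0 i2 i2
  + 2 * F i0 i1 i2 * F i0 i1 i2 * F i0 i1 i2 * F i0 i1 i2.

Lemma aronhold_map (S S' : comNzRingType) (phi : {rmorphism S -> S'}) (F : tensor3 S) :
  phi (aronhold F) = aronhold (fun i j l => phi (F i j l)).
Proof. by rewrite /aronhold; ring. Qed.

Lemma eq_aronhold (S : comNzRingType) (F G : tensor3 S) :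
  (forall i j l, F i j l = G i j l) -> aronhold F = aronhold G.
Proof. by move=> E; rewrite /aronhold !E. Qed.

Section SixProducts.
Variables (S : comNzRingType) (X : 'M[S]_3).

(** The six terms of the determinant of X are p0, p1, p2 (even) and q0, q1, q2
    (odd). With s, e, D the elementary symmetric functions of the even ones and
    s', e', D of the odd ones, s - s' = det X, and s + s' is a value of tri3,
    while D is a product of three values up to a factor; esum and edif stand
    for e + e' and e - e'. *)
Definition pp (a b c : 'I_3) : S := X a i0 * X b i1 * X c i2.

Local Notation p0 := (pp i0 i1 i2).
Local Notation p1 := (pp i1 i2 i0).
Local Notation p2 := (pp i2 i0 i1).
Local Notation q0 := (pp i0 i2 i1).
Local Notation q1 := (pp i1 i0 i2).
Local Notation q2 := (pp i2 i1 i0).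

Definition tri3 (i j l : 'I_3) : S :=
  X i0 i * X i1 j * X i2 l + X i1 i * X i2 j * X i0 l + X i2 i * X i0 j * X i1 l
  + X i0 i * X i2 j * X i1 l + X i1 i * X i0 j * X i2 l + X i2 i * X i1 j * X i0 l.

Lemma trans3_triangle i j l : trans3 X (triangle _) i j l = tri3 i j l.
Proof. by rewrite /trans3 !sum3 /triangle /tri3 /=; ring. Qed.

Definition esum := p0 * p1 + p1 * p2 + p2 * p0 + (q0 * q1 + q1 * q2 + q2 * q0).
Definition edif := p0 * p1 + p1 * p2 + p2 * p0 - (q0 * q1 + q1 * q2 + q2 * q0).
Definition pprod := p0 * p1 * p2.

Definition powsum m := p0 ^+ m + p1 ^+ m + p2 ^+ m + (q0 ^+ m + q1 ^+ m + q2 ^+ m).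
Definition powdif m := p0 ^+ m + p1 ^+ m + p2 ^+ m - (q0 ^+ m + q1 ^+ m + q2 ^+ m).

Lemma detE : \det X = powdif 1.
Proof. by rewrite det3 /powdif !expr1 /pp; ring. Qed.

Lemma powsum_sum m :
  powsum m = \sum_(s : 'S_3) (X (s i0) i0 * X (s i1) i1 * X (s i2) i2) ^+ m.
Proof.
rewrite (sum_S3 (fun a b c => (X a i0 * X b i1 * X c i2) ^+ m)).
by rewrite !sum3 /= !mulr0n !mulr1n !(add0r, addr0) /powsum /pp; ring.
Qed.

Lemma powsum0 : powsum 0 = 6%:R.
Proof. by rewrite /powsum !expr0; ring. Qed.

Lemma powdif0 : powdif 0 = 0.
Proof. by rewrite /powdif !expr0 subrr. Qed.

Lemma powsum1 : powsum 1 = tri3 i0 i1 i2.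
Proof. by rewrite /powsum !expr1 /tri3 /pp; ring. Qed.

Lemma pprodE : 216 * pprod = tri3 i0 i0 i0 * tri3 i1 i1 i1 * tri3 i2 i2 i2.
Proof. rewrite /pprod /tri3 /pp; ring. Qed.

Lemma esumE : 12 * esum = \det X ^+ 2 + tri3 i0 i0 i1 * tri3 i1 i2 i2
  + tri3 i0 i0 i2 * tri3 i1 i1 i2 + tri3 i0 i1 i1 * tri3 i0 i2 i2
  - tri3 i0 i1 i2 ^+ 2.
Proof. rewrite det3 /esum /tri3 /pp; ring. Qed.

Lemma det_edifE : 8 * (\det X * edif) =
  tri3 i0 i0 i0 * (tri3 i1 i1 i1 * tri3 i2 i2 i2 - tri3 i1 i1 i2 * tri3 i1 i2 i2)
  - tri3 i0 i0 i1 * (tri3 i0 i1 i1 * tri3 i2 i2 i2 - tri3 i0 i2 i2 * tri3 i1 i1 i2)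
  + tri3 i0 i0 i2 * (tri3 i0 i1 i1 * tri3 i1 i2 i2 - tri3 i0 i2 i2 * tri3 i1 i1 i1).
Proof. rewrite det3 /edif /tri3 /pp; ring. Qed.

Lemma edif2E : 48 * edif ^+ 2 =
  - tri3 i0 i0 i0 * tri3 i0 i1 i1 * tri3 i1 i2 i2 ^+ 2
  + 2 * tri3 i0 i0 i0 * tri3 i0 i1 i2 * tri3 i1 i1 i1 * tri3 i2 i2 i2
  - tri3 i0 i0 i0 * tri3 i0 i2 i2 * tri3 i1 i1 i1 * tri3 i1 i2 i2
  - 2 * tri3 i0 i0 i1 * tri3 i0 i1 i1 * tri3 i0 i1 i2 * tri3 i2 i2 i2
  + 3 * tri3 i0 i0 i1 * tri3 i0 i1 i1 * tri3 i0 i2 i2 * tri3 i1 i2 i2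
  - tri3 i0 i0 i1 * tri3 i0 i2 i2 ^+ 2 * tri3 i1 i1 i1.
Proof. rewrite /edif /tri3 /pp; ring. Qed.

Lemma det4E : 2 * \det X ^+ 4 = aronhold tri3.
Proof. rewrite det3 /aronhold /tri3; ring. Qed.

(** The recurrence T^3 = s T^2 - e T + D for the even terms, added to the one
    for the odd terms; powdif_rec is their difference. *)
Lemma powsum_rec m : 2 * powsum m.+3 =
  tri3 i0 i1 i2 * powsum m.+2 + \det X * powdif m.+2
  - esum * powsum m.+1 - edif * powdif m.+1 + 2 * pprod * powsum m.
Proof.
by rewrite det3 /powsum /powdif /tri3 /esum /edif /pprod /pp !exprS; ring.
Qed.

Lemma powdif_rec m : 2 * powdif m.+3 =
  tri3 i0 i1 i2 * powdif m.+2 + \det X * powsum m.+2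
  - esum * powdif m.+1 - edif * powsum m.+1 + 2 * pprod * powdif m.
Proof.
by rewrite det3 /powsum /powdif /tri3 /esum /edif /pprod /pp !exprS; ring.
Qed.

Lemma powsum2 : 2 * powsum 2 = tri3 i0 i1 i2 ^+ 2 + \det X ^+ 2 - 4 * esum.
Proof. by rewrite det3 /powsum /tri3 /esum /pp; ring. Qed.

Lemma powdif2 : powdif 2 = tri3 i0 i1 i2 * \det X - 2 * edif.
Proof. by rewrite det3 /powdif /tri3 /edif /pp; ring. Qed.

End SixProducts.


(** * The ring B is generated by omega over the image of R *)

Section Surjectivity.
Variables (k : fieldType) (chark : [pchar k] =i pred0).

Local Notation T := {mpoly k[3 * 3]}.
Local Notation Rring := {mpoly k[#|basis 3 3|]}.
Local Notation X3 := (X3 k).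
Local Notation X9 := (X9 k).
Local Notation omega := (omega k).
Local Notation tau := (tri3 X9).

Definition mu (F G : Rring) : T := RtoA F + RtoA G * omega.

Definition inC (p : T) : Prop := exists F G, p = mu F G.

Lemma inC_subspace : subspace inC.
Proof.
split; first by exists 0, 0; rewrite /mu !rmorph0 mul0r addr0.
move=> a p q [F [G ->]] [F' [G' ->]]; exists (a *: F + F'), (a *: G + G').
by rewrite /mu !linearP /= scalerDr scalerAl mulrDl addrACA.
Qed.

Lemma inC_R F : inC (RtoA F).
Proof. by exists F, 0; rewrite /mu rmorph0 mul0r addr0. Qed.

Lemma scaleCn n (p : T) : (n.+1%:R^-1 : k) *: (n.+1%:R * p) = p.
Proof. by rewrite mulr_natl -scaler_nat scalerK // (natk_neq0 chark). Qed.

Lemma inC_divn n (p : T) : inC (n.+1%:R * p) -> inC p.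
Proof. by move=> Cp; rewrite -(scaleCn n p); apply: (subspaceZ inC_subspace). Qed.

Lemma tau_R i j l : tau i j l = RtoA (6 * X3 i j l).
Proof.
rewrite rmorphM rmorph_nat /= RtoA_X3 trans3_triangle mul_mpolyC -scalerAr.
by rewrite (scaleCn 5).
Qed.

Lemma aronhold_R : aronhold tau = RtoA (aronhold (fun i j l => 6 * X3 i j l)).
Proof. by rewrite aronhold_map; apply: eq_aronhold => i j l; apply: tau_R. Qed.

(** The fourth power of the determinant is Aronhold's invariant of the product
    of the rows. *)
Lemma omega2_R : exists F, omega ^+ 2 = RtoA F.
Proof.
exists ((648%:R^-1 : k) *: aronhold (fun i j l => 6 * X3 i j l)).
rewrite linearZ /= -aronhold_R -det4E mulr_natl -scaler_nat scalerA.
rewrite /omega mul_mpolyC exprZn -exprM; congr (_ *: _).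
have := (natk_neq0 chark) 17; have := (natk_neq0 chark) 647; move=> *; field.
by rewrite (natk_neq0 chark) (natk_neq0 chark).
Qed.

Lemma inCM p q : inC p -> inC q -> inC (p * q).
Proof.
have [H EH] := omega2_R.
move=> [F [G ->]] [F' [G' ->]]; exists (F * F' + G * G' * H), (F * G' + F' * G).
rewrite /mu !(rmorphD, rmorphM) /= -EH; ring.
Qed.

Lemma inC_tau i j l : inC (tau i j l).
Proof. by rewrite tau_R; apply: inC_R. Qed.

Lemma inC_nat n : inC n%:R.
Proof. by rewrite -(rmorph_nat (@RtoA k 3 3)); apply: inC_R. Qed.

Local Notation inCD := (subspaceD inC_subspace).
Local Notation inCB := (subspaceB inC_subspace).

Lemma inC_det2 : inC (\det X9 ^+ 2).
Proof.
apply: (@inC_divn 0); exists 0, 18; rewrite /mu rmorph0 add0r mul1r rmorph_nat.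
by rewrite /omega mul_mpolyC -scalerAr (scaleCn 17).
Qed.

Lemma inCN p : inC p -> inC (- p).
Proof. by rewrite -sub0r; apply: inCB; apply: inC_subspace.1. Qed.

Lemma inCX p n : inC p -> inC (p ^+ n).
Proof. by move=> Cp; elim: n => [|n IHn]; [apply: (inC_nat 1) | rewrite exprS; apply: inCM]. Qed.

Lemma inC1 : inC 1. Proof. exact: (inC_nat 1). Qed.

Ltac inC_auto := repeat match goal with
  | H : inC ?p |- inC ?p => exact H
  | |- inC (tri3 _ _ _ _) => apply: inC_tau
  | |- inC (\det _ ^+ 2) => apply: inC_det2
  | |- inC 1 => exact: inC1
  | |- inC (_%:R) => apply: inC_nat
  | |- inC (- _) => apply: inCN
  | |- inC (_ - _) => apply: inCB
  | |- inC (_ + _) => apply: inCD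
  | |- inC (_ ^+ _) => apply: inCX
  | |- inC (_ * _) => apply: inCM
  end.

Lemma inC_esum : inC (esum X9).
Proof. by apply: (@inC_divn 11); rewrite esumE; inC_auto. Qed.

Lemma inC_det_edif : inC (\det X9 * edif X9).
Proof. by apply: (@inC_divn 7); rewrite det_edifE; inC_auto. Qed.

Lemma inC_edif2 : inC (edif X9 ^+ 2).
Proof. by apply: (@inC_divn 47); rewrite edif2E; inC_auto. Qed.

Lemma inC_pprod : inC (pprod X9).
Proof. by apply: (@inC_divn 215); rewrite pprodE; inC_auto. Qed.

(** By the recurrences, with the companion claim that the differences of power
    sums are combinations of det X and edif with coefficients in the subring:
    the products det X * edif and edif^2 lie in it. *)
Lemma inC_powsum m : inC (powsum X9 m).
Proof.
pose Q m := inC (powsum X9 m) /\ exists u v,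
  [/\ inC u, inC v & powdif X9 m = u * \det X9 + v * edif X9].
have C0 : inC 0 by exact: inC_subspace.1.
have Ces := inC_esum; have Cpp := inC_pprod; have Cdd := inC_det2.
have Cde := inC_det_edif; have Cee := inC_edif2.
suff: [/\ Q m, Q m.+1 & Q m.+2] by case=> -[].
elim: m => [|m [Q0 Q1 Q2]].
  split; split.
  - by rewrite powsum0; apply: inC_nat.
  - by exists 0, 0; split; [exact: C0 | exact: C0 | rewrite powdif0 !mul0r addr0].
  - by rewrite powsum1; inC_auto.
  - exists 1, 0; split=> //; first exact: inC1.
    by rewrite -detE mul0r addr0 mul1r.
  - by apply: (@inC_divn 1); rewrite powsum2; inC_auto.
  - exists (tau i0 i1 i2), (- 2); split; [by inC_auto | by inC_auto |].
    by rewrite powdif2 mulNr.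
split=> //; case: Q0 Q1 Q2 => [A0 [u0 [v0 [Cu0 Cv0 E0]]]] [A1 [u1 [v1 [Cu1 Cv1 E1]]]]
  [A2 [u2 [v2 [Cu2 Cv2 E2]]]]; split.
  apply: (@inC_divn 1); rewrite powsum_rec E1 E2.
  have -> : \det X9 * (u2 * \det X9 + v2 * edif X9) =
    u2 * \det X9 ^+ 2 + v2 * (\det X9 * edif X9) by ring.
  have -> : edif X9 * (u1 * \det X9 + v1 * edif X9) =
    u1 * (\det X9 * edif X9) + v1 * edif X9 ^+ 2 by ring.
  by inC_auto.
have E3 := powdif_rec X9 m.
pose u := tau i0 i1 i2 * u2 + powsum X9 m.+2 - esum X9 * u1 + 2 * pprod X9 * u0.
pose v := tau i0 i1 i2 * v2 - esum X9 * v1 - powsum X9 m.+1 + 2 * pprod X9 * v0.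
exists (2%:R^-1 *: u), (2%:R^-1 *: v); split.
- by apply: (subspaceZ inC_subspace); rewrite /u; inC_auto.
- by apply: (subspaceZ inC_subspace); rewrite /v; inC_auto.
rewrite -(scaleCn 1 (powdif _ _)) E3 E0 E1 E2 -!scalerAl -scalerDr; congr (_ *: _).
by rewrite /u /v; ring.
Qed.

Lemma inC_gact M p : inC p -> inC (gact M p).
Proof.
move=> [F [G ->]]; exists (gactR M F), (\det M ^+ 2 *: gactR M G).
rewrite /mu rmorphD rmorphM /= -!RtoA_gactR linearZ /= gact_omega //.
by rewrite -scalerAr -scalerAl.
Qed.

(** The symmetrizations of the a^m (x) b^m (x) c^m span the part of degree m of
    B, and each of them is the translate of a power sum of the six terms of
    det X9 by a matrix with columns a, b, c. *)
Lemma B_inC (p : T) : p \in @Bpred k 3 3 -> inC p.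
Proof.
move=> /BP[Ap Hp].
suff Hsym m : m \in msupp p -> inC (\sum_(s : 'S_3) bperm s 'X_[m]).
  have Ep : p = (6%:R^-1 : k) *: \sum_(s : 'S_3) bperm s p.
    under eq_bigr => s _ do rewrite Hp.
    by rewrite sumr_const card_Sn (_ : 3`! = 6)%N // -scaler_nat scalerK // (natk_neq0 chark).
  rewrite Ep; apply: (subspaceZ inC_subspace); rewrite {1}(mpolyE p).
  under eq_bigr => s _ do rewrite linear_sum /=.
  rewrite exchange_big /= big_seq; apply: (subspace_sum inC_subspace) => m mp.
  under eq_bigr => s _ do rewrite linearZ /=.
  by rewrite -scaler_sumr; apply: (subspaceZ inC_subspace); apply: Hsym.
move=> mp; pose c := bdeg i0 m.
apply: (multipowers_span chark (c := fun=> c)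
  (W := fun q => inC (\sum_(s : 'S_3) bperm s q))).
- split; first by rewrite big1 => [|s _]; [exact: inC_subspace.1 | rewrite rmorph0].
  move=> a u v Cu Cv; under eq_bigr => s _ do rewrite linearP /=.
  by rewrite big_split -scaler_sumr; apply: inC_subspace.2.
- move=> l; have := inC_gact (\matrix_(b, a) l a b) (inC_powsum c).
  congr inC; rewrite powsum_sum rmorph_sum; apply: eq_bigr => s _.
  rewrite rmorphXn !rmorphM /= !rmorph_prod prod3 /= !exprMn.
  have E q : bperm s (row_lin q (l q)) = gact (\matrix_(b, a) l a b) (X9 (s q) q).
    rewrite mxE gact_xvar linear_sum; apply: eq_bigr => a _.
    by rewrite linearZ /= bperm_xvar mxE.
  by rewrite !rmorphXn /= !E.
by move=> i; rewrite dhomogX /=; apply/eqP/(AP _ Ap).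
Qed.

End Surjectivity.


(** * Reduction modulo seven linear forms *)

Section ShiftedDegree.
Variables (k : fieldType) (n : nat).
Implicit Types (p q : {mpoly k[n]}).

(** Degree m in the twist by - d: a nonzero p must have degree m - d. *)
Definition hm d m p : Prop := forall t, t \in msupp p -> (mdeg t + d)%N = m.

Lemma hm_subspace d m : subspace (hm d m).
Proof.
split; first by move=> t; rewrite msupp0.
move=> a p q Hp Hq t /msuppD_le; rewrite mem_cat => /orP[/msuppZ_le|]; auto.
Qed.

Lemma hm0P m p : hm 0 m p <-> p \is m.-homog.
Proof.
split=> [H|/dhomogP H t /H]; last by rewrite addn0.
by apply/dhomogP => t /H; rewrite addn0.
Qed.

Lemma hm_homog d e p : hm d (e + d) p <-> p \is e.-homog.
Proof.
split=> [H|/dhomogP H t /H -> //].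
by apply/dhomogP => t /H /addIn.
Qed.

Lemma hm_small d m p : (m < d)%N -> hm d m p -> p = 0.
Proof.
move=> lt_md H; apply/eqP; rewrite -msupp_eq0.
case E: (msupp p) => [//|t s].
have := H t; rewrite E mem_head => /(_ isT) Em.
by move: lt_md; rewrite -Em ltnNge leq_addl.
Qed.

Lemma hmM d d' m m' p q : hm d m p -> hm d' m' q -> hm (d + d') (m + m') (p * q).
Proof.
move=> Hp Hq t /msuppM_le /allpairsP[[t1 t2] /= [/Hp <- /Hq <- ->]].
by rewrite mdegD addnACA.
Qed.

Lemma hmX i : hm 0 1 ('X_i : {mpoly k[n]}).
Proof. by apply/hm0P; rewrite dhomogX /= mdeg1. Qed.

End ShiftedDegree.

Section Module.
Variables (k : fieldType) (chark : [pchar k] =i pred0).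

Local Notation N3 := #|basis 3 3|.
Local Notation Rring := {mpoly k[#|basis 3 3|]}.
Local Notation X3 := (X3 k).

(** The coefficients of the Hessian of the generic cubic. *)
Definition hX (l : 'I_N3) : Rring :=
  hess X3 (tnth (word l) i0) (tnth (word l) i1) (tnth (word l) i2).

Lemma hX_idx3 i j l : hX (idx3 i j l) = hess X3 i j l.
Proof.
move: i j l; apply: forall3; apply: forall3; apply: forall3;
  by rewrite /hX word_idx3 !(tnth_nth i0) /= ?(sorted3 (@hess_sym _ X3)).
Qed.


Lemma det_homog n (A : 'M[{mpoly k[n]}]_3) :
  (forall i j, A i j \is 1.-homog) -> \det A \is 3.-homog.
Proof.
move=> hA; have h2 i j i' j' : A i j * A i' j' \is 2.-homog by apply: (@dhomogM _ _ _ 1 _ 1).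
have h3 i j q : q \is 2.-homog -> A i j * q \is 3.-homog by move=> hq; apply: (@dhomogM _ _ _ 1 _ 2).
by rewrite det3 rpredD ?rpredB ?h3 ?rpredB.
Qed.

Lemma hX_homog l : hX l \is 3.-homog.
Proof.
have hs i u v : slice X3 i u v \is 1.-homog by rewrite mxE dhomogX /= mdeg1.
have hD (A B : 'M[Rring]_3) : (forall u v, A u v \is 1.-homog) ->
    (forall u v, B u v \is 1.-homog) -> forall u v, (A + B) u v \is 1.-homog.
  by move=> hA hB u v; rewrite mxE rpredD.
rewrite /hX /hess /mixdet.
do ![apply: rpredD | rewrite rpredN]; apply: det_homog;
  repeat first [exact (hs _) | apply hD].
Qed.

(** The polarization of 3 q l, for q = x^2 + y^2 + z^2 and l = a0 x + a1 y + a2 z. *)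
Definition qtens (S : comNzRingType) (a : 'I_3 -> S) : tensor3 S := fun i j l =>
  (i == j)%:R * a l + (j == l)%:R * a i + (i == l)%:R * a j.

Lemma qtens_sym (S : comNzRingType) (a : 'I_3 -> S) : sym3 (qtens a).
Proof.
move=> i j l; rewrite /qtens (eq_sym j i) (eq_sym l j); split; ring.
Qed.

Lemma hess_qtens (S : comNzRingType) (a : 'I_3 -> S) i j l :
  hess (qtens a) i j l = 24 * (a i * a j * a l)
    - 2 * (a i0 ^+ 2 + a i1 ^+ 2 + a i2 ^+ 2) * qtens a i j l.
Proof.
move: i j l; apply: (sym3_ext (G := fun i j l => 24 * (a i * a j * a l)
    - 2 * (a i0 ^+ 2 + a i1 ^+ 2 + a i2 ^+ 2) * qtens a i j l)).
- exact: hess_sym.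
- by move=> i j l; rewrite -(qtens_sym a i j l).1 -(qtens_sym a i j l).2; split; ring.
all: rewrite /hess !mixdetE !mxE /qtens /=; ring.
Qed.

End Module.


Section Reduction.
Variables (k : fieldType) (chark : [pchar k] =i pred0).

Local Notation N3 := #|basis 3 3|.
Local Notation Rring := {mpoly k[#|basis 3 3|]}.
Local Notation X3 := (X3 k).
Local Notation A3 := {mpoly k[3]}.
Local Notation S7 := {mpoly k[7]}.

Definition theta : 7.-tuple Rring := [tuple X3 i0 i1 i2;
  X3 i0 i2 i2 - X3 i0 i1 i1; X3 i1 i2 i2 - X3 i0 i0 i1; X3 i1 i1 i2 - X3 i0 i0 i2;
  X3 i0 i0 i0 - 3 * X3 i0 i1 i1; X3 i1 i1 i1 - 3 * X3 i0 i0 i1;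
  X3 i2 i2 i2 - 3 * X3 i0 i0 i2].

Definition avar : 3.-tuple Rring := [tuple X3 i0 i1 i1; X3 i0 i0 i1; X3 i0 i0 i2].

(** Restriction to the cubics (x^2 + y^2 + z^2) * l. *)
Definition rho : Rring -> A3 := comp_mpoly
  [tuple qtens (fun j => 'X_j) (tnth (word l) i0) (tnth (word l) i1) (tnth (word l) i2)
   | l < N3].
HB.instance Definition _ := GRing.LRMorphism.on rho.

Definition asub : A3 -> Rring := comp_mpoly avar.
HB.instance Definition _ := GRing.LRMorphism.on asub.

Definition tsub : S7 -> Rring := comp_mpoly theta.
HB.instance Definition _ := GRing.LRMorphism.on tsub.

Lemma rho_X3 i j l : rho (X3 i j l) = qtens (fun j => 'X_j) i j l.
Proof.
rewrite /rho comp_mpolyXU -tnth_nth tnth_mktuple word_idx3.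
move: i j l; apply: forall3; apply: forall3; apply: forall3;
  by rewrite !(tnth_nth i0) /= ?(sorted3 (qtens_sym _)).
Qed.

Lemma rho_hess i j l : rho (hess X3 i j l) =
  24 * ('X_i * 'X_j * 'X_l) - 2 * ('X_i0 ^+ 2 + 'X_i1 ^+ 2 + 'X_i2 ^+ 2)
    * qtens (fun j => 'X_j) i j l.
Proof. by rewrite hess_map (eq_hess (G := qtens (fun j => 'X_j))) ?hess_qtens //; apply: rho_X3. Qed.

Lemma asub_X i : asub 'X_i = tnth avar i.
Proof. by rewrite /asub comp_mpolyXU -tnth_nth. Qed.

Lemma tsub_X i : tsub 'X_i = tnth theta i.
Proof. by rewrite /tsub comp_mpolyXU -tnth_nth. Qed.

Lemma comp_homog n m (t : n.-tuple {mpoly k[m]}) d p :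
  (forall i, tnth t i \is 1.-homog) -> p \is d.-homog -> p \mPo t \is d.-homog.
Proof.
move=> ht /dhomogP hp; rewrite comp_mpolyEX big_seq; apply: rpred_sum => u up.
apply: rpredZ; rewrite comp_mpolyX -(hp _ up) /= mdegE.
elim/big_ind2: _ => [|a p1 b p2 h1 h2|i _].
- exact: dhomog1.
- exact: dhomogM.
by have := dhomogMn (u i) (ht i); rewrite mul1n.
Qed.

Lemma X3_homog i j l : X3 i j l \is 1.-homog.
Proof. by rewrite dhomogX /= mdeg1. Qed.

Lemma theta_homog i : tnth theta i \is 1.-homog.
Proof.
have h3 x : x \is 1.-homog -> (3 * x : Rring) \is 1.-homog.
  by move=> hx; rewrite mulr_natl rpredMn.
case: i => -[|[|[|[|[|[|[|//]]]]]]] lt_i; rewrite (tnth_nth 0) /=;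
  rewrite ?rpredB ?h3 ?X3_homog //.
Qed.

Lemma avar_homog i : tnth avar i \is 1.-homog.
Proof. by case: i => -[|[|[|//]]] lt_i; rewrite (tnth_nth 0) /= X3_homog. Qed.

Lemma asub_rho_X3 a b c : asub (rho (X3 a b c)) = qtens (tnth avar) a b c.
Proof. by rewrite rho_X3 /qtens !(rmorphD, rmorphM, rmorph_nat) /= !asub_X. Qed.

(** The seven forms theta vanish on the cubics (x^2 + y^2 + z^2) * l, on which
    avar gives the coordinates of l; together they span the variables. *)
Lemma X_red l : exists c : 'I_7 -> k,
  'X_l = asub (rho 'X_l) + \sum_i c i *: tnth theta i.
Proof.
pose P a b c := exists v : 'I_7 -> k,
  X3 a b c - asub (rho (X3 a b c)) = \sum_i v i *: tnth theta i.
suff H a b c : P a b c.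
  have [v E] := H (tnth (word l) i0) (tnth (word l) i1) (tnth (word l) i2).
  by exists v; rewrite [in RHS](idx3_word l) -E addrC subrK [in LHS](idx3_word l).
have PC1 x y z : P y x z -> P x y z by rewrite /P (X3_sym k x y z).1.
have PC2 x y z : P x z y -> P x y z by rewrite /P (X3_sym k x y z).2.
have Pth i x y z : X3 x y z - qtens (tnth avar) x y z = tnth theta i -> P x y z.
  rewrite /P asub_rho_X3 => ->; exists (fun j => (j == i)%:R).
  rewrite (bigD1 i) //= eqxx scale1r big1 ?addr0 // => j /negbTE ->.
  by rewrite scale0r.
have P0 x y z : X3 x y z - qtens (tnth avar) x y z = 0 -> P x y z.
  rewrite /P asub_rho_X3 => ->; exists (fun=> 0).
  by rewrite big1 // => *; rewrite scale0r.
have P000 : P i0 i0 i0.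
  by apply: (Pth (@Ordinal 7 4 isT)); rewrite /qtens !(tnth_nth 0) /=; ring.
have P111 : P i1 i1 i1.
  by apply: (Pth (@Ordinal 7 5 isT)); rewrite /qtens !(tnth_nth 0) /=; ring.
have P222 : P i2 i2 i2.
  by apply: (Pth (@Ordinal 7 6 isT)); rewrite /qtens !(tnth_nth 0) /=; ring.
have P012 : P i0 i1 i2.
  by apply: (Pth (@Ordinal 7 0 isT)); rewrite /qtens !(tnth_nth 0) /=; ring.
have P022 : P i0 i2 i2.
  by apply: (Pth (@Ordinal 7 1 isT)); rewrite /qtens !(tnth_nth 0) /=; ring.
have P122 : P i1 i2 i2.
  by apply: (Pth (@Ordinal 7 2 isT)); rewrite /qtens !(tnth_nth 0) /=; ring.
have P112 : P i1 i1 i2.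
  by apply: (Pth (@Ordinal 7 3 isT)); rewrite /qtens !(tnth_nth 0) /=; ring.
have P011 : P i0 i1 i1 by apply: P0; rewrite /qtens !(tnth_nth 0) /=; ring.
have P001 : P i0 i0 i1 by apply: P0; rewrite /qtens !(tnth_nth 0) /=; ring.
have P002 : P i0 i0 i2 by apply: P0; rewrite /qtens !(tnth_nth 0) /=; ring.
exact: sym3_ind.
Qed.

Lemma asub_rho_homog l : asub (rho 'X_l) \is 1.-homog.
Proof.
have -> : 'X_l = X3 (tnth (word l) i0) (tnth (word l) i1) (tnth (word l) i2).
  by rewrite [in LHS](idx3_word l).
rewrite asub_rho_X3 /qtens.
by rewrite !rpredD // mulr_natl rpredMn ?avar_homog.
Qed.

(** By induction on the degree of a monomial, reducing its variables one at a
    time by X_red. *)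
Lemma red_theta d m F : hm d m.+1 F ->
  exists P : 'I_7 -> Rring, (forall i, hm d m (P i)) /\
    F = asub (rho F) + \sum_i tnth theta i * P i.
Proof.
pose Q d m F := exists P : 'I_7 -> Rring, (forall i, hm d m (P i)) /\
  F - asub (rho F) = \sum_i tnth theta i * P i.
have sQ e n : subspace (Q e n).
  split.
    exists (fun=> 0); split=> [i|]; first exact: (hm_subspace _ _ _ _).1.
    by rewrite !rmorph0 subr0 big1 // => i _; rewrite mulr0.
  move=> a u v [P [hP EP]] [P' [hP' EP']]; exists (fun i => a *: P i + P' i).
  split=> [i|]; first exact: (hm_subspace _ _ _ _).2.
  rewrite !linearP /= addrACA -scalerDr EP EP' scaler_sumr -big_split /=.
  by apply: eq_bigr => i _; rewrite mulrDr scalerAr.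
suff H : hm d m.+1 F -> Q d m F.
  by move=> /H[P [hP EP]]; exists P; split=> //; rewrite -EP addrC subrK.
move=> hF; rewrite (mpolyE F) big_seq; apply: subspace_sum => // u uF.
apply: subspaceZ => //; have {hF uF} du := hF u uF.
suff [P [hP EP]] : Q 1%N (mdeg u) 'X_[u].
  exists P; split=> // i t /hP; rewrite addn1 => Et.
  by move: du; rewrite -Et addSn => -[].
suff H e v : mdeg v = e -> Q 1%N e 'X_[v] by apply: H.
elim: e v => [|e IHe] v.
  move/eqP; rewrite mdeg_eq0 => /eqP ->; rewrite mpolyX0.
  exists (fun=> 0); split=> [i|]; first exact: (hm_subspace _ _ _ _).1.
  by rewrite !rmorph1 subrr big1 // => i _; rewrite mulr0.
move=> dv; have [l vl] : exists l, v l != 0%N.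
  case: (pickP (fun l => v l != 0%N)) => [l vl|v0]; first by exists l.
  by move: dv; rewrite mdegE big1 // => l _; apply/eqP; move: (v0 l) => /= /negbFE.
rewrite -(submK (_ : U_(l) <= v)%MM) ?lep1mP //; set w := (v - _)%MM.
have dw : mdeg w = e.
  apply/eqP; rewrite -(eqn_add2r 1) -[X in (_ + X)%N](mdeg1 l) -mdegD submK ?lep1mP //.
  by rewrite dv addn1.
have [P [hP EP]] := IHe w dw; have [c Ec] := X_red l.
exists (fun i => c i *: 'X_[w] + asub (rho 'X_l) * P i); split=> [i|].
  apply: (hm_subspace _ _ _ _).2; first by move=> t; rewrite msuppX inE => /eqP ->; rewrite dw addn1.
  by apply: (@hmM _ _ 0 1 1 e) => //; apply/hm0P/asub_rho_homog.
rewrite addmC mpolyXD !rmorphM /=.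
have split_diff (x y x' y' : Rring) : x * y - x' * y' = (x - x') * y + x' * (y - y') by ring.
rewrite split_diff.
have -> : 'X_l - asub (rho 'X_l) = \sum_i c i *: tnth theta i.
  by rewrite {1}Ec addrC addKr.
rewrite EP mulr_suml mulr_sumr -big_split /=.
by apply: eq_bigr => i _; rewrite -!mul_mpolyC; ring.
Qed.

End Reduction.


(** * The presentation of B as an R-module *)

Section Nakayama.
Variables (k : fieldType) (chark : [pchar k] =i pred0).

Local Notation N3 := #|basis 3 3|.
Local Notation Rring := {mpoly k[#|basis 3 3|]}.
Local Notation S7 := {mpoly k[7]}.
Local Notation hX := (hX k).
Local Notation theta := (theta k).
Local Notation rho := (@rho k).
Local Notation asub := (@asub k).
Local Notation tsub := (@tsub k).
Local Notation V := (Rring * Rring)%type.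

Definition sm (r : Rring) (x : V) : V := (r * x.1, r * x.2).

Lemma smD r x y : sm r (x + y) = sm r x + sm r y.
Proof. by rewrite /sm /= !mulrDr. Qed.
Lemma smDl r s x : sm (r + s) x = sm r x + sm s x.
Proof. by rewrite /sm /= !mulrDl. Qed.
Lemma smZl r a x : sm (a *: r) x = a *: sm r x.
Proof. by rewrite /sm; congr pair => /=; rewrite -scalerAl. Qed.
Lemma smA r s x : sm r (sm s x) = sm (r * s) x.
Proof. by rewrite /sm /= !mulrA. Qed.
Lemma smN r x : sm r (- x) = - sm r x.
Proof. by rewrite /sm /= !mulrN. Qed.
Lemma sm0 r : sm r 0 = 0.
Proof. by rewrite /sm /= mulr0. Qed.
Lemma sm0l x : sm 0 x = 0.
Proof. by rewrite /sm !mul0r. Qed.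
Lemma sm_sum r (I : finType) (F : I -> V) : sm r (\sum_i F i) = \sum_i sm r (F i).
Proof. by elim/big_ind2: _ => [|x y u v <- <-|//]; rewrite ?sm0 ?smD. Qed.

(** A pair (F, G) stands for F + G w, where w has degree 2. *)
Definition vdeg m (x : V) : Prop := hm 0 m x.1 /\ hm 2 m x.2.

(** The relations h_l = w X_l, where w stands for omega. *)
Definition nrel l : V := (hX l, - 'X_l).

Definition Nrel m (x : V) : Prop := exists a : 'I_N3 -> Rring,
  (forall l, hm 3 m (a l)) /\ x = \sum_l sm (a l) (nrel l).

Lemma Nrel_subspace m : subspace (Nrel m).
Proof.
split.
  exists (fun=> 0); split=> [l|]; first exact: (hm_subspace _ _ _ _).1.
  by rewrite big1 // => l _; rewrite sm0l.
move=> c x y [a [ha ->]] [b [hb ->]]; exists (fun l => c *: a l + b l).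
split=> [l|]; first exact: (hm_subspace _ _ _ _).2.
by rewrite scaler_sumr -big_split; apply: eq_bigr => l _; rewrite smDl smZl.
Qed.

Lemma Nrel_sm d m r x : r \is d.-homog -> Nrel m x -> Nrel (m + d) (sm r x).
Proof.
move=> hr [a [ha ->]]; exists (fun l => r * a l); split=> [l|].
  by rewrite addnC; apply: (@hmM _ _ 0 3 d m) => //; apply/hm0P.
by rewrite sm_sum; apply: eq_bigr => l _; rewrite smA.
Qed.

Lemma Nrel_gen m g l : hm 3 m g -> Nrel m (sm g (nrel l)).
Proof.
move=> hg; exists (fun i => if i == l then g else 0); split=> [i|].
  by case: eqP => // _; apply: (hm_subspace _ _ _ _).1.
by rewrite (bigD1 l) //= eqxx big1 ?addr0 // => i /negbTE ->; rewrite sm0l.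
Qed.

Local Notation av i := (tnth (avar k) i).

(** Generators, over k[theta], of (R + R w) / (h_l - w X_l): these pairs are a
    basis of its reduction modulo theta, with Hilbert function 1, 3, 7, 3, 1. *)
Definition bgen : 15.-tuple V := [tuple (1, 0); (av i0, 0); (av i1, 0); (av i2, 0);
  (av i0 * av i0, 0); (av i0 * av i1, 0); (av i0 * av i2, 0); (av i1 * av i1, 0);
  (av i1 * av i2, 0); (av i2 * av i2, 0); (0, 1);
  (av i0 ^+ 3, 0); (av i1 ^+ 3, 0); (av i2 ^+ 3, 0); (av i0 ^+ 4, 0)].

Definition bdeg15 : 15.-tuple nat := [tuple 0; 1; 1; 1; 2; 2; 2; 2; 2; 2; 2; 3; 3; 3; 4]%N.

Local Notation bg j := (tnth bgen j).
Local Notation dg j := (tnth bdeg15 j).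

Definition Zspan m (x : V) : Prop := exists s : 'I_15 -> S7,
  (forall j, hm (dg j) m (s j)) /\ Nrel m (x - \sum_j sm (tsub (s j)) (bg j)).

Lemma Zspan_subspace m : subspace (Zspan m).
Proof.
split.
  exists (fun=> 0); split=> [l|]; first exact: (hm_subspace _ _ _ _).1.
  rewrite big1 => [|l _]; first by rewrite subr0; apply: (Nrel_subspace _).1.
  by rewrite rmorph0 sm0l.
move=> c x y [a [ha Ea]] [b [hb Eb]]; exists (fun l => c *: a l + b l).
split=> [l|]; first exact: (hm_subspace _ _ _ _).2.
rewrite (eq_bigr (fun j => c *: sm (tsub (a j)) (bg j) + sm (tsub (b j)) (bg j))); last first.
  by move=> j _; rewrite linearP /= smDl smZl.
rewrite big_split -scaler_sumr opprD addrACA -scalerBr.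
exact: (Nrel_subspace _).2 c _ _ Ea Eb.
Qed.

Lemma Zspan_Nrel m x : Nrel m x -> Zspan m x.
Proof.
move=> Nx; exists (fun=> 0); split=> [l|]; first exact: (hm_subspace _ _ _ _).1.
by rewrite big1 ?subr0 // => l _; rewrite rmorph0 sm0l.
Qed.

Lemma Zspan_theta m i x : Zspan m x -> Zspan m.+1 (sm (tnth theta i) x).
Proof.
move=> [s [hs Ns]]; exists (fun j => 'X_i * s j); split=> [j|].
  by apply: (@hmM _ _ 0 (dg j) 1 m) => //; apply: hmX.
rewrite (eq_bigr (fun j => sm (tnth theta i) (sm (tsub (s j)) (bg j)))).
  rewrite -sm_sum -smN -smD -addn1; apply: Nrel_sm => //; exact: theta_homog.
by move=> j _; rewrite smA rmorphM /= tsub_X.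
Qed.

Lemma Zspan_gen m j : dg j = m -> Zspan m (bg j).
Proof.
move=> dj; exists (fun i => (i == j)%:R); split=> [i t|].
  case: eqP => [->|_]; last by rewrite msupp0.
  by rewrite msupp1 inE => /eqP ->; rewrite mdeg0 add0n.
rewrite (bigD1 j) //= eqxx rmorph1 big1 ?addr0 => [|i /negbTE ->]; last first.
  by rewrite rmorph0 sm0l.
by rewrite /sm !mul1r -surjective_pairing subrr; apply: (Nrel_subspace _).1.
Qed.

Section Step.
Variables (m : nat) (IH : forall x, vdeg m x -> Zspan m x).
Local Notation d := m.+1.
Let sZ := Zspan_subspace d.

(** The difference is a combination of theta with coefficients of lower degree,
    to which IH applies. *)
Lemma Zspan_red F G : hm 0 d F -> hm 2 d G ->
  Zspan d (asub (rho F), asub (rho G)) <-> Zspan d (F, G).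
Proof.
move=> hF hG; have [P [hP EP]] := red_theta hF; have [Q [hQ EQ]] := red_theta hG.
have E : (F, G) = (asub (rho F), asub (rho G)) + \sum_i sm (tnth theta i) (P i, Q i).
  have -> : \sum_i sm (tnth theta i) (P i, Q i) =
      (\sum_i tnth theta i * P i, \sum_i tnth theta i * Q i).
    by elim/big_ind3: _ => // x1 y1 z1 x2 y2 z2 -> ->.
  by rewrite {1}EP {1}EQ.
have Zt : Zspan d (\sum_i sm (tnth theta i) (P i, Q i)).
  by apply: (subspace_sum sZ) => i _; apply/Zspan_theta/IH; split; [apply: hP | apply: hQ].
split=> Z; first by rewrite E; apply: (subspaceD sZ).
by rewrite -[X in Zspan _ X](addrK (\sum_i sm (tnth theta i) (P i, Q i))) -E; apply: (subspaceB sZ).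
Qed.
End Step.
End Nakayama.


Section GradedNakayama.
Variables (k : fieldType) (chark : [pchar k] =i pred0).

Local Notation Rring := {mpoly k[#|basis 3 3|]}.
Local Notation X3 := (X3 k).
Local Notation A3 := {mpoly k[3]}.
Local Notation hX := (hX k).
Local Notation rho := (@rho k).
Local Notation asub := (@asub k).
Local Notation V := (Rring * Rring)%type.

Lemma rho_asub g : rho (asub g) = g.
Proof.
suff E : rho \o asub =1 idfun by exact: E.
apply: mpoly_ext_X => [c|i] /=; first by rewrite /rho /asub !comp_mpolyC.
rewrite asub_X; move: i; apply: forall3; rewrite (tnth_nth 0) /= rho_X3 /qtens /=; ring.
Qed.

Lemma hm_mul_homog n c e d' (p q : {mpoly k[n]}) :
  hm (c + e) d' p -> q \is e.-homog -> hm c d' (p * q).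
Proof.
move=> hp /dhomogP hq t /msuppM_le /allpairsP[[t1 t2] /= [/hp <- /hq <- ->]].
by rewrite mdegD -addnA (addnC c).
Qed.

Lemma hm_asub c d g : hm c d g -> hm c d (asub g).
Proof.
have [le_cd|lt_dc] := leqP c d; last first.
  by move=> /(hm_small lt_dc) ->; rewrite rmorph0; apply: (hm_subspace _ _ _ _).1.
rewrite -(subnK le_cd) => /hm_homog hg; apply/hm_homog.
by apply: comp_homog => //; apply: avar_homog.
Qed.

Lemma hm_rho c d p : hm c d p -> hm c d (rho p).
Proof.
have [le_cd|lt_dc] := leqP c d; last first.
  by move=> /(hm_small lt_dc) ->; rewrite rmorph0; apply: (hm_subspace _ _ _ _).1.
rewrite -(subnK le_cd) => /hm_homog hg; apply/hm_homog.
apply: comp_homog => // l; rewrite tnth_mktuple /qtens.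
have h1 i : ('X_i : A3) \is 1.-homog by rewrite dhomogX /= mdeg1.
by rewrite !rpredD // mulr_natl rpredMn.
Qed.

Section Step.
Variables (m : nat) (IH : forall x : V, vdeg m x -> Zspan m x).
Local Notation d := m.+1.
Let sZ := Zspan_subspace k d.
Local Notation I q := (Zspan d (asub q, 0)).
Local Notation Q := ('X_i0 ^+ 2 + 'X_i1 ^+ 2 + 'X_i2 ^+ 2 : A3).

Lemma I_add p q : I p -> I q -> I (p + q).
Proof.
move=> Ip Iq; have := subspaceD sZ Ip Iq.
by congr Zspan; congr pair; rewrite ?rmorphD ?addr0.
Qed.

Lemma I_scale c p : I p -> I (c *: p).
Proof.
move=> Ip; have := subspaceZ sZ c Ip.
by congr Zspan; congr pair; rewrite ?linearZ ?scaler0.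
Qed.

Lemma I_nat n p : I (n.+1%:R * p) -> I p.
Proof.
move=> Ip; rewrite -[p](scalerK (natk_neq0 chark n)).
by apply: I_scale; rewrite scaler_nat -mulr_natl.
Qed.

Lemma I_natM n p : I p -> I (n%:R * p).
Proof. by move=> Ip; rewrite mulr_natl -scaler_nat; apply: I_scale. Qed.

Lemma I_sub p q : I p -> I q -> I (p - q).
Proof. by move=> Ip Iq; rewrite -scaleN1r; exact: I_add Ip (I_scale _ Iq). Qed.

(** The relation h_l = w X_l modulo theta, multiplied by g: the Hessian of a
    conic times a line is known by hess_qtens. *)
Lemma Zspan_rel g i j l : hm 3 d g ->
  Zspan d (asub (g * (24 * ('X_i * 'X_j * 'X_l) - 2 * Q * qtens (fun j => 'X_j) i j l)),
           - asub (g * qtens (fun j => 'X_j) i j l)).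
Proof.
move=> hg; have hag := hm_asub hg.
have hF : hm 0 d (asub g * hX (idx3 i j l)).
  by apply: (@hm_mul_homog _ 0 3) => //; apply: hX_homog.
have hG : hm 2 d (asub g * - 'X_(idx3 i j l)).
  by apply: (@hm_mul_homog _ 2 1) => //; rewrite rpredN dhomogX /= mdeg1.
have /(Zspan_red IH hF hG).2 := Zspan_Nrel (Nrel_gen (idx3 i j l) hag).
congr Zspan; congr pair.
  by rewrite rmorphM /= rho_asub hX_idx3 rho_hess.
rewrite mulrN !rmorphN /=; congr (- _); by rewrite rmorphM /= rho_asub -[mpolyX _ _]/(X3 i j l) rho_X3.
Qed.

Local Notation x i := ('X_i : A3).

(** From the relation h_l = w X_l for the coefficient of xyz: there X_l reduces
    to 0 modulo theta. *)
Lemma I_xyz g : hm 3 d g -> I (g * (x i0 * x i1 * x i2)).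
Proof.
move=> hg; apply: (@I_nat 23); have := Zspan_rel i0 i1 i2 hg.
congr Zspan; congr pair; last by rewrite /qtens /= !mul0r !addr0 mulr0 rmorph0 oppr0.
by congr asub; rewrite /qtens /=; ring.
Qed.

Lemma Zspan_w g i j : i != j -> hm 3 d g ->
  Zspan d (asub (g * (24 * (x i * x i * x j) - 2 * Q * x j)), - asub (g * x j)).
Proof.
move=> /negbTE nij hg; have := Zspan_rel i i j hg.
by rewrite /qtens eqxx nij mul0r !addr0 mul1r.
Qed.

Lemma Zspan_pairB (c : k) (a b a' b' : Rring) :
  Zspan d (a, b) -> Zspan d (a', b') -> Zspan d (a - c *: a', b - c *: b').
Proof. by move=> Z Z'; apply: (subspaceB sZ Z (subspaceZ sZ c Z')). Qed.

(** The relations for x_j^3 and x_i^2 x_j have proportional coefficients of w,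
    so that w may be eliminated. *)
Lemma I_cube g i j : i != j -> hm 3 d g -> I (g * (x j ^+ 3 - 3 * (x i ^+ 2 * x j))).
Proof.
move=> nij hg; apply: (@I_nat 23).
have := Zspan_pairB 3 (Zspan_rel j j j hg) (Zspan_w nij hg).
rewrite /qtens eqxx; congr Zspan; congr pair.
  rewrite -[3 *: asub _]linearZ -rmorphB /= -!mul_mpolyC; congr asub.
  by rewrite mpolyC_nat; ring.
rewrite scalerN opprK addrC -[3 *: asub _]linearZ -rmorphB /= -[RHS](rmorph0 asub) -!mul_mpolyC.
by congr asub; rewrite mpolyC_nat; ring.
Qed.

Lemma hm_mon c e f i j : (e + f + c)%N = d -> hm c d (x i ^+ e * x j ^+ f).
Proof.
move=> <-; apply/hm_homog; apply: dhomogM.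
  by have := @dhomogMn 3 k mdeg 1 'X_i e; rewrite mul1n; apply; rewrite dhomogX /= mdeg1.
by have := @dhomogMn 3 k mdeg 1 'X_j f; rewrite mul1n; apply; rewrite dhomogX /= mdeg1.
Qed.

Lemma hm_mon3 c a b e : (a + b + e + c)%N = d ->
  hm c d (x i0 ^+ a * x i1 ^+ b * x i2 ^+ e).
Proof.
have X n i : x i ^+ n \is n.-homog.
  by have := @dhomogMn 3 k mdeg 1 'X_i n; rewrite mul1n; apply; rewrite dhomogX /= mdeg1.
by move=> <-; apply/hm_homog; rewrite !dhomogM.
Qed.

Lemma hmMX c g i : hm c.+1 d g -> hm c d (g * x i).
Proof.
by move=> hg; apply: (@hm_mul_homog _ c 1); rewrite ?addn1 // dhomogX /= mdeg1.
Qed.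

(** I_cube and its mirror image give two independent relations between
    x_i^3 x_j and x_i x_j^3. *)
Lemma I_31 g i j : i != j -> hm 4 d g -> I (g * (x i ^+ 3 * x j)).
Proof.
move=> nij hg; have nji : j != i by rewrite eq_sym.
apply: (@I_nat 7); have h1 := I_cube nji (hmMX (i := j) hg).
have h2 := I_natM 3 (I_cube nij (hmMX (i := i) hg)).
have := I_sub (I_scale (-1) h1) h2; congr (I _); rewrite scaleN1r; ring.
Qed.

Lemma I_5 g i : hm 5 d g -> I (g * x i ^+ 5).
Proof.
move=> hg; have [j nij] : exists j : 'I_3, i != j by exists (i + 1); move: i; apply: forall3.
have nji : j != i by rewrite eq_sym.
have h1 := I_cube nji (hmMX (i := i) (hmMX (i := i) hg)).
have h2 := I_natM 3 (I_31 nij (hmMX (i := j) hg)).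
have := I_add h1 h2; congr (I _); ring.
Qed.

Lemma I_gen j q : tnth (bdeg15) j = d -> tnth (bgen k) j = (asub q, 0) -> I q.
Proof. by move=> dj <-; apply: Zspan_gen. Qed.

Lemma I_pow3 i : d = 3%N -> I (x i ^+ 3).
Proof.
move=> d3; move: i; apply: forall3.
- by apply: (@I_gen (@Ordinal 15 11 isT)); rewrite ?(tnth_nth 0%N) // rmorphXn /= asub_X (tnth_nth 0).
- by apply: (@I_gen (@Ordinal 15 12 isT)); rewrite ?(tnth_nth 0%N) // rmorphXn /= asub_X (tnth_nth 0).
- by apply: (@I_gen (@Ordinal 15 13 isT)); rewrite ?(tnth_nth 0%N) // rmorphXn /= asub_X (tnth_nth 0).
Qed.

Lemma I_pow4 i : d = 4%N -> I (x i ^+ 4).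
Proof.
move=> d4.
have h0 : I (x i0 ^+ 4).
  by apply: (@I_gen (@Ordinal 15 14 isT)); rewrite ?(tnth_nth 0%N) // rmorphXn /= asub_X (tnth_nth 0).
have [->//|ni] := eqVneq i i0; have n0 : i0 != i by rewrite eq_sym.
have hi j : hm 3 d (x j) by have := @hm_mon 3 1 0 j j; rewrite expr0 mulr1; apply.
have := I_add h0 (I_sub (I_cube n0 (hi i)) (I_cube ni (hi i0))).
congr (I _); ring.
Qed.

Lemma I_pair i j e f : i != j -> (e + f)%N = d -> (3 <= d)%N -> I (x i ^+ e * x j ^+ f).
Proof.
move=> nij def d3; have nji : j != i by rewrite eq_sym.
have pure a b n : a != b -> n = d -> I (x a ^+ n).
  move=> nab nd; have [n3|n3] := eqVneq n 3%N; first by rewrite n3; apply: I_pow3; lia.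
  have [n4|n4] := eqVneq n 4%N; first by rewrite n4; apply: I_pow4; lia.
  have := @I_5 (x a ^+ (n - 5) * x a ^+ 0) a; rewrite expr0 mulr1 -exprD subnK; last lia.
  by apply; have := @hm_mon 5 (n - 5) 0 a a; rewrite expr0 mulr1; apply; lia.
have big a b u v : a != b -> (u + v)%N = d -> (3 <= u)%N -> (0 < v)%N ->
    I (x a ^+ u * x b ^+ v).
  move=> nab uvd u3 v1.
  have hg : hm 4 d (x a ^+ (u - 3) * x b ^+ v.-1) by apply: hm_mon; lia.
  by have := I_31 nab hg; rewrite mulrACA -exprD subnK // -exprSr prednK.
have [f0|f0] := posnP f; first by rewrite f0 expr0 mulr1; apply: (pure i j) => //; lia.
have [e0|e0] := posnP e; first by rewrite e0 expr0 mul1r; apply: (pure j i) => //; lia.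
have [e3|e2] := leqP 3 e; first exact: big.
have [f3|f2] := leqP 3 f; first by rewrite mulrC; apply: big => //; lia.
have mixed a b : a != b -> d = 3%N -> I (x a ^+ 2 * x b ^+ 1).
  move=> nab dE; have h1 : hm 3 d (x a ^+ 0 * x b ^+ 0) by apply: hm_mon; lia.
  apply: (@I_nat 2); have := I_sub (I_pow3 b dE) (I_cube nab h1).
  congr (I _); ring.
have [ed|ed] := eqVneq d 3%N.
  have [ee|ee] := eqVneq e 2%N.
    have f1 : f = 1%N by lia.
    by rewrite ee f1; exact: mixed nij ed.
  have e1 : e = 1%N by lia.
  have f2' : f = 2%N by lia.
  by rewrite e1 f2' mulrC; exact: mixed nji ed.
have d4 : d = 4%N by lia.
have -> : e = 2%N by lia.
have -> : f = 2%N by lia.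
have h1 : hm 3 d (x i ^+ 0 * x j ^+ 1) by apply: hm_mon; lia.
apply: (@I_nat 2); have := I_sub (I_pow4 j d4) (I_cube nij h1).
congr (I _); ring.
Qed.

Lemma I_subspace : subspace (fun q => I q).
Proof.
split; first by rewrite rmorph0; apply: sZ.1.
by move=> c u v Iu Iv; exact: I_add (I_scale c Iu) Iv.
Qed.

(** The relations I_xyz, I_cube, I_31 and I_5 leave no monomial of degree
    greater than 4, and only the generators in degrees 3 and 4. *)
Lemma I_all q : (3 <= d)%N -> q \is d.-homog -> I q.
Proof.
move=> d3 /dhomogP hq; rewrite (mpolyE q).
rewrite big_seq; apply: (subspace_sum I_subspace) => u /hq du; apply: I_scale.
rewrite mpolyXE_id prod3; have {du} : (u i0 + u i1 + u i2)%N = d by rewrite -du /= mdegE sum3.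
move: (u i0) (u i1) (u i2) => a b c abc.
have [a0|a0] := posnP a; first by rewrite a0 expr0 mul1r; apply: I_pair => //; lia.
have [b0|b0] := posnP b; first by rewrite b0 expr0 mulr1; apply: I_pair => //; lia.
have [c0|c0] := posnP c; first by rewrite c0 expr0 mulr1; apply: I_pair => //; lia.
have hg : hm 3 d (x i0 ^+ a.-1 * x i1 ^+ b.-1 * x i2 ^+ c.-1).
  by apply: hm_mon3; lia.
have := I_xyz hg; congr (I _).
rewrite -[in RHS](prednK a0) -[in RHS](prednK b0) -[in RHS](prednK c0) !exprSr; ring.
Qed.

Lemma I_low q : (d <= 2)%N -> q \is d.-homog -> I q.
Proof.
move=> d2 /dhomogP hq; rewrite (mpolyE q).
rewrite big_seq; apply: (subspace_sum I_subspace) => u /hq du; apply: I_scale.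
rewrite mpolyXE_id prod3; have {du} : (u i0 + u i1 + u i2)%N = d by rewrite -du /= mdegE sum3.
have gen j p v : tnth bdeg15 j = d -> tnth (bgen k) j = (v, 0) -> asub p = v -> I p.
  by move=> dj Ej Ep; apply: (@I_gen j) => //; rewrite Ep.
have r := asub_X k.
have tn := (tnth_nth 0 (avar k)).
case: (u i0) => [|[|[|a]]]; case: (u i1) => [|[|[|b]]]; case: (u i2) => [|[|[|c]]] E;
  rewrite ?expr0 ?mul1r ?mulr1 ?expr1; try (move: E d2; lia).
- by apply: (@gen (@Ordinal 15 3 isT)); rewrite ?(tnth_nth 0%N) -?E // asub_X.
- by apply: (@gen (@Ordinal 15 9 isT)); rewrite ?(tnth_nth 0%N) -?E // rmorphM /= asub_X.
- by apply: (@gen (@Ordinal 15 2 isT)); rewrite ?(tnth_nth 0%N) -?E // asub_X.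
- by apply: (@gen (@Ordinal 15 8 isT)); rewrite ?(tnth_nth 0%N) -?E // rmorphM /= !asub_X.
- by apply: (@gen (@Ordinal 15 7 isT)); rewrite ?(tnth_nth 0%N) -?E // rmorphM /= asub_X.
- by apply: (@gen (@Ordinal 15 1 isT)); rewrite ?(tnth_nth 0%N) -?E // asub_X.
- by apply: (@gen (@Ordinal 15 6 isT)); rewrite ?(tnth_nth 0%N) -?E // rmorphM /= !asub_X.
- by apply: (@gen (@Ordinal 15 5 isT)); rewrite ?(tnth_nth 0%N) -?E // rmorphM /= !asub_X.
- by apply: (@gen (@Ordinal 15 4 isT)); rewrite ?(tnth_nth 0%N) -?E // rmorphM /= asub_X.
Qed.

(** The relation for x_i^2 x_j writes w x_j as an element without w. *)
Lemma Zspan_snd r : hm 2 d r -> Zspan d (0, asub r).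
Proof.
move=> hr; rewrite (mpolyE r).
have sJ : subspace (fun q => Zspan d ((0, asub q) : V)).
  split; first by rewrite rmorph0; apply: sZ.1.
  move=> c u v Ju Jv; have := sZ.2 c _ _ Ju Jv.
  by congr Zspan; congr pair; rewrite ?linearP //= scaler0 addr0.
rewrite big_seq; apply: (subspace_sum sJ) => u /hr du.
apply: (subspaceZ sJ).
have [u0|/eqP u0] := eqVneq (mdeg u) 0%N.
  have /eqP := u0; rewrite mdeg_eq0 => /eqP ->; rewrite mpolyX0 rmorph1.
  rewrite -[(0, 1)]/(tnth (bgen k) (@Ordinal 15 10 isT)); apply: Zspan_gen.
  by rewrite -du u0.
have [j uj] : exists j, u j != 0%N.
  case: (pickP (fun l => u l != 0%N)) => [l vl|v0]; first by exists l.
  by case: u0; rewrite mdegE big1 // => l _; apply/eqP; move: (v0 l) => /= /negbFE.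
have [i nij] : exists i : 'I_3, i != j by exists (j + 1); move: (j); apply: forall3.
rewrite -(submK (_ : U_(j) <= u)%MM) ?lep1mP // mpolyXD; set g := (u - _)%MM.
have dg1 : (mdeg g + 3)%N = d.
  by rewrite -du -[in RHS](submK (_ : U_(j) <= u)%MM) ?lep1mP // mdegD mdeg1 -addnA.
have hg : hm 3 d ('X_[g] : A3) by move=> t; rewrite msuppX inE => /eqP ->.
have := Zspan_w nij hg; set p := _ * (_ - _) => Zp.
have Ip : I p.
  apply: I_all; first by rewrite -dg1 leq_addl.
  rewrite -dg1; apply: dhomogM; first by rewrite dhomogX.
  have h1 a : x a \is 1.-homog by rewrite dhomogX /= mdeg1.
  have h2 a b : x a * x b \is 2.-homog by apply: (@dhomogM _ _ _ 1 _ 1).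
  have h3 a b c : x a * x b * x c \is 3.-homog by apply: (@dhomogM _ _ _ 2 _ 1).
  have -> : 24 * (x i * x i * x j) - 2 * Q * x j = 24 * (x i * x i * x j)
    - 2 * (x i0 * x i0 * x j + x i1 * x i1 * x j + x i2 * x i2 * x j) by ring.
  by rewrite !mulr_natl rpredB // rpredMn // !rpredD.
have := subspaceB sZ Ip Zp; congr Zspan; congr pair.
  exact: subrr.
by rewrite -[LHS]/(0 - - _) sub0r opprK.
Qed.

Lemma Zspan_step (x : V) : vdeg d x -> Zspan d x.
Proof.
case: x => F G [/= hF hG]; apply/(Zspan_red IH hF hG).
have := subspaceD sZ (_ : I (rho F)) (Zspan_snd (hm_rho hG)).
rewrite -[_ + _]/(_ + 0, 0 + _) addr0 add0r; apply.
have /hm0P hrF := hm_rho hF.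
by have [d3|d2] := leqP 3 d; [apply: I_all | apply: I_low].
Qed.

End Step.

(** Graded Nakayama lemma. *)
Lemma Zspan_all m (x : V) : vdeg m x -> Zspan m x.
Proof.
elim: m x => [|m IHm] x; last exact: Zspan_step.
case: x => F G [/= hF /(hm_small (isT : 0 < 2)%N) ->].
have -> : (F, 0) = F@_0%MM *: tnth (bgen k) (@Ordinal 15 0 isT).
  rewrite -[_ *: _]/(_ *: 1, _ *: 0) scaler0; congr pair.
  rewrite alg_mpolyC; apply/mpolyP => u; rewrite mcoeffC.
  have [->|nu] := eqVneq u 0%MM; first by rewrite mulr1.
  rewrite mulr0; apply/memN_msupp_eq0/negP => /hF.
  by rewrite addn0 => /eqP; rewrite mdeg_eq0 (negbTE nu).
by apply: (subspaceZ (Zspan_subspace _ _)); apply: Zspan_gen.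
Qed.

End GradedNakayama.


(** * Hilbert functions *)

(** A spanning family that is not longer than a free family in its span is
    free. *)
Lemma free_of_card (k : fieldType) (V : lmodType k) (I K : finType)
    (v : I -> V) (b : K -> V) (C : K -> I -> k) :
    (forall i, b i = \sum_j C i j *: v j) ->
    (forall d : K -> k, \sum_i d i *: b i = 0 -> forall i, d i = 0) ->
    (#|I| <= #|K|)%N ->
  forall d : I -> k, \sum_j d j *: v j = 0 -> forall j, d j = 0.
Proof.
move=> bC bfree le_IK d dv.
pose M : 'M[k]_(#|K|, #|I|) := \matrix_(i, j) C (enum_val i) (enum_val j).
have sumM (y : 'rV_#|K|) :
    \sum_i y 0 (enum_rank i) *: b i = \sum_j (y *m M) 0 (enum_rank j) *: v j.
  under eq_bigr => i _ do rewrite bC scaler_sumr.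
  rewrite exchange_big /=; apply: eq_bigr => j _.
  rewrite !mxE scaler_suml (reindex (@enum_val K xpredT)) /=; last exact/onW_bij/enum_val_bij.
  by apply: eq_bigr => i _; rewrite enum_valK scalerA !mxE enum_rankK.
have freeM : row_free M.
  rewrite -kermx_eq0; apply/rowV0P => y /sub_kermxP yM.
  apply/rowP => i; rewrite mxE -(enum_valK i).
  apply: (bfree (fun i => y 0 (enum_rank i))); rewrite sumM yM.
  by rewrite big1 // => j _; rewrite mxE scale0r.
have eq_IK : #|I| = #|K|.
  by apply/eqP; rewrite eqn_leq le_IK -(eqP freeM) rank_leq_col.
have fullM : row_full M by rewrite /row_full (eqP freeM) eq_IK.
pose e : 'rV[k]_#|I| := \row_j d (enum_val j).
have /submxP[y Ey] : (e <= M)%MS by apply: submx_full.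
have y0 : y = 0.
  apply/rowP => i; rewrite mxE -(enum_valK i).
  apply: (bfree (fun i => y 0 (enum_rank i))); rewrite sumM -Ey -[RHS]dv.
  by apply: eq_bigr => j _; rewrite mxE enum_rankK.
move=> j; have := congr1 (fun u : 'rV_ _ => u 0 (enum_rank j)) Ey.
by rewrite y0 mul0mx !mxE enum_rankK.
Qed.

Lemma bin2_mul n : (2 * 'C(n.+2, 2) = n.+2 * n.+1)%N.
Proof. by rewrite -[X in (X * _)%N]/(2`!)%N mulnC bin_ffact /falling_factorial /= muln1. Qed.

Lemma bin3_mul n : (6 * 'C(n.+2, 3) = n.+2 * (n.+1 * n))%N.
Proof. by rewrite -[X in (X * _)%N]/(3`!)%N mulnC bin_ffact /falling_factorial /= muln1. Qed.

Lemma bin6_mul n : (720 * 'C(n + 6, 6) =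
  (n + 6) * ((n + 5) * ((n + 4) * ((n + 3) * ((n + 2) * (n + 1))))))%N.
Proof.
rewrite -[X in (X * _)%N]/(6`!)%N mulnC bin_ffact !addnS addn0 /falling_factorial /=.
by rewrite muln1.
Qed.

(** The left-hand side counts the monomials in theta times the generators bgen
    in degree m, the right-hand side is the dimension of Sym^3(Sym^m U). *)
Lemma Hilbert_identity m :
  (\sum_(j < 15) (if tnth bdeg15 j <= m then 'C(m - tnth bdeg15 j + 6, 6) else 0)
   = 'C('C(m.+2, 2).+2, 3))%N.
Proof.
rewrite !big_ord_recl big_ord0 !(tnth_nth 0%N) /=.
have [m4|m4] := leqP m 3.
  by case: m m4 => [|[|[|[|//]]]] _; vm_compute.
rewrite -(subnK m4); move: (m - 4)%N => n {m m4}.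
have -> : (0 < n + 4)%N by lia.
have -> : (1 < n + 4)%N by lia.
have -> : (2 < n + 4)%N by lia.
have -> : (n + 4 - 0 = n + 4)%N by lia.
have -> : (n + 4 - 1 = n + 3)%N by lia.
have -> : (n + 4 - 2 = n + 2)%N by lia.
have -> : (n + 4 - 3 = n + 1)%N by lia.
rewrite addnK addn0.
set c0 := 'C(n + 4 + 6, 6); set c1 := 'C(n + 3 + 6, 6); set c2 := 'C(n + 2 + 6, 6).
set c3 := 'C(n + 1 + 6, 6); set c4 := 'C(n + 6, 6).
have := bin6_mul (n + 4); have := bin6_mul (n + 3); have := bin6_mul (n + 2).
have := bin6_mul (n + 1); have := bin6_mul n.
rewrite -/c0 -/c1 -/c2 -/c3 -/c4 => E4 E3 E2 E1 E0.
have := bin2_mul (n + 4); set D := 'C(_, 2) => ED.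
have := bin3_mul D; set X := 'C(_, 3) => EX.
have EX' : (48 * X = (2 * D + 4) * ((2 * D + 2) * (2 * D)))%N by lia.
rewrite ED in EX'; lia.
Qed.


(** * A free family in B *)

Section OrbitSums.
Variables (k : fieldType) (chark : [pchar k] =i pred0).
Local Notation T := {mpoly k[3 * 3]}.
Implicit Types f g : 'I_3 -> 'X_{1..3}.

Definition mon3 f : 'X_{1..3 * 3} :=
  [multinom (mxvec (\matrix_(q < 3, a < 3) f q a)) 0%R l | l < 3 * 3].

Lemma mon3E f q a : mon3 f (mxvec_index q a) = f q a.
Proof. by rewrite mnmE mxvecE mxE. Qed.

Lemma mon3_inj f g : mon3 f = mon3 g -> f =1 g.
Proof. by move=> E q; apply/mnmP => a; rewrite -!mon3E E. Qed.

Lemma eq_mon3 f g : f =1 g -> mon3 f = mon3 g.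
Proof. by move=> E; apply/mnmP => l; case/mxvec_indexP: l => q a; rewrite !mon3E E. Qed.

Lemma mon3_prod f : 'X_[mon3 f] = \prod_q \prod_a (xvar q a : T) ^+ f q a.
Proof.
rewrite mpolyXE_id (reindex _ (curry_mxvec_bij 3 3)) /= pair_bigA.
by apply: eq_bigr => -[q a] _ /=; rewrite mon3E.
Qed.

Lemma bperm_mon3 s f :
  bperm s ('X_[mon3 f] : T) = 'X_[mon3 (fun q => f ((s^-1)%g q))].
Proof.
rewrite !mon3_prod rmorph_prod [RHS](reindex_inj (@perm_inj _ s)) /=.
apply: eq_bigr => q _; rewrite rmorph_prod; apply: eq_bigr => a _.
by rewrite rmorphXn /= bperm_xvar permK.
Qed.

Lemma bdeg_mon3 f i : bdeg i (mon3 f) = mdeg (f i).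
Proof. by rewrite /bdeg mdegE; apply: eq_bigr => a _; rewrite mon3E. Qed.

Lemma mdeg_mon3 f : mdeg (mon3 f) = (\sum_q mdeg (f q))%N.
Proof.
rewrite mdegE (reindex _ (curry_mxvec_bij 3 3)) /=.
under [RHS]eq_bigr => q _ do rewrite mdegE.
by rewrite pair_bigA; apply: eq_bigr => -[q a] _ /=; rewrite mon3E.
Qed.

Definition orbit_sum f : T := \sum_(s : 'S_3) bperm s 'X_[mon3 f].

Lemma orbit_sum_B m f : (forall q, mdeg (f q) = m) -> orbit_sum f \in @Bpred k 3 3.
Proof.
move=> fm; apply/BP; split=> [|s].
  apply: rpred_sum => s _; rewrite bperm_mon3; apply/AP => u i j.
  by rewrite msuppX inE => /eqP ->; rewrite !bdeg_mon3 !fm.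
rewrite /orbit_sum linear_sum /= [RHS](reindex_inj (mulIg s)) /=.
apply: eq_bigr => s' _; rewrite !bperm_mon3; congr ('X_[_]).
by apply: eq_mon3 => q; rewrite invMg permM.
Qed.

Lemma orbit_sum_homog m f : (forall q, mdeg (f q) = m) -> orbit_sum f \is (3 * m).-homog.
Proof.
move=> fm; apply: rpred_sum => s _; rewrite bperm_mon3 dhomogX /= mdeg_mon3 sum3 !fm.
by rewrite !mulSn mul0n addn0 addnA.
Qed.

Section Basis.
Variable m : nat.

Local Notation L := [seq s2m t | t : m.-tuple 'I_3 <- enum (basis 3 m)].
Local Notation N' := ('C(m + 2, m)).-1.

Definition omon (l : 'I_#|basis N'.+1 3|) (q : 'I_3) : 'X_{1..3} :=
  nth 0%MM L (tnth (word l) q).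

Let szL : size L = N'.+1.
Proof. by rewrite size_basis prednK // bin_gt0 leq_addr. Qed.

Lemma omon_deg l q : mdeg (omon l q) = m.
Proof. by apply/eqP; rewrite basis_cover mem_nth // szL. Qed.

Lemma omon_perm l l' (s : 'S_3) : (forall q, omon l ((s^-1)%g q) = omon l' q) -> l = l'.
Proof.
move=> E; apply: enum_val_inj; rewrite -/(word l) -/(word l').
have srt (x : 'I_#|basis N'.+1 3|) : sorted leq (map val (word x)).
  by have := enum_valP x; rewrite inE.
apply/val_inj/(inj_map val_inj).
apply: (sorted_eq leq_trans anti_leq (srt l) (srt l')).
apply: perm_map; rewrite perm_sym; apply/tuple_permP; exists (s^-1)%g.
have {}E q : tnth (word l) ((s^-1)%g q) = tnth (word l') q.
  have := E q; rewrite /omon => /eqP; rewrite nth_uniq ?szL ?uniq_basis // => /eqP; exact: val_inj.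
by congr val; apply: eq_from_tnth => q; rewrite tnth_mktuple E.
Qed.

(** The monomials of two different orbits are different, and each coefficient
    is a positive integer. *)
Lemma orbit_sum_free (d : 'I_#|basis N'.+1 3| -> k) :
  \sum_l d l *: orbit_sum (omon l) = 0 -> forall l, d l = 0.
Proof.
move=> E l; have := congr1 (mcoeff (mon3 (omon l))) E.
rewrite mcoeff0 linear_sum /= (bigD1 l) //= big1 => [|l' nl].
  rewrite addr0 mcoeffZ => /eqP; rewrite mulf_eq0 => /orP[/eqP //|].
  rewrite linear_sum /= (bigD1 1%g) //= bperm_mon3 mcoeffX.
  rewrite (eq_mon3 (g := omon l)) => [|q]; last by rewrite invg1 perm1.
  rewrite eqxx => /eqP E1.
  have [n En] : exists n : nat, \sum_(i | i != 1%g) (bperm i ('X_[mon3 (omon l)] : T))@_(mon3 (omon l)) = n%:R.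
    elim/big_rec: _ => [|s x _ [n ->]]; first by exists 0%N.
    rewrite bperm_mon3 mcoeffX -natrD; eexists; reflexivity.
  by move: E1; rewrite En -natrD add1n => /eqP; rewrite (negbTE (natk_neq0 chark n)).
rewrite mcoeffZ linear_sum /= big1 ?mulr0 // => s _; rewrite bperm_mon3 mcoeffX.
case: eqP => // /mon3_inj Em; case/eqP: nl; exact: omon_perm Em.
Qed.

Lemma card_omon : #|basis N'.+1 3| = 'C('C(m.+2, 2).+2, 3).
Proof.
have := size_basis N' 3; rewrite size_map -cardE => ->.
have N0 : (0 < 'C(m.+2, 2))%N by rewrite bin_gt0.
have -> : 'C(m + 2, m) = 'C(m.+2, 2) by rewrite -bin_sub ?leq_addr // addKn addn2.
by congr 'C(_, 3); rewrite addnC addnS addnS addn1 prednK.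
Qed.

End Basis.
End OrbitSums.


(** * B is presented by the relations between the cubic and its Hessian *)

Section GradedMaps.
Variables (k : fieldType) (n n' : nat).

Lemma mpoly_expand_list (p : {mpoly k[n]}) (L : seq 'X_{1..n}) :
    uniq L -> {subset msupp p <= L} ->
  p = \sum_(i < size L) p@_(nth 0%MM L i) *: 'X_[nth 0%MM L i].
Proof.
move=> uL sL; rewrite -(big_mkord xpredT (fun i => p@_(nth 0%MM L i) *: 'X_[nth 0%MM L i])).
rewrite -(big_nth 0%MM xpredT (fun t => p@_t *: 'X_[t])).
rewrite {1}(mpolyE p) [RHS](bigID (mem (msupp p))) /= [X in _ + X]big1 ?addr0; last first.
  by move=> t /memN_msupp_eq0 ->; rewrite scale0r.
rewrite -[RHS]big_filter; apply: perm_big; apply: uniq_perm; rewrite ?filter_uniq //.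
by move=> t; rewrite mem_filter; case: (boolP (t \in msupp p)) => // /sL ->.
Qed.

(** The images of the homogeneous components of F have distinct degrees. *)
Lemma pihomog_graded (f : {linear {mpoly k[n]} -> {mpoly k[n']}}) c :
    (forall d F, F \is d.-homog -> f F \is (3 * d + c).-homog) ->
  forall m F, pihomog mdeg (3 * m + c) (f F) = f (pihomog mdeg m F).
Proof.
move=> hf m F; rewrite {1}(pihomog_partitionE (mf := mdeg) (leqnn (mmeasure mdeg F))).
rewrite linear_sum linear_sum /=.
have E (i : nat) : pihomog mdeg (3 * m + c) (f (pihomog mdeg i F)) =
    if i == m then f (pihomog mdeg m F) else 0.
  have hi := hf _ _ (pihomogP mdeg i F).
  have [<-|ni] := eqVneq i m; first by rewrite pihomog_dE.
  by apply: pihomog_ne0 hi; rewrite eqn_add2r eqn_pmul2l.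
under eq_bigr => i _ do rewrite E.
have [lt_m|le_m] := ltnP m (mmeasure mdeg F).
  rewrite (bigD1 (Ordinal lt_m)) //= eqxx big1 ?addr0 // => i.
  by rewrite -val_eqE /= => /negbTE ->.
rewrite big1 => [|i _].
  rewrite pihomogE big_seq_cond big1 ?linear0 // => t /andP[/msize_mdeg_lt lt_t /eqP dt].
  by move: le_m; rewrite -dt leqNgt lt_t.
by case: eqP => // im; move: le_m; rewrite -im leqNgt ltn_ord.
Qed.

Lemma pihomog_graded_ne (f : {linear {mpoly k[n]} -> {mpoly k[n']}}) c e :
    (forall d F, F \is d.-homog -> f F \is (3 * d + c).-homog) ->
    (forall d, 3 * d + c != e)%N ->
  forall F, pihomog mdeg e (f F) = 0.
Proof.
move=> hf ne F; rewrite (pihomog_partitionE (mf := mdeg) (leqnn (mmeasure mdeg F))).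
rewrite linear_sum linear_sum big1 // => i _ /=.
exact: pihomog_ne0 (ne i) (hf _ _ (pihomogP mdeg i F)).
Qed.

End GradedMaps.

Section Injectivity.
Variables (k : fieldType) (chark : [pchar k] =i pred0).

Local Notation T := {mpoly k[3 * 3]}.
Local Notation Rring := {mpoly k[#|basis 3 3|]}.
Local Notation V := (Rring * Rring)%type.
Local Notation tsub := (@tsub k).

Lemma RtoA_homog d (F : Rring) : F \is d.-homog -> RtoA F \is (3 * d).-homog.
Proof.
move=> /dhomogP hF; rewrite /RtoA comp_mpolyEX big_seq; apply: rpred_sum => u /hF <-.
apply: rpredZ; rewrite comp_mpolyX /= mdegE.
have ht i : tnth [tuple symtensor k l | l < #|basis 3 3|] i \is 3.-homog.
  rewrite tnth_mktuple; apply: rpredZ; apply: rpred_sum => s _.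
  have X q a : (xvar q a : T) \is 1.-homog by rewrite dhomogX /= mdeg1.
  by rewrite prod3; apply: (@dhomogM _ _ _ 2 _ 1) => //; apply: (@dhomogM _ _ _ 1 _ 1).
rewrite big_distrr /=; elim/big_ind2: _ => [|a p1 b p2 h1 h2|i _].
- exact: dhomog1.
- exact: dhomogM.
exact: dhomogMn.
Qed.

Lemma omega_homog : omega k \is 6.-homog.
Proof.
rewrite /omega mul_mpolyC; apply: rpredZ; apply: (@dhomogMn _ _ _ 3 _ 2).
by apply: det_homog => i j; rewrite mxE dhomogX /= mdeg1.
Qed.

Definition muomega (G : Rring) : T := RtoA G * omega k.
Lemma muomega_linear : linear muomega.
Proof. by move=> a u v; rewrite /muomega linearP /= mulrDl scalerAl. Qed.
HB.instance Definition _ := GRing.isLinear.Build k Rring T _ muomega muomega_linear.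

Lemma mu_pihomog m (x : V) : exists2 y : V, vdeg m y &
  pihomog mdeg (3 * m) (mu x.1 x.2) = mu y.1 y.2.
Proof.
have E1 := @pihomog_graded _ _ _ (@RtoA k 3 3) 0.
have hR d (F : Rring) : F \is d.-homog -> RtoA F \is (3 * d + 0).-homog.
  by rewrite addn0; apply: RtoA_homog.
have hO d (F : Rring) : F \is d.-homog -> muomega F \is (3 * d + 6).-homog.
  by move=> /RtoA_homog hF; apply: dhomogM hF omega_homog.
have := E1 hR m x.1; rewrite addn0 => {}E1.
have [m2|m2] := leqP 2 m.
  exists (pihomog mdeg m x.1, pihomog mdeg (m - 2) x.2).
    split; first by apply/hm0P/pihomogP.
    by rewrite -[X in hm _ X](subnK m2); apply/hm_homog/pihomogP.
  rewrite /mu linearD /= E1 -/(muomega _); congr (_ + _).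
  have -> : (3 * m = 3 * (m - 2) + 6)%N by lia.
  exact: (pihomog_graded hO).
exists (pihomog mdeg m x.1, 0).
  by split; [apply/hm0P/pihomogP | apply: (hm_subspace _ _ _ _).1].
rewrite /mu linearD /= E1 -/(muomega _) rmorph0 mul0r.
by rewrite (pihomog_graded_ne hO) // => d; lia.
Qed.

Definition muv (x : V) : T := mu x.1 x.2.
Lemma muv_linear : linear muv.
Proof.
move=> a x y; rewrite /muv /mu !linearP /= scalerDr scalerAl mulrDl.
by rewrite addrACA.
Qed.
HB.instance Definition _ := GRing.isLinear.Build k V T _ muv muv_linear.

Lemma muv_sm r x : muv (sm r x) = RtoA r * muv x.
Proof. by rewrite /muv /mu /= !rmorphM /= mulrDr mulrA. Qed.

Lemma muv_nrel l : muv (nrel k l) = 0.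
Proof.
rewrite /muv /mu /= rmorphN /= (idx3_word l) hX_idx3 -/(X3 k _ _ _).
by rewrite RtoA_hess // mulNr mulrC subrr.
Qed.

Lemma muv_Nrel m x : Nrel m x -> muv x = 0.
Proof.
move=> [a [_ ->]]; rewrite linear_sum big1 // => l _.
by rewrite /= muv_sm muv_nrel mulr0.
Qed.

Section Degree.
Variable m : nat.

Definition tmon (j : 'I_15) : seq 'X_{1..7} :=
  if (tnth bdeg15 j <= m)%N
  then [seq s2m t | t : (m - tnth bdeg15 j).-tuple 'I_7 <- enum (basis 7 (m - tnth bdeg15 j))]
  else [::].

Lemma tmon_uniq j : uniq (tmon j).
Proof. by rewrite /tmon; case: ifP => // _; apply: uniq_basis. Qed.

Lemma tmonP j t : ((mdeg t + tnth bdeg15 j)%N == m) = (t \in tmon j).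
Proof.
rewrite /tmon; case: leqP => [le_dm|lt_md].
  by rewrite -basis_cover -[in LHS](subnK le_dm) eqn_add2r.
by apply/negbTE; rewrite neq_ltn (leq_trans lt_md (leq_addl _ _)) orbT.
Qed.

Let I := {j : 'I_15 & 'I_(size (tmon j))}.

Lemma card_I : #|{: I}| = 'C('C(m.+2, 2).+2, 3).
Proof.
rewrite card_tagged sumnE big_map big_enum /= -Hilbert_identity.
apply: eq_bigr => j _; rewrite card_ord /tmon; case: ifP => // _.
by rewrite size_basis -bin_sub ?leq_addr // addKn.
Qed.

Definition vI (x : I) : T :=
  RtoA (tsub 'X_[nth 0%MM (tmon (tag x)) (tagged x)]) * muv (tnth (bgen k) (tag x)).

Lemma muv_span (x : V) s : (forall j, hm (tnth bdeg15 j) m (s j)) ->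
    Nrel m (x - \sum_j sm (tsub (s j)) (tnth (bgen k) j)) ->
  muv x = \sum_(i : I) (s (tag i))@_(nth 0%MM (tmon (tag i)) (tagged i)) *: vI i.
Proof.
move=> hs /muv_Nrel /eqP; rewrite linearB subr_eq0 => /eqP ->.
rewrite linear_sum /=.
transitivity (\sum_j \sum_(i < size (tmon j)) (s j)@_(nth 0%MM (tmon j) i) *:
    vI (Tagged (fun j => 'I_(size (tmon j))) i)).
  apply: eq_bigr => j _; rewrite muv_sm.
  have sub : {subset msupp (s j) <= tmon j}.
    by move=> t /(hs j) dt; rewrite -tmonP dt.
  rewrite {1}(mpoly_expand_list (tmon_uniq j) sub) [tsub _]linear_sum [RtoA _]linear_sum mulr_suml.
  by apply: eq_bigr => i _; rewrite !linearZ /= -scalerAl.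
rewrite sig_big_dep /=; by apply: eq_bigr => -[j i] _.
Qed.

(** In degree m, the space of pairs modulo relations is spanned by as many
    elements as there are orbit sums, and it maps onto a space containing these
    free elements; hence the map is injective. *)
Lemma muv_inj (x : V) : vdeg m x -> muv x = 0 -> Nrel m x.
Proof.
move=> /(Zspan_all chark)[s [hs Ns]] x0.
have mus := muv_span hs Ns.
pose b l := orbit_sum k (@omon m l).
have bspan l : exists c : I -> k, b l = \sum_i c i *: vI i.
  have [F [G E]] := B_inC chark (orbit_sum_B k (omon_deg l)).
  have [y /(Zspan_all chark)[sy [hsy Nsy]]] := mu_pihomog m (F, G).
  rewrite /= -E pihomog_dE ?orbit_sum_homog //; last exact: omon_deg.
  by rewrite -/(muv y) (muv_span hsy Nsy) => Eb; eexists; exact: Eb.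
have /boolp.choice[C HC] := bspan.
pose d (i : I) := (s (tag i))@_(nth 0%MM (tmon (tag i)) (tagged i)).
have le_IK : (#|{: I}| <= #|{: 'I_#|basis ('C(m + 2, m)).-1.+1 3|}|)%N.
  by rewrite card_I card_ord card_omon.
have d0 : forall i : I, d i = 0.
  apply: (free_of_card HC) => //; first exact: orbit_sum_free.
  by rewrite -[RHS]x0 mus.
have s0 j : s j = 0.
  apply/mpolyP => t; rewrite mcoeff0; case: (boolP (t \in msupp (s j))) => [tj|/memN_msupp_eq0 //].
  have tL : t \in tmon j by rewrite -tmonP (hs j t tj).
  have lt_t : (index t (tmon j) < size (tmon j))%N by rewrite index_mem.
  by have := d0 (Tagged (fun j => 'I_(size (tmon j))) (Ordinal lt_t)); rewrite /d /= nth_index.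
move: Ns; rewrite big1 ?subr0 // => j _; by rewrite s0 rmorph0 sm0l.
Qed.
End Degree.
End Injectivity.


(** * The kernel of R -> B *)

Section KoszulSyzygies.
Variables (k : fieldType) (chark : [pchar k] =i pred0) (n : nat).

Lemma euler e (p : {mpoly k[n]}) : p \is e.-homog -> \sum_j 'X_j * p^`M(j) = e%:R *: p.
Proof.
move=> /dhomogP hp; rewrite {2}(mpolyE p) scaler_sumr.
under eq_bigr => j _ do rewrite {1}(mpolyE p) linear_sum mulr_sumr /=.
rewrite exchange_big /= big_seq [RHS]big_seq; apply: eq_bigr => t tp.
under eq_bigr => j _ do rewrite linearZ /= mderivX -!scalerAr.
rewrite -scaler_sumr scalerA mulrC -scalerA; congr (_ *: _).
rewrite -(hp t tp) /= mdegE natr_sum scaler_suml; apply: eq_bigr => j _.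
have [->|tj] := eqVneq (t j) 0%N; first by rewrite !scale0r.
by rewrite -mpolyXD addmC submK // lep1mP.
Qed.

(** The syzygies of the variables are generated by the Koszul ones: contraction
    with the antisymmetric derivative of a is the homotopy. *)
Lemma koszul e (a : 'I_n -> {mpoly k[n]}) (h : 'I_n -> {mpoly k[n]}) :
    (forall i, a i \is e.-homog) -> \sum_i a i * 'X_i = 0 ->
  exists c : 'I_n -> 'I_n -> {mpoly k[n]},
    \sum_i a i * h i = \sum_i \sum_j c i j * ('X_j * h i - 'X_i * h j).
Proof.
move=> ha aX; pose c i j := (a i)^`M(j) - (a j)^`M(i).
have cX i : \sum_j 'X_j * c i j = e.+1%:R *: a i.
  rewrite /c; under eq_bigr => j _ do rewrite mulrBr.
  rewrite big_split sumrN /= (euler (ha i)).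
  have := congr1 (mderiv i) aX; rewrite linear0 linear_sum /=.
  under eq_bigr => j _ do rewrite mderivM mderivX.
  rewrite big_split /= [X in _ + X](bigD1 i) //= [X in _ + (_ + X)]big1 => [|j nj]; last first.
    by rewrite mnm1E (negbTE nj) scale0r mulr0.
  have -> : (U_(i) - U_(i) = 0 :> 'X_{1..n})%MM.
    by apply/mnmP => l; rewrite mnmBE subnn mnm0E.
  rewrite addr0 mnm1E eqxx scale1r mpolyX0 mulr1 => /eqP; rewrite addr_eq0 => /eqP E.
  under eq_bigr => j _ do rewrite mulrC.
  by rewrite E opprK -[X in _ + X]scale1r -scalerDl natr1.
have cN i j : c i j = - c j i by rewrite /c opprB.
exists (fun i j => (2 * e.+1)%:R^-1 *: c i j).
have -> : \sum_i \sum_j ((2 * e.+1)%:R^-1 *: c i j) * ('X_j * h i - 'X_i * h j) =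
  (2 * e.+1)%:R^-1 *: (\sum_i (\sum_j 'X_j * c i j) * h i
                       + \sum_j (\sum_i 'X_i * c j i) * h j).
  rewrite [X in _ + X](eq_bigr (fun j => \sum_i - ('X_i * c i j * h j))); last first.
    by move=> j _; rewrite mulr_suml; apply: eq_bigr => i _; rewrite cN mulrN mulNr.
  rewrite [X in _ + X]exchange_big -big_split scaler_sumr; apply: eq_bigr => i _ /=.
  rewrite mulr_suml -big_split scaler_sumr; apply: eq_bigr => j _ /=.
  by rewrite -!mul_mpolyC; ring.
have -> : \sum_i (\sum_j 'X_j * c i j) * h i = e.+1%:R *: \sum_i a i * h i.
  by rewrite scaler_sumr; apply: eq_bigr => i _; rewrite cX scalerAl.
rewrite -scalerDr -mulr2n -scaler_nat !scalerA -?mulrA -natrM (mulnC e.+1).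
by rewrite mulVf ?scale1r // mul2n doubleS natk_neq0.
Qed.
End KoszulSyzygies.

Section IdealAndCokernel.
Variables (k : fieldType) (chark : [pchar k] =i pred0).

Local Notation N3 := #|basis 3 3|.
Local Notation Rring := {mpoly k[#|basis 3 3|]}.
Local Notation V := (Rring * Rring)%type.
Local Notation hX := (hX k).
Local Notation omega := (omega k).

(** The 2 x 2 minors of the matrix with rows the generic cubic and its Hessian. *)
Definition bracket (l l' : 'I_N3) : Rring := 'X_l * hX l' - 'X_l' * hX l.

Lemma RtoA_hX l : RtoA (hX l) = omega * RtoA ('X_l : Rring).
Proof.
have := muv_nrel chark l; rewrite /muv /mu /= rmorphN /= mulNr => /eqP.
by rewrite subr_eq0 mulrC => /eqP.
Qed.

Lemma RtoA_bracket l l' : RtoA (bracket l l') = 0.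
Proof. 
rewrite /bracket rmorphB !rmorphM /= !RtoA_hX.
by move: (RtoA 'X_l) (RtoA 'X_l') omega => p p' q; ring. Qed.

(** If F maps to 0, then (F, 0) is a combination of the relations
    (h_l, - X_l), whose coefficients form a syzygy of the variables. *)
Lemma kernel_homog m (F : Rring) : F \is m.-homog -> RtoA F = 0 ->
  exists c : 'I_N3 -> 'I_N3 -> Rring, F = \sum_i \sum_j c i j * bracket j i.
Proof.
move=> /hm0P hF F0.
have hx : vdeg m ((F, 0) : V) by split=> //; apply: (hm_subspace _ _ _ _).1.
have /(muv_inj chark hx)[a [ha Ea]] : muv ((F, 0) : V) = 0.
  by rewrite /muv /mu /= F0 rmorph0 mul0r addr0.
have [m3|m3] := leqP 3 m; last first.
  exists (fun _ _ => 0).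
  have -> : F = 0.
    have := congr1 fst Ea; rewrite /= => ->; rewrite big1 // => l _.
    by rewrite (hm_small m3 (ha l)) sm0l.
  by rewrite big1 // => i _; rewrite big1 // => j _; rewrite mul0r.
have E1 : F = \sum_l a l * hX l.
  by have := congr1 fst Ea; rewrite /= => ->; rewrite raddf_sum.
have E2 : \sum_l a l * 'X_l = 0.
  have := congr1 snd Ea; rewrite /= raddf_sum /= => E.
  apply/eqP; rewrite -oppr_eq0 -sumrN; apply/eqP; rewrite [RHS]E.
  by apply: eq_bigr => l _; rewrite mulrN.
have ha' l : a l \is (m - 3).-homog by have := ha l; rewrite -[X in hm _ X](subnK m3) => /hm_homog.
have [c Ec] := koszul chark hX ha' E2.
by exists c; rewrite E1 Ec.
Qed.

Lemma RtoA_pihomog m (F : Rring) :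
  pihomog mdeg (3 * m) (RtoA F) = RtoA (pihomog mdeg m F).
Proof.
have hR d (G : Rring) : G \is d.-homog -> RtoA G \is (3 * d + 0).-homog.
  by rewrite addn0; apply: RtoA_homog.
by have := pihomog_graded hR m F; rewrite addn0.
Qed.

Lemma kernel_bracket (F : Rring) : RtoA F = 0 ->
  exists c : 'I_N3 -> 'I_N3 -> Rring, F = \sum_i \sum_j c i j * bracket j i.
Proof.
move=> F0; rewrite (pihomog_partitionE (mf := mdeg) (leqnn (mmeasure mdeg F))).
elim/big_ind: _ => [|F1 F2 [c1 ->] [c2 ->]|d _].
- exists (fun _ _ => 0).
  by rewrite big1 // => i _; rewrite big1 // => j _; rewrite mul0r.
- exists (fun i j => c1 i j + c2 i j); rewrite -big_split; apply: eq_bigr => i _ /=.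
  by rewrite -big_split; apply: eq_bigr => j _ /=; rewrite mulrDl.
apply: (kernel_homog (pihomogP mdeg d F)).
by rewrite -RtoA_pihomog F0 linear0.
Qed.

(** The relations begin in degree 3, whereas omega has degree 2. *)
Lemma omega_notin_kY (F : Rring) : RtoA F <> omega.
Proof.
move=> EF; pose F2 := pihomog mdeg 2 F.
have E2 : RtoA F2 = omega.
  rewrite -RtoA_pihomog EF pihomog_dE //; exact: omega_homog.
have hx : vdeg 2 ((F2, -1) : V).
  split; first exact/hm0P/pihomogP.
  by move=> t; rewrite (perm_mem (msuppN _)) msupp1 inE => /eqP ->; rewrite mdeg0.
have /(muv_inj chark hx)[a [ha]] : muv ((F2, -1) : V) = 0.
  by rewrite /muv /mu /= E2 rmorphN rmorph1 mulN1r subrr.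
rewrite big1 => [/(congr1 snd) /eqP|l _]; first by rewrite /= oppr_eq0 oner_eq0.
by rewrite (hm_small (isT : 2 < 3)%N (ha l)) sm0l.
Qed.

End IdealAndCokernel.


(** * The cokernel of R -> B *)

Section Cokernel.
Variables (k : fieldType) (chark : [pchar k] =i pred0).

Local Notation T := {mpoly k[3 * 3]}.
Local Notation Rring := {mpoly k[#|basis 3 3|]}.
Local Notation hX := (hX k).
Local Notation omega := (omega k).
Local Notation C := (Cmod k 3 3).

Lemma det_X9_multihomog : multihomog (fun=> 1%N) (\det (X9 k)).
Proof.
move=> i; rewrite /determinant; apply: rpred_sum => s _.
have : multihomog (fun i => \sum_(q : 'I_3) (q == i))%N (\prod_q X9 k q (s q)).
  apply: (@multihomog_prod k 3 3 _ (fun q i => q == i : nat)) => q.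
  by rewrite mxE; apply: xvar_homog.
move=> /(_ i) /=.
have -> : (\sum_(q < 3) (q == i))%N = 1%N.
  by rewrite (bigD1 i) //= eqxx big1 // => j /negbTE ->.
move=> h.
have -> : ((-1) ^+ s : T) = ((-1) ^+ s : k)%:MP by rewrite rmorphXn rmorphN1.
by rewrite mul_mpolyC; apply: rpredZ.
Qed.

Lemma omega_multihomog : multihomog (fun=> 2%N) omega.
Proof.
move=> i; rewrite /omega mul_mpolyC; apply: rpredZ.
by apply: (@dhomogMn _ _ _ 1 _ 2); apply: det_X9_multihomog.
Qed.

Lemma omega_B (x : k) : x *: omega \in @Bpred k 3 3.
Proof.
apply: B_scale; apply/BP; split=> [|s]; first exact: (A_homog omega_multihomog).
exact: bperm_omega.
Qed.

Definition oB (x : k) : Bring k 3 3 := MkB (omega_B x).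

(** X_l * omega is the image of h_l, so that R_+ * omega lies in that of R. *)
Lemma RtoA_omega (F : Rring) : exists G, RtoA F * omega = RtoA G + F@_0%MM *: omega.
Proof.
rewrite (mpolyE F); elim: (msupp F) => [|u r [G EG]].
  by exists 0; rewrite !big_nil !rmorph0 mul0r scale0r addr0.
suff [H EH] : exists H, RtoA ('X_[u] : Rring) * omega = RtoA H + ('X_[u] : Rring)@_0%MM *: omega.
  exists (F@_u *: H + G); rewrite !big_cons !linearD /= mcoeffZ !linearZ /= mulrDl EG.
  by rewrite -scalerAl EH scalerDr scalerDl scalerA addrACA.
have [->|nu] := eqVneq u 0%MM.
  by exists 0; rewrite mpolyX0 !rmorph1 rmorph0 mul1r add0r scale1r.
have [l ul] : exists l, u l != 0%N.
  case: (pickP (fun l => u l != 0%N)) => [l ul|u0]; first by exists l.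
  by case/eqP: nu; apply/mnmP => l; rewrite mnm0E; apply/eqP; move: (u0 l) => /= /negbFE.
exists (hX l * 'X_[u - U_(l)]); rewrite mcoeffX (negbTE nu) scale0r addr0.
rewrite -{1}(submK (_ : U_(l) <= u)%MM) ?lep1mP // addmC mpolyXD !rmorphM /= RtoA_hX //; ring.
Qed.

Lemma Bring_omega (b : Bring k 3 3) : exists F x, val b = RtoA F + x *: omega.
Proof.
have [F [G Eb]] := B_inC chark (valP b); have [H EH] := RtoA_omega G.
exists (F + H), G@_0%MM; rewrite Eb /mu EH rmorphD /=; ring.
Qed.

Lemma toC_omega (c : C) : exists x : k, c = toC (oB x).
Proof.
have [b ->] := toC_surj c; have [F [x Eb]] := Bring_omega b.
exists x; apply/toC_eq/kYP; exists F; apply: val_inj => /=.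
by rewrite /= Eb addrK.
Qed.

Lemma toC_omega_inj (x y : k) : toC (oB x) = toC (oB y) -> x = y.
Proof.
move/toC_eq/kYP => [F /(congr1 val) /= E]; apply/eqP; rewrite -subr_eq0; apply/negPn/negP => nxy.
apply: (@omega_notin_kY _ chark ((x - y)^-1 *: F)).
by rewrite linearZ /= -E -scalerBl scalerK.
Qed.

Definition phiC (c : C) : det2 k 3 3 := projT1 (boolp.cid (toC_omega c)).

Lemma phiC_E c : c = toC (oB (phiC c)).
Proof. exact: projT2 (boolp.cid (toC_omega c)). Qed.

Lemma phiC_oB x : phiC (toC (oB x)) = x.
Proof. by apply: toC_omega_inj; rewrite -phiC_E. Qed.

Lemma phiC_val (b : Bring k 3 3) F x : val b = RtoA F + x *: omega -> phiC (toC b) = x.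
Proof.
move=> Eb; rewrite -[RHS]phiC_oB; congr phiC; apply/toC_eq/kYP; exists F.
by apply: val_inj; rewrite /= Eb addrK.
Qed.

Lemma phiC_linear : linear phiC.
Proof.
move=> F c c'; rewrite [in LHS](phiC_E c) [in LHS](phiC_E c').
move: (phiC c) (phiC c') => x y.
have [G EG] := RtoA_omega F.
rewrite -[_ *: toC _]/(Cscale _ _) Cscale_toC -toCD.
apply: (phiC_val (F := x *: G)).
rewrite /= -scalerAr EG scalerDr scalerA linearZ /=.
rewrite -addrA -scalerDl; congr (_ + _ *: _); rewrite mulrC; reflexivity.
Qed.
HB.instance Definition _ := GRing.isLinear.Build Rring C (det2 k 3 3) _ phiC phiC_linear.

Lemma phiC_bij : bijective phiC.
Proof.
exists (fun x : det2 k 3 3 => toC (oB x)) => [c|x]; last exact: phiC_oB.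
by rewrite -phiC_E.
Qed.

Lemma phiC_gact (M : 'M[k]_3) (b : Bring k 3 3) :
  phiC (toC (gactB M b)) = gact_det2 M (phiC (toC b)).
Proof.
have [F [x Eb]] := Bring_omega b; rewrite (phiC_val Eb).
apply: (phiC_val (F := gactR M F)); rewrite /= Eb rmorphD /= RtoA_gactR linearZ /=.
by rewrite gact_omega scalerA mulrC.
Qed.

Lemma phiC_graded (m : nat) (c : C) : Cgraded m c <-> det2_graded m (phiC c).
Proof.
split=> [[b hb ->] m2|hc].
  have [F [x Eb]] := Bring_omega b; rewrite (phiC_val Eb).
  apply/eqP/negPn/negP => nx.
  apply: (@omega_notin_kY _ chark (- x^-1 *: pihomog mdeg 2 F)).
  have hm : val b \is (3 * m).-homog.
    apply/dhomogP => u ub.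
    have hi i := dhomogP _ _ _ (hb i) u ub.
    rewrite /= mdegE (reindex _ (curry_mxvec_bij 3 3)) /=.
    rewrite (eq_bigr (fun p => u (mxvec_index p.1 p.2))); last by case.
    rewrite -(pair_bigA _ (fun q a => u (mxvec_index q a))) /=.
    by rewrite sum3 -!/(bdeg _ u) !hi !mulSn mul0n addn0 addnA.
  have : pihomog mdeg (3 * 2) (val b) = 0.
    by apply: pihomog_ne0 hm; rewrite eqn_pmul2l //; apply/eqP.
  rewrite Eb linearD /= RtoA_pihomog linearZ /= (pihomog_dE (omega_homog _)) => /eqP.
  rewrite addr_eq0 => /eqP E.
  by rewrite linearZ /= E scaleNr scalerN opprK scalerK.
have [m2|/eqP m2] := eqVneq m 2%N.
  exists (oB (phiC c)); last exact: phiC_E.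
  by move=> i; apply: rpredZ; rewrite m2; apply: omega_multihomog.
exists 0; first by move=> i; apply: rpred0.
rewrite (phiC_E c) (hc m2); congr toC; apply: val_inj; exact: scale0r.
Qed.

End Cokernel.


(** * Brackets of the generic cubic and its Hessian *)

Section Brackets.
Variables (k : fieldType) (chark : [pchar k] =i pred0).

Local Notation N3 := #|basis 3 3|.
Local Notation Rring := {mpoly k[#|basis 3 3|]}.
Local Notation X3 := (X3 k).
Local Notation hX := (hX k).
Local Notation bracket := (bracket k).
Implicit Types (a b c u v w : 'I_3 -> k).

(** The trilinear form on k^3 with coefficients F. *)
Definition ev3 (F : tensor3 Rring) u v w : Rring :=
  \sum_i \sum_j \sum_l (u i * v j * w l) *: F i j l.

Definition cols (u v w : 'I_3 -> k) : 'M[k]_3 :=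
  \matrix_(i, j) tnth [tuple u i; v i; w i] j.

Lemma ev3_trans3 F (M : 'M[k]_3) i j l : trans3 (map_mx (@mpolyC _ k) M) F i j l =
  ev3 F (fun x => M x i) (fun x => M x j) (fun x => M x l).
Proof.
apply: eq_bigr => x _; apply: eq_bigr => y _; apply: eq_bigr => z _.
by rewrite !mxE -!mpolyCM mul_mpolyC.
Qed.

Lemma ev3_Dl F u u' v w t : ev3 F (fun i => t * u i + u' i) v w = t *: ev3 F u v w + ev3 F u' v w.
Proof.
rewrite scaler_sumr -big_split; apply: eq_bigr => i _ /=.
rewrite scaler_sumr -big_split; apply: eq_bigr => j _ /=.
rewrite scaler_sumr -big_split; apply: eq_bigr => l _ /=.
by rewrite scalerA -scalerDl; congr (_ *: _); ring.
Qed.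

Lemma ev3_sym F : sym3 F -> forall u v w, ev3 F u v w = ev3 F v u w /\ ev3 F u v w = ev3 F u w v.
Proof.
move=> sF u v w; rewrite /ev3; split.
  rewrite exchange_big /=; apply: eq_bigr => i _; apply: eq_bigr => j _.
  by apply: eq_bigr => l _; rewrite (sF j i l).1 (mulrC (u j)).
apply: eq_bigr => i _; rewrite exchange_big /=; apply: eq_bigr => j _.
by apply: eq_bigr => l _; rewrite (sF i l j).2 mulrAC.
Qed.

Definition coef_pairing (F : 'I_N3 -> Rring) (g : {mpoly k[3]}) : Rring :=
  \sum_l g@_(s2m (word l)) *: F l.

Lemma coef_pairing_linear F : linear (coef_pairing F).
Proof.
move=> t g g'; rewrite /coef_pairing scaler_sumr -big_split; apply: eq_bigr => l _ /=.
by rewrite mcoeffD mcoeffZ scalerDl scalerA.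
Qed.
HB.instance Definition _ F :=
  GRing.isLinear.Build k {mpoly k[3]} Rring _ (coef_pairing F) (coef_pairing_linear F).

Lemma coef_pairing_X F i j l :
  coef_pairing F ('X_i * 'X_j * 'X_l) = F (idx3 i j l).
Proof.
rewrite /coef_pairing (bigD1 (idx3 i j l)) //= big1 => [|l' /negbTE nl].
  by rewrite -!mpolyXD s2m_idx3 mcoeffX eqxx scale1r addr0.
rewrite -!mpolyXD -s2m_idx3 mcoeffX (inj_in_eq (@inj_s2m 3 3)) ?enum_valP //.
by rewrite (inj_eq enum_val_inj) eq_sym nl scale0r.
Qed.

Lemma coef_pairing_lin F u v w :
  coef_pairing F (lin_form u * lin_form v * lin_form w)
    = ev3 (fun i j l => F (idx3 i j l)) u v w.
Proof.
rewrite /lin_form !mulr_suml linear_sum; apply: eq_bigr => i _ /=.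
rewrite [X in X * _]mulr_sumr mulr_suml linear_sum; apply: eq_bigr => j _ /=.
rewrite mulr_sumr linear_sum; apply: eq_bigr => l _ /=.
by rewrite -coef_pairing_X -linearZ -!mul_mpolyC !mpolyCM; congr coef_pairing; ring.
Qed.

(** A triple of vectors enters F only through the product of the three linear
    forms; this makes powers_span available. *)
Lemma pairing_ex (F : 'I_N3 -> Rring) (F' : tensor3 Rring) :
    (forall i j l, F (idx3 i j l) = F' i j l) ->
  exists p : {linear {mpoly k[3]} -> Rring},
    [/\ forall u v w, p (lin_form u * lin_form v * lin_form w) = ev3 F' u v w,
        forall i j l, p ('X_i * 'X_j * 'X_l) = F' i j l
      & forall g, p g = \sum_l g@_(s2m (word l)) *: F l].
Proof.
move=> E; exists (coef_pairing F); split=> // [u v w|i j l].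
  rewrite /= coef_pairing_lin.
  by apply: eq_bigr => i _; apply: eq_bigr => j _; apply: eq_bigr => l _; rewrite E.
by rewrite /= coef_pairing_X E.
Qed.

(** The bracket of a^3 and a^2 b. *)
Definition Phi a b : Rring :=
  ev3 X3 a a a * ev3 (hess X3) a a b - ev3 X3 a a b * ev3 (hess X3) a a a.

Lemma independent_or a b : [\/ exists c, \det (cols a b c) != 0, a =1 (fun=> 0)
  | exists t, forall i, b i = t * a i].
Proof.
have detc c : \det (cols a b c) = (a i1 * b i2 - a i2 * b i1) * c i0
   + (a i2 * b i0 - a i0 * b i2) * c i1 + (a i0 * b i1 - a i1 * b i0) * c i2.
  by rewrite det3 !mxE !(tnth_nth 0) /=; ring.
have [E0|n0] := eqVneq (a i1 * b i2 - a i2 * b i1) 0; last first.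
  apply: Or31; exists (fun i => (i == i0)%:R); rewrite detc /= !mulr0 !addr0 mulr1 //.
have [E1|n1] := eqVneq (a i2 * b i0 - a i0 * b i2) 0; last first.
  by apply: Or31; exists (fun i => (i == i1)%:R); rewrite detc /= !mulr0 !addr0 add0r mulr1.
have [E2|n2] := eqVneq (a i0 * b i1 - a i1 * b i0) 0; last first.
  by apply: Or31; exists (fun i => (i == i2)%:R); rewrite detc /= !mulr0 !add0r mulr1.
have solve i : a i != 0 -> (forall j, a i * b j = a j * b i) ->
    exists t, forall i, b i = t * a i.
  move=> nai E; exists (b i / a i) => j; apply: (mulfI nai).
  by rewrite E; field.
move/eqP: E0; rewrite subr_eq0 => /eqP E0.
move/eqP: E1; rewrite subr_eq0 => /eqP E1.
move/eqP: E2; rewrite subr_eq0 => /eqP E2.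
have [a0|na0] := eqVneq (a i0) 0; last first.
  by apply: Or33; apply: (solve i0) => //; apply: forall3; rewrite ?E1 // mulrC.
have [a1|na1] := eqVneq (a i1) 0; last first.
  by apply: Or33; apply: (solve i1) => //; apply: forall3; rewrite ?E2 // mulrC.
have [a2|na2] := eqVneq (a i2) 0; last first.
  by apply: Or33; apply: (solve i2) => //; apply: forall3; rewrite ?E0 // mulrC.
by apply: Or32; apply: forall3.
Qed.

Lemma ev3Z F r s t u v w :
  ev3 F (fun i => r * u i) (fun i => s * v i) (fun i => t * w i) = (r * s * t) *: ev3 F u v w.
Proof.
rewrite scaler_sumr; apply: eq_bigr => i _; rewrite scaler_sumr; apply: eq_bigr => j _.
rewrite scaler_sumr; apply: eq_bigr => l _; rewrite scalerA; congr (_ *: _); ring.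
Qed.

(** In the second case both vectors are multiples of w. *)
Lemma dependent_or a b : (exists c, \det (cols a b c) != 0) \/
  (exists s t w, a = (fun i => s * w i) /\ b = (fun i => t * w i)).
Proof.
case: (independent_or a b) => [H|a0|[t E]]; [by left | right | right].
  exists 0, 1, b; split; apply: boolp.funext => i; first by rewrite a0 mul0r.
  by rewrite mul1r.
exists 1, t, a; split; apply: boolp.funext => i; last exact: E.
by rewrite mul1r.
Qed.

Lemma ev3_cols F a b c (vec := fun i => tnth [tuple a; b; c] i) i j l :
  trans3 (map_mx (@mpolyC _ k) (cols a b c)) F i j l = ev3 F (vec i) (vec j) (vec l).
Proof.
rewrite ev3_trans3.
have E q : (fun x => cols a b c x q) = vec q.
  apply: boolp.funext => x; rewrite mxE /vec; move: q; apply: forall3;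
  by rewrite !(tnth_nth 0) ?(tnth_nth (fun=> 0)).
by rewrite !E.
Qed.

Lemma hess_cols a b c (vec := fun i => tnth [tuple a; b; c] i) i j l :
  hess (trans3 (map_mx (@mpolyC _ k) (cols a b c)) X3) i j l =
  (\det (cols a b c) ^+ 2)%:MP * ev3 (hess X3) (vec i) (vec j) (vec l).
Proof. by rewrite hess_trans3 ev3_cols det_map_mx -rmorphXn. Qed.

(** hess_apolar, in a frame that begins with a and b; if a and b are dependent,
    then the terms cancel. *)
Lemma ev3_apolar a b :
  ev3 X3 a a a * ev3 (hess X3) b b b - 3 * ev3 X3 a a b * ev3 (hess X3) a b b
  + 3 * ev3 X3 a b b * ev3 (hess X3) a a b - ev3 X3 b b b * ev3 (hess X3) a a a = 0.
Proof.
case: (dependent_or a b) => [[c nd]|[s [t [w [-> ->]]]]]; last first.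
  by rewrite !ev3Z -!mul_mpolyC !mpolyCM; ring.
have := hess_apolar (trans3_sym (map_mx (@mpolyC _ k) (cols a b c)) (X3_sym k)).
rewrite !hess_cols !ev3_cols !(tnth_nth a) /= => E.
apply: (@mulfI _ ((\det (cols a b c) ^+ 2)%:MP)).
  by rewrite mpolyC_eq0 expf_neq0.
by rewrite mulr0 -[RHS]E; ring.
Qed.

Section Span.
Variables (W : Rring -> Prop) (sW : subspace W).

(** The coefficient of t^2 in Phi (a + t b) b is {a^3, b^3} + 3 {a^2 b, a b^2},
    where {,} is the bracket; by apolarity it equals 2 {a^3, b^3}. *)
Lemma Phi_cubes : (forall a b, W (Phi a b)) -> forall a b,
  W (ev3 X3 a a a * ev3 (hess X3) b b b - ev3 X3 b b b * ev3 (hess X3) a a a).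
Proof.
move=> WP a b.
set X0 := ev3 X3 a a a; set H3 := ev3 (hess X3) b b b.
set X3' := ev3 X3 b b b; set H0 := ev3 (hess X3) a a a.
pose X1 := ev3 X3 a a b; pose X2 := ev3 X3 a b b.
pose H1 := ev3 (hess X3) a a b; pose H2 := ev3 (hess X3) a b b.
pose w (i : 'I_5) : Rring := tnth [tuple X0 * H1 - X1 * H0; 2 * (X0 * H2 - X2 * H0);
  X0 * H3 - X3' * H0 + 3 * (X1 * H2 - X2 * H1);
  2 * (X1 * H3 - X3' * H1); X2 * H3 - X3' * H2] i.
have expand F : sym3 F -> forall t, let c := (fun i => t * b i + a i) in
    ev3 F c c c = ev3 F a a a + t *: (3 * ev3 F a a b) + t ^+ 2 *: (3 * ev3 F a b b) + t ^+ 3 *: ev3 F b b b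
    /\ ev3 F c c b = ev3 F a a b + t *: (2 * ev3 F a b b) + t ^+ 2 *: ev3 F b b b.
  move=> sF t c; have s := ev3_sym sF.
  have e1 u v : ev3 F c u v = t *: ev3 F b u v + ev3 F a u v by rewrite /c ev3_Dl.
  have e2 u v : ev3 F u c v = t *: ev3 F u b v + ev3 F u a v.
    by rewrite (s _ _ _).1 e1 (s b u v).1 (s a u v).1.
  have e3 u v : ev3 F u v c = t *: ev3 F u v b + ev3 F u v a.
    by rewrite (s _ _ _).2 e2 (s u b v).2 (s u a v).2.
  have s1 : ev3 F b b a = ev3 F a b b by rewrite (s _ _ _).2 (s _ _ _).1.
  have s2 : ev3 F b a b = ev3 F a b b by rewrite (s _ _ _).1.
  have s3 : ev3 F b a a = ev3 F a a b by rewrite (s _ _ _).1 (s _ _ _).2.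
  have s4 : ev3 F a b a = ev3 F a a b by rewrite (s _ _ _).2.
  split; rewrite ?e1 ?e2 ?e3 ?s1 ?s2 ?s3 ?s4 -!mul_mpolyC !rmorphXn /=; ring.
have Ww : W (w (@Ordinal 5 2 isT)).
  apply: (curve_coef_mem chark sW) => t _.
  have [EX1 EX2] := expand _ (X3_sym k) t; have [EH1 EH2] := expand _ (@hess_sym _ X3) t.
  have := WP (fun i => t * b i + a i) b; rewrite /Phi EX1 EX2 EH1 EH2.
  congr W; rewrite !big_ord_recl big_ord0 /w !(tnth_nth 0) /= /bump /=.
  rewrite -/X0 -/X1 -/X2 -/X3' -/H0 -/H1 -/H2 -/H3 -!mul_mpolyC !rmorphXn /=; ring.
have apolar := ev3_apolar a b; rewrite -/X0 -/X1 -/X2 -/X3' -/H0 -/H1 -/H2 -/H3 in apolar.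
have E : X0 * H3 - X3' * H0 = 2%:R^-1 *: w (@Ordinal 5 2 isT).
  apply: (scalerI (natk_neq0 chark 1)); rewrite scalerA divff ?natk_neq0 // scale1r.
  rewrite /w (tnth_nth 0) /= scaler_nat -[LHS]mulr_natl.
  by rewrite -[RHS]addr0 -apolar; ring.
by rewrite E; apply: subspaceZ.
Qed.

(** Cubes span all cubic forms, and the bracket is bilinear. *)
Lemma Phi_brackets : (forall a b, W (Phi a b)) -> forall l l', W (bracket l l').
Proof.
move=> /Phi_cubes WC.
have [pX [pXl pXX _]] := @pairing_ex (fun l => 'X_l) X3 (fun i j l => erefl).
have [pH [pHl pHX _]] := pairing_ex (@hX_idx3 k).
have cube u : lin_form u ^+ 3 = lin_form u * lin_form u * lin_form u.
  by rewrite !exprS expr0 mulr1 mulrA.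
have H1 g : g \is 3.-homog -> forall u, W (pX g * pH (lin_form u ^+ 3) - pX (lin_form u ^+ 3) * pH g).
  move=> hg u; move: g hg; apply: (powers_span chark) => [|v].
    split; first by rewrite !linear0 mul0r mulr0 subrr; apply: sW.1.
    move=> t p q Wp Wq; rewrite !linearP /=; have := sW.2 t _ _ Wp Wq.
    congr W; rewrite -!mul_mpolyC; ring.
  by rewrite !cube !pXl !pHl; exact: WC.
have H2 g g' : g \is 3.-homog -> g' \is 3.-homog -> W (pX g * pH g' - pX g' * pH g).
  move=> hg; move: g'; apply: (powers_span chark) => [|v]; last exact: H1.
  split; first by rewrite !linear0 mul0r mulr0 subrr; apply: sW.1.
  move=> t p q Wp Wq; rewrite !linearP /=; have := sW.2 t _ _ Wp Wq.
  congr W; rewrite -!mul_mpolyC; ring.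
move=> l l'; have hm i j m : ('X_i * 'X_j * 'X_m : {mpoly k[3]}) \is 3.-homog.
  by rewrite -!mpolyXD dhomogX /= !mdegD !mdeg1.
have := H2 _ _ (hm (tnth (word l) i0) (tnth (word l) i1) (tnth (word l) i2))
  (hm (tnth (word l') i0) (tnth (word l') i1) (tnth (word l') i2)).
rewrite !pXX !pHX -!hX_idx3.
have EX m : X3 (tnth (word m) i0) (tnth (word m) i1) (tnth (word m) i2) = 'X_m.
  by rewrite [in RHS](idx3_word m).
by rewrite !EX -!idx3_word.
Qed.

(** The bracket is bilinear and alternating. *)
Lemma brackets_ev3 : (forall l l', W (bracket l l')) -> forall a b c u v w,
  W (ev3 X3 a b c * ev3 (hess X3) u v w - ev3 X3 u v w * ev3 (hess X3) a b c).
Proof.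
move=> WB a b c u v w.
have [pX [pXl _ pXE]] := @pairing_ex (fun l => 'X_l) X3 (fun i j l => erefl).
have [pH [pHl _ pHE]] := pairing_ex (@hX_idx3 k).
rewrite -!pXl -!pHl; move: (_ * _ * _) (_ * _ * _) => g' g; rewrite !pXE !pHE.
rewrite !big_distrlr /= [X in _ - X]exchange_big /= -sumrB.
apply: (subspace_sum sW) => l _; rewrite -sumrB; apply: (subspace_sum sW) => l' _.
have := subspaceZ sW (g@_(s2m (word l)) * g'@_(s2m (word l'))) (WB l l').
rewrite /bracket; move: ('X_l) ('X_l') (hX l) (hX l') => x x' h h'.
set s := g@__; set t := g'@__ => Wst.
by move: Wst; congr W; rewrite -!mul_mpolyC !mpolyCM; ring.
Qed.

End Span.
End Brackets.


(** * Cubics and the points of the affine space *)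

Section Coordinates.
Variables (k : fieldType) (U : vectType k) (n : nat) (e : n.-tuple U).
Hypothesis eU : basis_of {:U} e.

Lemma coord_basis_nth (i j : 'I_n) : coord e i e`_j = (i == j)%:R :> k.
Proof. by rewrite coord_free ?(basis_free eU) // eq_sym. Qed.

Lemma linear_of_values (V : vectType k) (w : 'I_n -> V) :
  exists l : 'Hom(U, V), forall a : 'I_n, l e`_a = w a.
Proof.
pose f (u : U) := \sum_a coord e a u *: w a.
have lf : linear f.
  move=> t u v; rewrite /f scaler_sumr -big_split; apply: eq_bigr => a _ /=.
  by rewrite linearP scalerDl scalerA.
pose F := GRing.isLinear.Build k U V _ f lf.
pose fl : {linear U -> V} := HB.pack f F.
exists (linfun fl) => a; rewrite lfunE /= /f (bigD1 a) //= big1 => [|b nab].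
  by rewrite coord_basis_nth eqxx scale1r addr0.
by rewrite coord_basis_nth (negbTE nab) scale0r.
Qed.

Lemma linear_eq_on_basis (V : vectType k) (f g : 'Hom(U, V)) :
  (forall a : 'I_n, f e`_a = g e`_a) -> forall u, f u = g u.
Proof.
move=> E u; rewrite (coord_basis eU (memvf u)) !linear_sum; apply: eq_bigr => a _ /=.
by rewrite !linearZ /= E.
Qed.

Lemma matrix_End (M : 'M[k]_n) : exists g : 'End(U), forall j : 'I_n, g e`_j = \sum_i M i j *: e`_i.
Proof. exact: linear_of_values. Qed.

(** An equivariant projection therefore commutes with all invertible
    matrices. *)
Lemma gl_dual_mx_surj (M : 'M[k]_n) : M \in unitmx ->
  exists2 g : 'End(U), inGL g & gl_dual_mx e g = M.
Proof.
move=> uM.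
have [g gE] := matrix_End (invmx M)^T; have [h hE] := matrix_End M^T.
have comp (A B : 'M[k]_n) (f f' : 'End(U)) : (forall j : 'I_n, f e`_j = \sum_i A i j *: e`_i) ->
    (forall j : 'I_n, f' e`_j = \sum_i B i j *: e`_i) -> A *m B = 1%:M -> forall u, f (f' u) = u.
  move=> fE f'E AB u.
  suff /(_ u) : forall v, (f \o f')%VF v = (\1)%VF v by rewrite comp_lfunE id_lfunE.
  apply: linear_eq_on_basis => j; rewrite comp_lfunE id_lfunE f'E linear_sum /=.
  under eq_bigr => i _ do rewrite linearZ /= fE scaler_sumr.
  rewrite exchange_big /= (bigD1 j) //= [X in _ + X]big1 => [|i nij].
    under eq_bigr => i _ do rewrite scalerA mulrC.
    rewrite -scaler_suml; have := congr1 (fun N : 'M_n => N j j) AB.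
    by rewrite !mxE eqxx => ->; rewrite scale1r addr0.
  under eq_bigr => a _ do rewrite scalerA mulrC.
  rewrite -scaler_suml; have := congr1 (fun N : 'M_n => N i j) AB.
  by rewrite !mxE (negbTE nij) => ->; rewrite scale0r.
have hg : forall u, h (g u) = u.
  by apply: (comp _ _ _ _ hE gE); rewrite -trmx_mul mulVmx // trmx1.
have gh : forall u, g (h u) = u.
  by apply: (comp _ _ _ _ gE hE); rewrite -trmx_mul mulmxV // trmx1.
have gGL : inGL g.
  by apply/lker0P => u v E; rewrite -(hg u) E hg.
exists g => //; apply/matrixP => i j; rewrite !mxE.
have -> : ((g^-1)%VF e`_i) = h e`_i by rewrite -{1}(gh e`_i) lker0_lfunK.
rewrite hE linear_sum (bigD1 j) //= linearZ /= coord_basis_nth eqxx.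
rewrite big1 ?addr0 ?mxE => [|b nb]; first exact: mulr1.
by rewrite linearZ /= coord_basis_nth eq_sym (negbTE nb); apply: mulr0.
Qed.

End Coordinates.

Lemma trans3_cube (S : comNzRingType) (M : 'M[S]_3) (u : 'I_3 -> S) i j l
  (L := fun i => \sum_a u a * M a i) :
  trans3 M (fun a b c => u a * u b * u c) i j l = L i * L j * L l.
Proof.
rewrite /trans3 /L big_distrlr /= mulr_suml; apply: eq_bigr => a _.
rewrite mulr_suml; apply: eq_bigr => b _.
by rewrite big_distrr /=; apply: eq_bigr => c _; ring.
Qed.

Lemma trans3D (S : comNzRingType) (M : 'M[S]_3) t (F G H : tensor3 S) i j l :
    (forall a b c, H a b c = t * F a b c + G a b c) ->
  trans3 M H i j l = t * trans3 M F i j l + trans3 M G i j l.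
Proof.
move=> E; rewrite -trans3Z /trans3 -big_split; apply: eq_bigr => a _ /=.
rewrite -big_split; apply: eq_bigr => b _ /=.
rewrite -big_split; apply: eq_bigr => c _ /=.
by rewrite E mulrDr.
Qed.

Section Polarization.
Variables (k : fieldType) (chark : [pchar k] =i pred0).

Local Notation A3 := {mpoly k[3]}.
Local Notation N3 := #|basis 3 3|.
Local Notation Rring := {mpoly k[#|basis 3 3|]}.
Local Notation X3 := (X3 k).
Implicit Types (f g : A3).

Definition polar3 f : tensor3 k := fun i j l => polar f (idx3 i j l).

Lemma polar_linear t f g (l : 'I_N3) : polar (t *: f + g) l = t * polar f l + polar g l.
Proof.
by rewrite /polar mderivmD mderivmZ mcoeffD mcoeffZ mulrDr mulrCA.
Qed.

Lemma polar3_linear t f g i j l :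
  polar3 (t *: f + g) i j l = t * polar3 f i j l + polar3 g i j l.
Proof. exact: polar_linear. Qed.

Lemma polar3_sym f : sym3 (polar3 f).
Proof.
move=> i j l; split; congr (polar _ _); apply: idx3_perm; apply/seq.permP => a /=.
  by rewrite addnCA.
by congr addn; rewrite addnCA.
Qed.

Lemma mderiv_lin_form (u : 'I_3 -> k) i : (lin_form u)^`M(i) = (u i)%:MP.
Proof.
rewrite /lin_form linear_sum /= (bigD1 i) //= big1 => [|a na].
  rewrite addr0 linearZ /= mderivX mnm1E eqxx.
  have -> : (U_(i) - U_(i) = 0 :> 'X_{1..3})%MM by apply/mnmP => b; rewrite !mnmE subnn.
  by rewrite mpolyX0 scale1r alg_mpolyC.
by rewrite linearZ /= mderivX mnm1E (negbTE na) scale0r scaler0.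
Qed.

Lemma polar3_prod (u v w : 'I_3 -> k) i j l :
  polar3 (lin_form u * lin_form v * lin_form w) i j l = 6%:R^-1 *
   (u i * v j * w l + u i * w j * v l + v i * u j * w l + v i * w j * u l
    + w i * u j * v l + w i * v j * u l).
Proof.
rewrite /polar3 /polar; congr (_ * _).
rewrite s2m_idx3 !mderivmDm !mderivmU1m !mderivM !(mderivD, mderivM, mderiv_lin_form, mderivC).
rewrite !(mul0r, mulr0, addr0, add0r). rewrite -!(mpolyCD, mpolyCM) mcoeffC eqxx mulr1; ring.
Qed.

Lemma six_neq0 : 6%:R != 0 :> k. Proof. exact: natk_neq0. Qed.

Lemma polar3_cube (u : 'I_3 -> k) i j l :
  polar3 (lin_form u ^+ 3) i j l = u i * u j * u l.
Proof.
have -> : lin_form u ^+ 3 = lin_form u * lin_form u * lin_form u.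
  by rewrite !exprS expr0 mulr1 mulrA.
by rewrite polar3_prod; field; apply: six_neq0.
Qed.

(** The value at l of the polarization of f is the coefficient of the monomial
    l, up to a factor invertible in characteristic 0. *)
Lemma polar3_surj (v : 'I_N3 -> k) : exists2 f, f \is 3.-homog & forall l, polar f l = v l.
Proof.
pose mf (m : 'X_{1..3}) : k := \prod_i (m i)`!%:R.
have mf_n0 m : mf m != 0.
  by apply/prodf_neq0 => i _; rewrite -(prednK (fact_gt0 _)) natk_neq0.
have mw (l : 'I_N3) : mdeg (s2m (word l)) = 3%N.
  by rewrite (idx3_word l) s2m_idx3 !mdegD !mdeg1.
pose f : A3 := \sum_l (6%:R / mf (s2m (word l)) * v l) *: 'X_[s2m (word l)].
exists f => [|l].
  by apply: rpred_sum => l _; apply: rpredZ; rewrite dhomogX /= mw.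
have fl : f@_(s2m (word l)) = 6%:R / mf (s2m (word l)) * v l.
  rewrite /f linear_sum (bigD1 l) //= big1 => [|l' nl].
    by rewrite mcoeffZ mcoeffX eqxx mulr1 addr0.
  rewrite mcoeffZ mcoeffX (inj_in_eq (@inj_s2m 3 3)) ?enum_valP //.
  by rewrite (inj_eq enum_val_inj) (negbTE nl) mulr0.
rewrite /polar mcoeff_mderivm addm0 fl -[_ *+ \prod_i _]mulr_natr.
have -> : (\prod_i (s2m (word l) i) ^_ (s2m (word l) i))%N%:R = mf (s2m (word l)).
  by rewrite natr_prod; apply: eq_bigr => i _; rewrite ffactnn.
have -> : 3`!%:R = 6%:R :> k by [].
by field; rewrite mf_n0 six_neq0.
Qed.

(** Cubics take all values on the variables of R. *)
Lemma evalR_ext (F G : Rring) :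
  (forall f, f \is 3.-homog -> evalR F f = evalR G f) -> F = G.
Proof.
move=> E; apply: (meval_inj chark) => v; have [f hf fv] := polar3_surj v.
by rewrite -(meval_eq _ fv) -[RHS](meval_eq _ fv); apply: E.
Qed.

(** It is enough to consider cubes of linear forms, by powers_span. *)
Lemma polar3_diag (S : comNzRingType) (iota : {rmorphism k -> S})
    (phi : {rmorphism A3 -> S}) (M : 'M[S]_3) i f :
    (forall c, phi c%:MP = iota c) -> (forall a, M a i = phi 'X_a) ->
    f \is 3.-homog ->
  phi f = trans3 M (fun a b c => iota (polar3 f a b c)) i i i.
Proof.
move=> phiC MX; move: f.
apply: (powers_span chark) => [|u].
  split.
    rewrite raddf0 /trans3; symmetry; rewrite big1 // => a _; rewrite big1 // => b _.
    rewrite big1 // => c _; suff -> : polar3 0 a b c = 0 by rewrite raddf0 mulr0.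
    by rewrite /polar3 /polar linear0 mcoeff0 mulr0.
  move=> t f g Ef Eg; rewrite rmorphD /= -mul_mpolyC rmorphM phiC Ef Eg.
  symmetry; apply: trans3D => a b c.
  by rewrite mul_mpolyC polar3_linear rmorphD rmorphM.
have Eu : phi (lin_form u) = \sum_a iota (u a) * M a i.
  rewrite rmorph_sum; apply: eq_bigr => a _ /=.
  by rewrite -mul_mpolyC rmorphM phiC MX.
rewrite rmorphXn /= Eu.
rewrite (@eq_trans3 _ _ _ (fun a b c => iota (u a) * iota (u b) * iota (u c))).
  by rewrite trans3_cube !exprS expr0 mulr1 mulrA.
by move=> a b c; rewrite polar3_cube !rmorphM.
Qed.

Lemma evalR_trans3 f (M : 'M[Rring]_3) i j l :
  evalR (trans3 M X3 i j l) f
  = trans3 (map_mx (fun F => evalR F f) M) (polar3 f) i j l.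
Proof.
rewrite /evalR (trans3_map (meval (polar f))); apply: eq_trans3 => a b c.
by rewrite /= /X3 mevalXU.
Qed.

Section ProductsOfLinearForms.
Variables (U : vectType k) (e : 3.-tuple U).
Hypothesis eU : basis_of {:U} e.

Lemma linformE (l : 'Hom(U, k^o)) : linform e l = lin_form (fun a => l e`_a).
Proof. by []. Qed.

Lemma evalR_prod (F : Rring) (l : 'I_3 -> 'Hom(U, k^o)) (c : 'I_(3 * 3) -> k) :
    (forall q a, c (mxvec_index q a) = l q e`_a) ->
  evalR F (\prod_q linform e (l q)) = (RtoA F).@[c].
Proof.
move=> cE; rewrite /evalR /RtoA comp_mpoly_meval; apply: meval_eq => t.
have -> : (tnth [tuple symtensor k l0 | l0 < N3] t).@[c] = (RtoA ('X_t : Rring)).@[c].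
  by rewrite /RtoA comp_mpolyXU -tnth_nth.
rewrite (idx3_word t); move: (tnth _ i0) (tnth _ i1) (tnth _ i2) => x y z.
rewrite -/(X3 _ _ _) RtoA_X3 mevalM mevalC (trans3_map (meval c)).
rewrite -/(polar3 _ _ _ _) prod3 !linformE polar3_prod.
congr (_ * _); rewrite /trans3 !sum3 /triangle /= !(rmorph0, rmorph1) !(mulr0, mulr1, add0r, addr0).
by rewrite !mxE /xvar !mevalXU !cE; ring.
Qed.

(** On a product of three linear forms, F takes the value of RtoA F at their
    coefficients, which are arbitrary. *)
Lemma J_kernel (F : Rring) : J e F <-> RtoA F = 0.
Proof.
split=> [JF|F0 f [l ->]]; last first.
  rewrite (@evalR_prod _ _ (mxvec (\matrix_(q, a) (l q e`_a : k)) 0)) ?F0 ?meval0 //.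
  by move=> q a; rewrite mxvecE mxE.
apply: (meval_inj chark) => c; rewrite meval0.
have ex q : exists l : 'Hom(U, k^o), forall a : 'I_3, l e`_a = c (mxvec_index q a).
  exact: (@linear_of_values k U 3 e eU k^o (fun a => c (mxvec_index q a) : k^o)).
have [l lE] := boolp.choice ex.
by rewrite -(@evalR_prod _ l) ?JF //; exists l.
Qed.

End ProductsOfLinearForms.
End Polarization.


(** * The projection onto S_(3,3) *)

Section SchurColumns.
Variables (k : fieldType) (n : nat).

Lemma colminorE r la j (c : nat -> 'I_n) h : colheight (r :: la) j = h ->
  colminor k (r :: la) j c
  = \det (\matrix_(i < h, i' < h) xvar (inord i : 'I_(size la).+1) (c i')).
Proof.
move=> <-; congr (\det _); apply/matrixP => i i'; rewrite !mxE; congr (xvar _ _).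
by apply: val_inj; rewrite /= inordK //= (leq_trans (ltn_ord i)) ?count_size.
Qed.

End SchurColumns.

Lemma det_mx22 (S : comNzRingType) (M : 'M[S]_2) :
  \det M = M ord0 ord0 * M ord_max ord_max - M ord0 ord_max * M ord_max ord0.
Proof.
rewrite (expand_det_row _ ord0) big_ord_recl big_ord1 /cofactor !det_mx11 !mxE /=.
have -> : lift ord0 ord0 = ord_max :> 'I_2 by apply: val_inj.
have -> : lift ord_max ord0 = ord0 :> 'I_2 by apply: val_inj.
by rewrite /bump /= !expr0 expr1; ring.
Qed.

Section RowForms.
Variables (k : fieldType) (d n : nat).

Lemma gact_row_lin (M : 'M[k]_n) (q : 'I_d) (l : 'I_n -> k) :
  gact M (row_lin q l) = row_lin q (fun b => \sum_a M b a * l a).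
Proof.
rewrite /row_lin linear_sum /=.
under eq_bigr => a _ do rewrite linearZ /= gact_xvar scaler_sumr.
rewrite exchange_big /=; apply: eq_bigr => b _; rewrite scaler_suml.
by apply: eq_bigr => a _; rewrite scalerA mulrC.
Qed.

Lemma row_lin_unit (q : 'I_d) (a : 'I_n) :
  row_lin q (fun b => (b == a)%:R : k) = xvar q a.
Proof.
rewrite /row_lin (bigD1 a) //= eqxx scale1r big1 ?addr0 // => b /negbTE ->.
by rewrite scale0r.
Qed.

Lemma row_linD (q : 'I_d) (t : k) (a b : 'I_n -> k) :
  row_lin q (fun i => t * a i + b i) = t *: row_lin q a + row_lin q b.
Proof.
rewrite /row_lin scaler_sumr -big_split; apply: eq_bigr => i _ /=.
by rewrite scalerDl scalerA.
Qed.

End RowForms.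

Section Transvectant.
Variable S : comNzRingType.

(** The third transvectant of two binary cubics, in the first two vectors of a
    frame. *)
Definition transvectant (F G : tensor3 S) : S :=
  F i0 i0 i0 * G i1 i1 i1 - 3 * F i0 i0 i1 * G i0 i1 i1
  + 3 * F i0 i1 i1 * G i0 i0 i1 - F i1 i1 i1 * G i0 i0 i0.

Lemma transvectantC (F G : tensor3 S) : transvectant F G = - transvectant G F.
Proof. by rewrite /transvectant; ring. Qed.

Lemma transvectant_linearl t (F G H F' : tensor3 S) :
    (forall i j l, H i j l = t * F i j l + G i j l) ->
  transvectant H F' = t * transvectant F F' + transvectant G F'.
Proof. by move=> E; rewrite /transvectant !E; ring. Qed.

Lemma transvectant_linearr t (F G H F' : tensor3 S) :
    (forall i j l, H i j l = t * F i j l + G i j l) ->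
  transvectant F' H = t * transvectant F' F + transvectant F' G.
Proof.
by move=> E; rewrite !(transvectantC F') (transvectant_linearl _ E) opprD mulrN.
Qed.

Lemma transvectant_cubes (F G : tensor3 S) (u v : 'I_3 -> S) :
    (forall i j l, F i j l = u i * u j * u l) -> (forall i j l, G i j l = v i * v j * v l) ->
  transvectant F G = (u i0 * v i1 - v i0 * u i1) ^+ 3.
Proof. by move=> EF EG; rewrite /transvectant !EF !EG; ring. Qed.

End Transvectant.

Section BrillProjection.
Variables (k : fieldType) (chark : [pchar k] =i pred0).
Variables (U : vectType k) (e : 3.-tuple U) (eU : basis_of {:U} e).

Local Notation T2 := {mpoly k[2 * 3]}.
Local Notation ly := (@row_lin k 2 3 ord0).
Local Notation lx := (@row_lin k 2 3 ord_max).
Local Notation y a := (xvar (ord0 : 'I_2) a : T2).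
Local Notation x a := (xvar (ord_max : 'I_2) a : T2).

Definition wedge (a b : 'I_3 -> k) : T2 := ly a * lx b - ly b * lx a.
Definition minor (a b : 'I_3) : T2 := y a * x b - y b * x a.

Let Ds (s : k) : 'M[k]_3 := diag_mx (\row_j s ^+ (j == i2)).

Let gact_Ds s q a : gact (Ds s) (xvar q a : T2) = s ^+ (a == i2) *: xvar q a.
Proof.
rewrite gact_xvar (bigD1 a) //= big1 => [|b /negbTE nb]; first by rewrite !mxE eqxx addr0.
by rewrite !mxE nb scale0r.
Qed.

Let Ds_unit s : s != 0 -> Ds s \in unitmx.
Proof.
by move=> s0; rewrite unitmxE unitfE det_diag prod3 !mxE /= !expr0 !mul1r.
Qed.

Let wt2 (a b : 'I_3) : nat := ((a == i2) + (b == i2))%N.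

Let gact_minor s a b : gact (Ds s) (minor a b) = s ^+ wt2 a b *: minor a b.
Proof.
rewrite /minor rmorphB !rmorphM /= !gact_Ds exprD -!scalerAl -!scalerAr !scalerA.
by rewrite [X in _ - X *: _]mulrC scalerBr.
Qed.

Let minor_wt0 a b : wt2 a b = 0%N -> exists t : k, minor a b = t *: minor i0 i1.
Proof.
move: a b; apply: forall3; apply: forall3 => // _.
- by exists 0; rewrite /minor subrr scale0r.
- by exists 1; rewrite scale1r.
- by exists (-1); rewrite /minor scaleN1r opprB.
by exists 0; rewrite /minor subrr scale0r.
Qed.

(** The decomposition of q by weights for the torus acting on the third
    coordinate, where minor i0 i1 ^+ 3 spans the weight 0 part of S_(3,3). *)
Let weighted (q : T2) : Prop :=
  exists2 w : 'I_7 -> T2, forall s, gact (Ds s) q = \sum_(i < 7) s ^+ i *: w i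
    & exists t, w ord0 = t *: minor i0 i1 ^+ 3.

Let schur33_weights q : @schur k 3 [:: 3; 3]%N q -> weighted q.
Proof.
have sW : subspace weighted.
  split.
    exists (fun=> 0) => [s|]; last by exists 0; rewrite scale0r.
    by rewrite linear0 big1 // => i _; rewrite scaler0.
  move=> r u v [w wE [t t0]] [w' w'E [t' t'0]].
  exists (fun i => r *: w i + w' i) => [s|]; last first.
    by exists (r * t + t'); rewrite t0 t'0 scalerDl scalerA.
  rewrite linearP /= wE w'E scaler_sumr -big_split; apply: eq_bigr => i _ /=.
  by rewrite scalerDr !scalerA mulrC.
apply: (lspan_min sW) => p [t ->].
pose a j := t j 0%N; pose b j := t j 1%N.
have -> : \prod_(j < head 0%N [:: 3; 3]%N) colminor k [:: 3; 3]%N j (t j)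
    = minor (a 0%N) (b 0%N) * minor (a 1%N) (b 1%N) * minor (a 2%N) (b 2%N).
  rewrite prod3 /=; do 2?congr (_ * _); rewrite (@colminorE _ _ _ _ _ _ 2) // det_mx22 !mxE /=;
  rewrite /minor /a /b; congr (_ * _ - _ * _); congr (xvar _ _); apply: val_inj; rewrite /= inordK //.
pose w j := wt2 (a j) (b j); pose W := (w 0 + w 1 + w 2)%N.
have W7 : (W < 7)%N.
  have w2 j : (w j <= 2)%N by rewrite /w /wt2; do 2 case: eqP.
  by rewrite ltnS (leq_add (leq_add (w2 0%N) (w2 1%N)) (w2 2%N)).
exists (fun i => (i == Ordinal W7)%:R *: (minor (a 0%N) (b 0%N) * minor (a 1%N) (b 1%N) * minor (a 2%N) (b 2%N))) => [s|].
  rewrite (bigD1 (Ordinal W7)) //= big1 => [|i /negbTE ->]; last by rewrite scale0r scaler0.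
  rewrite eqxx scale1r addr0 !rmorphM /= !gact_minor -/(w 0%N) -/(w 1%N) -/(w 2%N).
  by rewrite /W !exprD -!mul_mpolyC !mpolyCM; ring.
have [W0|nW] := eqVneq W 0%N; last first.
  exists 0; rewrite scale0r (_ : (ord0 == Ordinal W7) = false) ?scale0r //.
  by rewrite -val_eqE /= eq_sym; apply/negbTE.
have [w0 [w1 w2]] : w 0%N = 0%N /\ w 1%N = 0%N /\ w 2%N = 0%N by rewrite /W in W0; lia.
have [t0 ->] := minor_wt0 w0; have [t1 ->] := minor_wt0 w1; have [t2 ->] := minor_wt0 w2.
rewrite (_ : (ord0 == Ordinal W7) = true) ?scale1r; last by rewrite -val_eqE /= W0.
exists (t0 * t1 * t2).
by rewrite -!mul_mpolyC !mpolyCM; ring.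
Qed.

Variables (pi : {linear T2 -> T2}) (piP : brill_projection 3 e pi).

Let pi_gact (M : 'M[k]_3) p : M \in unitmx -> multihomog (fun=> 3%N) p ->
  pi (gact M p) = gact M (pi p).
Proof.
by move=> uM hp; have [g gGL <-] := gl_dual_mx_surj eU uM; case: piP => _ _; apply.
Qed.

Lemma row_lin_homog d n (q q' : 'I_d) (l : 'I_n -> k) :
  row_lin q l \is ((q == q') : nat).-homog for (@bdeg d n q').
Proof. by apply: rpred_sum => a _; apply: rpredZ; apply: xvar_homog. Qed.

Let cubes_homog a b : multihomog (fun=> 3%N) (ly a ^+ 3 * lx b ^+ 3).
Proof.
move=> q.
have := dhomogM (dhomogMn 3 (row_lin_homog ord0 q a)) (dhomogMn 3 (row_lin_homog ord_max q b)).
suff -> : (((ord0 == q) : nat) * 3 + ((ord_max == q) : nat) * 3 = 3)%N by [].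
by case: q => -[|[|]].
Qed.

(** By equivariance the image has weight 0 for this torus. *)
Let pi_axis : exists t : k, pi (y i0 ^+ 3 * x i1 ^+ 3) = t *: minor i0 i1 ^+ 3.
Proof.
have cE : y i0 ^+ 3 * x i1 ^+ 3 =
    ly (fun b => (b == i0)%:R) ^+ 3 * lx (fun b => (b == i1)%:R) ^+ 3.
  by rewrite !row_lin_unit.
have hp : multihomog (fun=> 3%N) (y i0 ^+ 3 * x i1 ^+ 3 : T2) by rewrite cE.
have [w wE [t w0]] := schur33_weights (let: And3 h _ _ := piP in h _ hp).
set q := pi _ in wE.
have fixD s : s != 0 -> gact (Ds s) q = q.
  move=> s0; rewrite -pi_gact ?Ds_unit //; congr (pi _).
  by rewrite rmorphM !rmorphXn /= !gact_Ds /= !expr0 !scale1r.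
exists t; rewrite -w0; symmetry; apply/eqP; rewrite -subr_eq0; apply/eqP.
pose w' (i : 'I_7) := w i - (i == ord0)%:R *: q.
have -> : w ord0 - q = w' ord0 by rewrite /w' eqxx scale1r.
have sW : subspace (fun p : T2 => p = 0).
  by split=> // r u v -> ->; rewrite scaler0 addr0.
apply: (curve_coef_mem chark sW (w := w')) => s s0.
rewrite /w'; under eq_bigr => i _ do rewrite scalerBr.
rewrite sumrB -wE fixD // (bigD1 ord0) //= big1 ?addr0 ?eqxx ?expr0 ?scale1r ?subrr //.
by move=> i /negbTE ->; rewrite scale0r scaler0.
Qed.

Let c0 : k := projT1 (boolp.cid pi_axis).
Let pi_axisE : pi (y i0 ^+ 3 * x i1 ^+ 3) = c0 *: minor i0 i1 ^+ 3.
Proof. exact: projT2 (boolp.cid pi_axis). Qed.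

Let pi_frame a b c : \det (cols a b c) != 0 ->
  pi (ly a ^+ 3 * lx b ^+ 3) = c0 *: wedge a b ^+ 3.
Proof.
move=> nd; set M := cols a b c.
have col0 q : gact M (xvar q i0 : T2) = row_lin q a.
  by rewrite gact_xvar; apply: eq_bigr => i _; rewrite mxE (tnth_nth 0).
have col1 q : gact M (xvar q i1 : T2) = row_lin q b.
  by rewrite gact_xvar; apply: eq_bigr => i _; rewrite mxE (tnth_nth 0).
rewrite -!col0 -!col1 -!rmorphXn -rmorphM pi_gact ?unitmxE ?unitfE //.
  by rewrite pi_axisE linearZ /= rmorphXn rmorphB !rmorphM /= !col0 !col1.
by rewrite -!row_lin_unit.
Qed.

Let pi_line (A B D : T2) (r : k) : pi (A * (r *: D + B) ^+ 3) =
  pi (A * B ^+ 3) + (3 * r) *: pi (A * (B ^+ 2 * D))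
  + (3 * r ^+ 2) *: pi (A * (B * D ^+ 2)) + r ^+ 3 *: pi (A * D ^+ 3).
Proof.
have -> : A * (r *: D + B) ^+ 3 = A * B ^+ 3 + (3 * r) *: (A * (B ^+ 2 * D))
    + (3 * r ^+ 2) *: (A * (B * D ^+ 2)) + r ^+ 3 *: (A * D ^+ 3).
  by rewrite -!mul_mpolyC ?mpolyCM ?rmorphXn /= ?mpolyCM !mpolyC_nat; ring.
by rewrite (linearD pi) /= (linearD pi) /= (linearD pi) /= !linearZ.
Qed.

Let cubic_curve (p0 p1 p2 p3 : T2) (c : k) (wb wd : T2) (m : 'I_4) : T2 := tnth [tuple
  p0 - c *: wb ^+ 3; 3%:R *: (p1 - c *: (wb ^+ 2 * wd));
  3%:R *: (p2 - c *: (wb * wd ^+ 2)); p3 - c *: wd ^+ 3] m.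

Let cubic_curve_eq (P p0 p1 p2 p3 wb wd : T2) (r c : k) :
    P = p0 + (3 * r) *: p1 + (3 * r ^+ 2) *: p2 + r ^+ 3 *: p3 ->
    P = c *: (r *: wd + wb) ^+ 3 ->
  \sum_(i < 4) r ^+ i *: cubic_curve p0 p1 p2 p3 c wb wd i = 0.
Proof.
move=> -> /eqP; rewrite -subr_eq0 => E; apply/eqP; move: E; congr (_ == 0).
rewrite !big_ord_recl big_ord0 /cubic_curve !(tnth_nth 0) /= /bump /= expr0 expr1 scale1r addr0.
by rewrite -!mul_mpolyC ?mpolyCM ?rmorphXn /= ?mpolyCM !mpolyC_nat; ring.
Qed.

(** For dependent a and b, both sides are limits of values at independent
    vectors: they are the constant terms of polynomials in r that agree at all
    non-zero r. *)
Let pi_cubes a b : pi (ly a ^+ 3 * lx b ^+ 3) = c0 *: wedge a b ^+ 3.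
Proof.
have r0 q : row_lin q (fun=> 0) = 0 :> T2 by rewrite /row_lin big1 // => i _; rewrite scale0r.
case: (independent_or a b) => [[c /pi_frame -> //]|/boolp.funext -> |[t bE]].
  by rewrite /wedge !r0 !expr0n /= !mul0r mulr0 subrr expr0n raddf0 scaler0.
have [->|na] := boolp.pselect (a = (fun=> 0)).
  by rewrite /wedge !r0 !expr0n /= !mul0r mulr0 subrr expr0n raddf0 scaler0.
have [i ai] : exists i, a i != 0.
  have [//|nex] := boolp.pselect (exists i, a i != 0).
  case: na; apply: boolp.funext => i; apply/eqP/negPn/negP => ai.
  by apply: nex; exists i.
(* Since b is a multiple of a, moving b along e_j makes a and b independent. *)
have [j ji] : exists j : 'I_3, j != i.
  by exists (if i == i0 then i1 else i0); move: i {ai}; apply: forall3.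
pose d (l : 'I_3) : k := (l == j)%:R.
have ind r : r != 0 -> exists c, \det (cols a (fun l => r * d l + b l) c) != 0.
  move=> nr; case: (independent_or a (fun l => r * d l + b l)) => // [a0|[t' E]].
    by rewrite a0 eqxx in ai.
  have Ei := E i; have Ej := E j; move: Ei Ej.
  rewrite /d eqxx eq_sym (negbTE ji) !bE mulr0 add0r mulr1 => /(mulIf ai) <- /eqP.
  by rewrite -subr_eq0 addrK (negbTE nr).
have sW : subspace (fun p : T2 => p = 0).
  by split=> // r u v -> ->; rewrite scaler0 addr0.
apply/eqP; rewrite -subr_eq0; apply/eqP.
pose w := cubic_curve
  (pi (ly a ^+ 3 * lx b ^+ 3)) (pi (ly a ^+ 3 * (lx b ^+ 2 * lx d)))
  (pi (ly a ^+ 3 * (lx b * lx d ^+ 2))) (pi (ly a ^+ 3 * lx d ^+ 3))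
  c0 (wedge a b) (wedge a d).
suff : w ord0 = 0 by rewrite /w /cubic_curve (tnth_nth 0).
apply: (curve_coef_mem chark sW (w := w)) => r /ind[c /pi_frame E].
apply: cubic_curve_eq (pi_line (ly a ^+ 3) (lx b) (lx d) r) _.
rewrite -row_linD E; congr (_ *: _ ^+ 3).
by rewrite /wedge !row_linD -!mul_mpolyC; ring.
Qed.

(** Otherwise pi would vanish, whereas S_(3,3) does not. *)
Let c0_neq0 : c0 != 0.
Proof.
apply/eqP => cz.
have sW : subspace (fun p : T2 => pi p = 0).
  by split=> [|r u v uz vz]; rewrite ?linear0 // linearP /= uz vz scaler0 addr0.
have pi0 p : multihomog (fun=> 3%N) p -> pi p = 0.
  move: p; apply: (multipowers_span chark (c := fun=> 3%N) sW) => l.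
  rewrite big_ord_recl big_ord1.
  have -> : lift ord0 ord0 = ord_max :> 'I_2 by apply: val_inj.
  by rewrite pi_cubes cz scale0r.
have hm : @schur k 3 [:: 3; 3]%N (minor i0 i1 ^+ 3).
  apply: lspan_mem; exists (fun _ i => if i == 0%N then i0 else i1).
  rewrite prod3 /=; rewrite !(@colminorE _ _ _ _ _ _ 2) // det_mx22 !mxE /=.
  have -> : (inord 0 : 'I_2) = ord0 by apply: val_inj; rewrite /= inordK.
  have -> : (inord 1 : 'I_2) = ord_max by apply: val_inj; rewrite /= inordK.
  by rewrite /minor !exprS expr0 mulr1 mulrA.
case: piP => _ /(_ _ hm)[p /pi0 -> E] _.
pose c : 'I_(2 * 3) -> k := fun t => mxvec (\matrix_(q < 2, a < 3) ((q == a :> nat)%:R : k)) 0 t.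
move/(congr1 (meval c)): E; rewrite meval0 rmorphXn rmorphB !rmorphM /= !mevalXU /c !mxvecE !mxE /=.
by rewrite mul0r subr0 mul1r expr1n => /eqP; rewrite eq_sym oner_eq0.
Qed.

Definition transc (M : 'M[T2]_3) (f : {mpoly k[3]}) : tensor3 T2 :=
  trans3 M (fun a b c => (polar3 f a b c)%:MP).

Let comp_row (q : 'I_2) (f : {mpoly k[3]}) := f \mPo [tuple (xvar q a : T2) | a < 3].

Let comp_row_lin q a : comp_row q (lin_form a) = row_lin q a.
Proof.
rewrite /comp_row /lin_form linear_sum; apply: eq_bigr => i _ /=.
by rewrite linearZ /= comp_mpolyXU -tnth_nth tnth_mktuple.
Qed.

Let comp_rowP q t f g : comp_row q (t *: f + g) = t *: comp_row q f + comp_row q g.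
Proof. by rewrite /comp_row comp_mpolyD comp_mpolyZ. Qed.

Lemma transc_linear M t f g i j l :
  transc M (t *: f + g) i j l = t%:MP * transc M f i j l + transc M g i j l.
Proof.
apply: trans3D => a b c.
by rewrite polar3_linear mpolyCD mpolyCM.
Qed.

Let pi_transvectant (M : 'M[T2]_3) (f g : {mpoly k[3]}) :
    (forall a, M a i0 = y a) -> (forall a, M a i1 = x a) ->
    f \is 3.-homog -> g \is 3.-homog ->
  pi ((f \mPo [tuple y a | a < 3]) * (g \mPo [tuple x a | a < 3]))
  = c0 *: transvectant (transc M f) (transc M g).
Proof.
move=> My Mx hf hg; rewrite -/(comp_row _ f) -/(comp_row _ g).
have subspace_eq (A : {mpoly k[3]} -> T2) (B : {mpoly k[3]} -> T2) :
    (forall t f g, A (t *: f + g) = t *: A f + A g) ->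
    (forall t f g, B (t *: f + g) = t *: B f + B g) -> subspace (fun f => A f = B f).
  move=> lA lB; have l0 C : (forall t f g, C (t *: f + g) = t *: C f + C g) -> C 0 = 0 :> T2.
    by move=> lC; have := lC (-1) 0 0; rewrite scaler0 addr0 scaleN1r addNr.
  by split=> [|t u v Eu Ev]; rewrite ?l0 // lA lB Eu Ev.
move: g hg; apply: (powers_span chark) => [|b].
  apply: subspace_eq => t g g'.
    by rewrite comp_rowP mulrDr -scalerAr linearP.
  rewrite (transvectant_linearr _ (transc_linear M t g g')).
  by rewrite mul_mpolyC scalerDr !scalerA mulrC.
move: f hf; apply: (powers_span chark) => [|a].
  apply: subspace_eq => t f f'.
    by rewrite comp_rowP mulrDl -scalerAl linearP.
  rewrite (transvectant_linearl _ (transc_linear M t f f')).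
  by rewrite mul_mpolyC scalerDr !scalerA mulrC.
have comp_cube q u : comp_row q (lin_form u ^+ 3) = row_lin q u ^+ 3.
  by rewrite -comp_row_lin /comp_row rmorphXn.
have transc_cube u i j l (L := fun i => \sum_b (u b)%:MP * M b i) :
    transc M (lin_form u ^+ 3) i j l = L i * L j * L l.
  rewrite -trans3_cube; apply: eq_trans3 => ? ? ?.
  by rewrite (polar3_cube chark) !mpolyCM.
have L0 u : \sum_b (u b)%:MP * M b i0 = ly u.
  by apply: eq_bigr => ? _; rewrite My mul_mpolyC.
have L1 u : \sum_b (u b)%:MP * M b i1 = lx u.
  by apply: eq_bigr => ? _; rewrite Mx mul_mpolyC.
rewrite !comp_cube pi_cubes (transvectant_cubes (transc_cube a) (transc_cube b)).
by rewrite !L0 !L1.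
Qed.

(** This determines pi: both sides are bilinear in f and g, and for cubes the
    transvectant is the cube of a minor. *)
Lemma brill_projectionE : exists2 c : k, c != 0 & forall (M : 'M[T2]_3) (f g : {mpoly k[3]}),
    (forall a, M a i0 = y a) -> (forall a, M a i1 = x a) ->
    f \is 3.-homog -> g \is 3.-homog ->
  pi ((f \mPo [tuple y a | a < 3]) * (g \mPo [tuple x a | a < 3]))
  = c *: transvectant (transc M f) (transc M g).
Proof. by exists c0 => //; exact: pi_transvectant. Qed.

End BrillProjection.


(** * Brill's form in a frame *)

Section PowerSum.
Variables (k : fieldType) (chark : [pchar k] =i pred0).

Local Notation m111 := (U_(i0) + U_(i0) + U_(i0))%MM.
Local Notation m12 := (U_(i0) + U_(i1))%MM.

Lemma mesym2_3 : mesym 3 k 2 = 'X_i0 * 'X_i1 + 'X_i0 * 'X_i2 + 'X_i1 * 'X_i2.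
Proof.
rewrite mesymE.
have E : [set h : {set 'I_3} | #|h| == 2%N] = [set ~: [set i] | i : 'I_3].
  apply/setP => h; rewrite inE; apply/idP/imsetP => [h2|[i _ ->]]; last first.
    by rewrite cardsC1 card_ord.
  have : #|~: h| == 1%N by rewrite cardsCs setCK card_ord (eqP h2).
  by case/cards1P => i hi; exists i => //; rewrite -hi setCK.
transitivity (\sum_(h in [set h : {set 'I_3} | #|h| == 2%N]) 'X_[mesym1 h] : {mpoly k[3]}).
  by apply: eq_bigl => h; rewrite inE.
rewrite E big_imset /=; last by move=> i j _ _ /setC_inj/set1_inj.
rewrite (eq_bigl predT) => [|i]; last by rewrite inE.
rewrite sum3 -!mpolyXD addrC addrA addrAC; congr (_ + _ + _); congr 'X_[_];
  by apply/mnmP; apply: forall3; rewrite mnmE !inE /= mnmDE !mnm1E.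
Qed.

Lemma power_sum_poly3 :
  power_sum_poly k 3 = 'X_i0 ^+ 3 - 3%:R *: ('X_i0 * 'X_i1) + 3%:R *: 'X_i2.
Proof.
apply: msym_fundamental_un; rewrite -power_sum_polyE.
rewrite comp_mpolyD comp_mpolyB !comp_mpolyZ rmorphXn rmorphM /= !comp_mpolyXU -!tnth_nth !tnth_mktuple /=.
rewrite mesym1E mesym2_3 mesymnnE prod3 !sum3 /power_sum sum3 !scaler_nat; ring.
Qed.

(** p_3 = e1^3 - 3 e1 e2 + 3 e3 has three monomials. *)
Lemma power_sum_poly_sum (V : nmodType) (F : k -> 'X_{1..3} -> V) :
  \sum_(m <- msupp (power_sum_poly k 3)) F (power_sum_poly k 3)@_m m
  = F 1 m111 + F (- 3%:R) m12 + F 3%:R U_(i2)%MM.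
Proof.
pose c m : k := (m == m111)%:R - 3%:R * (m == m12)%:R + 3%:R * (m == U_(i2)%MM)%:R.
have pE m : (power_sum_poly k 3)@_m = c m.
  rewrite power_sum_poly3 mcoeffD mcoeffB !mcoeffZ !exprS expr0 mulr1 -!mpolyXD !mcoeffX /c.
  by rewrite addmA !(eq_sym m).
have neq m m' : mdeg m != mdeg m' -> (m == m') = false.
  by move=> n; apply/eqP => E; rewrite E eqxx in n.
have [d1 d2 d3] : [/\ (m111 == m12) = false, (m111 == U_(i2)%MM) = false & (m12 == U_(i2)%MM) = false].
  by split; apply: neq; rewrite !mdegD !mdeg1.
have c1 : c m111 = 1 by rewrite /c eqxx d1 d2 !mulr0 subr0 addr0.
have c2 : c m12 = - 3%:R by rewrite /c eqxx eq_sym d1 d3 mulr1 mulr0 sub0r addr0.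
have c3 : c U_(i2)%MM = 3%:R.
  by rewrite /c eqxx ![U_(_)%MM == _]eq_sym d2 d3 mulr1 mulr0 subr0 add0r.
rewrite (perm_big [:: m111; m12; U_(i2)%MM]) /=.
  by rewrite !big_cons big_nil addr0 !pE c1 c2 c3 addrA.
apply: uniq_perm; rewrite ?msupp_uniq //= ?inE ?d1 ?d2 ?d3 //.
move=> m; rewrite mcoeff_msupp pE !inE.
have [->|n1] := eqVneq m m111; first by rewrite c1 oner_eq0.
have [->|n2] := eqVneq m m12; first by rewrite c2 oppr_eq0 natk_neq0.
have [->|n3] := eqVneq m U_(i2)%MM; first by rewrite c3 natk_neq0.
by rewrite /c (negbTE n1) (negbTE n2) (negbTE n3) !mulr0 subr0 addr0 eqxx.
Qed.

End PowerSum.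

Section BrillForm.
Variable S : comNzRingType.
Implicit Types F : tensor3 S.

(** The polarization in x of Q_f(x, z), in a frame whose third vector is z. *)
Definition brillQ F : tensor3 S := fun i j l =>
  27 * F i2 i2 i * F i2 i2 j * F i2 i2 l
  - 9 * F i2 i2 i2 * (F i2 i2 i * F i2 j l + F i2 i2 j * F i2 i l + F i2 i2 l * F i2 i j)
  + 3 * F i2 i2 i2 ^+ 2 * F i j l.

(** The image of f(y) Q_f(x, z) under the projection, up to a factor, for a
    cubic f with tensor F in the frame (y, x, z). *)
Definition brillB F : S := transvectant F (brillQ F).

Lemma brillB_hess F : sym3 F ->
  2 * brillB F = 27 * (F i0 i2 i2 * hess F i1 i2 i2 - F i1 i2 i2 * hess F i0 i2 i2).
Proof. exact: brill_hess. Qed.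

Lemma eq_brillQ F G i j l : (forall i j l, F i j l = G i j l) -> brillQ F i j l = brillQ G i j l.
Proof. by move=> E; rewrite /brillQ !E. Qed.

Lemma eq_brillB F G : (forall i j l, F i j l = G i j l) -> brillB F = brillB G.
Proof. by move=> E; rewrite /brillB /transvectant /brillQ !E. Qed.

End BrillForm.

Lemma brillQ_map (S S' : comNzRingType) (phi : {rmorphism S -> S'}) (F : tensor3 S) i j l :
  phi (brillQ F i j l) = brillQ (fun i j l => phi (F i j l)) i j l.
Proof.
by rewrite /brillQ !(rmorph_nat, rmorphXn, rmorphN, rmorphM, rmorphD).
Qed.

Lemma brillB_map (S S' : comNzRingType) (phi : {rmorphism S -> S'}) (F : tensor3 S) :
  phi (brillB F) = brillB (fun i j l => phi (F i j l)).
Proof.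
rewrite /brillB /transvectant -!brillQ_map.
by rewrite !(rmorph_nat, rmorphN, rmorphM, rmorphD).
Qed.

(** The line z + t x, in coordinates on the frame (y, x, z). *)
Definition line_mx (S : comNzRingType) : 'M[{poly S}]_3 :=
  \matrix_(i, j) tnth [tuple 0; 'X; 1] i.

Lemma trans3_line (S : comNzRingType) (T : tensor3 S) : sym3 T ->
  trans3 (line_mx S) (fun a b c => (T a b c)%:P) i0 i0 i0
  = (T i2 i2 i2)%:P + (3 * T i2 i2 i1)%:P * 'X + (3 * T i2 i1 i1)%:P * 'X^2
            + (T i1 i1 i1)%:P * 'X^3.
Proof.
move=> sT; rewrite /trans3 /line_mx; do 3 under eq_bigr => ? _ do rewrite ?sum3.
rewrite !sum3 !mxE !(tnth_nth 0) /= !(sorted3 sT) !rmorphM /= !polyC_natr; ring.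
Qed.

Lemma cubic_coefs (S : comNzRingType) (a b c d : S)
  (p := a%:P + b%:P * 'X + c%:P * 'X^2 + d%:P * 'X^3) :
  [/\ p`_0 = a, p`_1 = b, p`_2 = c & p`_3 = d].
Proof. by split; rewrite /p !coefE /= !(mulr0, mulr1, addr0, add0r). Qed.

Section BrillTensor.
Variables (k : fieldType) (chark : [pchar k] =i pred0).

Local Notation Syx := {mpoly k[2 * 3]}.
Local Notation Syxz := {mpoly {mpoly k[2 * 3]}[3]}.
Local Notation y a := (xvar (ord0 : 'I_2) a : Syx).
Local Notation x a := (xvar (ord_max : 'I_2) a : Syx).

Lemma xvar0E a : xvar0 k a = y a.
Proof. by congr (xvar _ _); apply: val_inj. Qed.
Lemma xvar1E a : xvar1 k a = x a.
Proof. by congr (xvar _ _); apply: val_inj. Qed.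

(** The frame (y, x, z) of indeterminate vectors. *)
Definition yxz : 'M[Syxz]_3 :=
  \matrix_(a, j) tnth [tuple (y a)%:MP; (x a)%:MP; 'X_a] j.

Definition yxz_tensor (f : {mpoly k[3]}) : tensor3 Syxz :=
  trans3 yxz (fun a b c => (polar3 f a b c)%:MP%:MP).

Lemma yxz_tensor_sym f : sym3 (yxz_tensor f).
Proof.
apply: trans3_sym => a b c; have [E1 E2] := polar3_sym f a b c.
by split; rewrite ?E1 // -E1 E2.
Qed.

(** Restrict f to the line z + t x by polar3_diag. *)
Lemma shiftE (f : {mpoly k[3]}) (T := yxz_tensor f) : f \is 3.-homog ->
  shift f = (T i2 i2 i2)%:P + (3 * T i2 i2 i1)%:P * 'X + (3 * T i2 i1 i1)%:P * 'X^2
            + (T i1 i1 i1)%:P * 'X^3.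
Proof.
move=> hf.
pose iota : {rmorphism k -> {poly Syxz}} := polyC \o (@mpolyC 3 Syx \o @mpolyC (2 * 3) k).
pose s a : {poly Syxz} := ('X_a)%:P + ((xvar1 k a)%:MP)%:P * 'X.
pose phi : {rmorphism {mpoly k[3]} -> {poly Syxz}} := mmap iota s.
have phiX a : phi 'X_a = s a by rewrite /phi /= mmapX mmap1U.
pose E := line_mx Syxz.
have M0 a : (map_mx polyC yxz *m E) a i0 = phi 'X_a.
  rewrite phiX mxE sum3 !mxE !(tnth_nth 0) /= /s xvar1E; ring.
have phiC c : phi c%:MP = iota c by rewrite /phi /= mmapC.
rewrite -[LHS]/(phi f) (polar3_diag chark phiC M0 hf) -trans3_comp.
rewrite (@eq_trans3 _ _ _ (fun a b c => (T a b c)%:P)); last first.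
  by move=> a b c; rewrite (trans3_map polyC).
exact: trans3_line (yxz_tensor_sym f).
Qed.

Lemma brill_tensorE (f : {mpoly k[3]}) : f \is 3.-homog ->
  brill_tensor 3 f = (f \mPo [tuple y a | a < 3])%:MP * brillQ (yxz_tensor f) i1 i1 i1.
Proof.
move=> hf; rewrite /brill_tensor.
have -> : [tuple xvar0 k a | a < 3] = [tuple y a | a < 3].
  by apply: eq_from_tnth => a; rewrite !tnth_mktuple xvar0E.
congr (_%:MP * _).
set T := yxz_tensor f.
have [f0 f1 f2 f3] : [/\ fcoef f 0 = T i2 i2 i2, fcoef f 1 = 3 * T i2 i2 i1,
    fcoef f 2 = 3 * T i2 i1 i1 & fcoef f 3 = T i1 i1 i1].
  by rewrite /fcoef (shiftE hf); exact: cubic_coefs.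
rewrite /Qbrill (power_sum_poly_sum chark (fun c m => c%:MP%:MP * fcoef f 0 ^+ (3 - mdeg m)
      * \prod_(i < 3) fcoef f i.+1 ^+ m i)).
rewrite !prod3 !mdegD !mdeg1 !mnmDE !mnm1E [nat_of_ord _]/=.
rewrite f0 f1 f2 f3 !rmorphN !rmorph_nat !rmorph1 /brillQ.
move: (T i2 i2 i2) (T i2 i2 i1) (T i2 i1 i1) (T i1 i1 i1) => T0 T1 T2 T3 /=; ring.
Qed.

End BrillTensor.


(** * The form Q_f at a fixed point *)

Lemma map_mpoly_meval (R S : comNzRingType) n (phi : {rmorphism R -> S}) (P : {mpoly R[n]}) v :
  phi P.@[v] = (map_mpoly phi P).@[fun i => phi (v i)].
Proof.
rewrite mevalE rmorph_sum [in RHS](mpolyE P) [X in X.@[_]]raddf_sum [RHS]raddf_sum; apply: eq_bigr => m _ /=.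
rewrite rmorphM map_mpolyZ map_mpolyX mevalZ mevalX rmorph_prod; congr (_ * _).
by apply: eq_bigr => i _; rewrite rmorphXn.
Qed.

Lemma trans3_prod (S : comNzRingType) (M : 'M[S]_3) (A : 'I_3 -> S) (B : 'I_3 -> 'I_3 -> S) i j l
    (Am := fun i => \sum_a A a * M a i)
    (Bm := fun i j => \sum_a \sum_b B a b * (M a i * M b j)) :
  [/\ trans3 M (fun a b c => A a * B b c) i j l = Am i * Bm j l,
      trans3 M (fun a b c => A b * B a c) i j l = Am j * Bm i l
    & trans3 M (fun a b c => A c * B a b) i j l = Am l * Bm i j].
Proof.
rewrite /trans3 /Am /Bm !big_distrl /=; split.
- apply: eq_bigr => a _; rewrite big_distrr; apply: eq_bigr => b _ /=.
  by rewrite big_distrr; apply: eq_bigr => c _ /=; ring.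
- rewrite exchange_big /=; apply: eq_bigr => a _; rewrite big_distrr; apply: eq_bigr => b _ /=.
  by rewrite big_distrr; apply: eq_bigr => c _ /=; ring.
under eq_bigr => a _ do rewrite exchange_big /=.
rewrite exchange_big /=; apply: eq_bigr => c _; rewrite big_distrr; apply: eq_bigr => a _ /=.
by rewrite big_distrr; apply: eq_bigr => b _ /=; ring.
Qed.

(** Linearity of the change of frame, in the shape needed for brillQ. *)
Lemma trans3_combine (S : comNzRingType) (M : 'M[S]_3) (F G1 G2 G3 G4 H : tensor3 S) (s t : S) i j l :
    (forall a b c, H a b c = 27 * G1 a b c - s * (G2 a b c + G3 a b c + G4 a b c) + t * F a b c) ->
  trans3 M H i j l = 27 * trans3 M G1 i j l
    - s * (trans3 M G2 i j l + trans3 M G3 i j l + trans3 M G4 i j l) + t * trans3 M F i j l.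
Proof.
move=> E; pose Z : tensor3 S := fun _ _ _ => 0.
have Z0 : trans3 M Z i j l = 0.
  by apply: big1 => a _; apply: big1 => b _; apply: big1 => c _; rewrite mulr0.
pose K4 a b c := t * F a b c + Z a b c; pose K3 a b c := - s * G4 a b c + K4 a b c.
pose K2 a b c := - s * G3 a b c + K3 a b c; pose K1 a b c := - s * G2 a b c + K2 a b c.
rewrite (@trans3D _ _ 27 G1 K1 H) => [|a b c]; last by rewrite E /K1 /K2 /K3 /K4 /Z; ring.
rewrite (@trans3D _ _ (- s) G2 K2 K1) // (@trans3D _ _ (- s) G3 K3 K2) //.
rewrite (@trans3D _ _ (- s) G4 K4 K3) // (@trans3D _ _ t F Z K4) // Z0; ring.
Qed.

Section BrillValues.
Variables (k : fieldType) (chark : [pchar k] =i pred0).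

Local Notation Syx := {mpoly k[2 * 3]}.

Lemma sym3_word (S : comNzRingType) (F : tensor3 S) (sF : sym3 F) i j l :
  F (tnth (word (idx3 i j l)) i0) (tnth (word (idx3 i j l)) i1) (tnth (word (idx3 i j l)) i2)
  = F i j l.
Proof.
move: i j l; apply: forall3; apply: forall3; apply: forall3;
  by rewrite word_idx3 !(tnth_nth i0) /= ?(sorted3 sF).
Qed.

Lemma sym3_polar (F : tensor3 k) : sym3 F ->
  exists2 f : {mpoly k[3]}, f \is 3.-homog & forall i j l, polar3 f i j l = F i j l.
Proof.
move=> sF.
have [f hf fE] := polar3_surj chark (fun l =>
  F (tnth (word l) i0) (tnth (word l) i1) (tnth (word l) i2)).
by exists f => // i j l; rewrite /polar3 fE sym3_word.
Qed.

(** So brill_projectionE applies to f and Q_f(x, z) for each z. *)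
Lemma brillQ_polar (f : {mpoly k[3]}) (z : 'I_3 -> k) :
  exists2 g : {mpoly k[3]}, g \is 3.-homog & forall (M : 'M[Syx]_3),
    (forall a, M a i2 = (z a)%:MP) -> forall i j l,
    transc M g i j l = brillQ (transc M f) i j l.
Proof.
have sF := polar3_sym f; set F := polar3 f in sF *.
pose B a b := \sum_c F a b c * z c; pose A a := \sum_b B a b * z b; pose A0 := \sum_a A a * z a.
have BC a b : B a b = B b a by apply: eq_bigr => c _; rewrite (sF a b c).1.
pose G a b c := 27 * A a * A b * A c - 9 * A0 * (A a * B b c + A b * B a c + A c * B a b)
  + 3 * A0 ^+ 2 * F a b c.
have sG : sym3 G.
  move=> a b c; split; rewrite /G; first by rewrite (sF a b c).1 (BC a b); ring.
  by rewrite (sF a b c).2 (BC b c); ring.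
have [g hg gE] := sym3_polar sG; exists g => // M Mz i j l.
pose Am i := \sum_a (A a)%:MP * M a i.
pose Bm i j := \sum_a \sum_b (B a b)%:MP * (M a i * M b j).
have TB i' j' : transc M f i2 i' j' = Bm i' j'.
  rewrite /transc /trans3 [LHS]exchange_big /=; apply: eq_bigr => a _.
  rewrite [LHS]exchange_big /=; apply: eq_bigr => b _.
  rewrite rmorph_sum /= mulr_suml; apply: eq_bigr => c _.
  by rewrite Mz -/F (sF c a b).1 (sF a c b).2 (mpolyCM _ (F a b c)); ring.
have TA i' : transc M f i2 i2 i' = Am i'.
  rewrite TB /Bm exchange_big; apply: eq_bigr => b _ /=.
  rewrite rmorph_sum /= mulr_suml; apply: eq_bigr => a _.
  by rewrite Mz (BC b a) (mpolyCM _ (B a b)); ring.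
have TA0 : transc M f i2 i2 i2 = A0%:MP.
  by rewrite TA /Am rmorph_sum /=; apply: eq_bigr => a _; rewrite Mz (mpolyCM _ (A a)).
rewrite /brillQ !TA0 !TA !TB.
have [E1 E2 E3] := trans3_prod M (fun a => (A a)%:MP) (fun a b => (B a b)%:MP) i j l.
have {}E1 : _ = Am i * Bm j l := E1; have {}E2 : _ = Am j * Bm i l := E2.
have {}E3 : _ = Am l * Bm i j := E3.
have E0 : _ = Am i * Am j * Am l := trans3_cube M (fun a => (A a)%:MP) i j l.
rewrite [LHS](@trans3_combine Syx M (fun a b c => (F a b c)%:MP)
   (fun a b c => (A a)%:MP * (A b)%:MP * (A c)%:MP)
   (fun a b c => (A a)%:MP * (B b c)%:MP) (fun a b c => (A b)%:MP * (B a c)%:MP)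
   (fun a b c => (A c)%:MP * (B a b)%:MP) _
   (9 * A0%:MP) (3 * A0%:MP ^+ 2)) => [|a b c].
  rewrite -[transc M f i j l]/(trans3 M (fun a b c => (F a b c)%:MP) i j l).
  by rewrite E0 E1 E2 E3; ring.
rewrite gE /G ; move: (A a) (A b) (A c) (B b c) (B a c) (B a b) (F a b c) => ? ? ? ? ? ? ?.
by rewrite !(rmorph_nat, rmorphD, rmorphN, rmorphM, rmorphXn) /=; ring.
Qed.
End BrillValues.


(** * The Brill equations as coefficients and as values *)

Lemma map_mpoly_meval2 (R S : comNzRingType) m n (phi : {rmorphism R -> S})
    (P : {mpoly {mpoly R[m]}[n]}) u v :
  phi P.@[u].@[v] = (map_mpoly (map_mpoly phi) P).@[fun a => map_mpoly phi (u a)].@[fun i => phi (v i)].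
Proof. by rewrite map_mpoly_meval (map_mpoly_meval (map_mpoly phi)). Qed.

Section CoefficientsAndValues.
Variables (k : fieldType) (chark : [pchar k] =i pred0).

Lemma meval_mem (S : comAlgType k) (W : S -> Prop) (sW : subspace W) n (P : {mpoly S[n]}) :
  (forall m, W P@_m) -> forall c : 'I_n -> k, W (P.@[fun i => (c i)%:A]).
Proof.
move=> WP c; rewrite mevalE; apply: (subspace_sum sW) => m _.
have -> : \prod_i (c i)%:A ^+ m i = (\prod_i c i ^+ m i)%:A :> S.
  rewrite -[RHS]/(in_alg S _) rmorph_prod; apply: eq_bigr => i _.
  by rewrite rmorphXn.
by rewrite mulr_algr; apply: subspaceZ.
Qed.

Lemma meval2_inj m n (P Q : {mpoly {mpoly k[m]}[n]}) :
    (forall (z : 'I_n -> k) (v : 'I_m -> k),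
       P.@[fun a => (z a)%:MP].@[v] = Q.@[fun a => (z a)%:MP].@[v]) -> P = Q.
Proof.
move=> E; apply/mpolyP => t; apply: (meval_inj chark) => v.
rewrite -!(mcoeff_map_mpoly (meval v)); congr (_@__).
apply: (meval_inj chark) => z; have := E z v.
by rewrite !(map_mpoly_meval (meval v)) /= => E'; rewrite (meval_eq (v2 := fun i => (z i)%:MP.@[v])) ?E'
   => [|i]; rewrite ?mevalC //; apply: meval_eq => i; rewrite mevalC.
Qed.

(** The coefficients of a polynomial and its values at numerical points span
    the same space. *)
Lemma meval2_mem (A : comAlgType k) (W : A -> Prop) (sW : subspace W) m n
    (P : {mpoly {mpoly A[m]}[n]}) :
  (forall s t, W P@_s@_t) <->
  (forall (z : 'I_n -> k) (v : 'I_m -> k),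
      W (P.@[fun a => ((z a)%:A)%:MP].@[fun i => (v i)%:A])).
Proof.
have swap z v : P.@[fun a => ((z a)%:A)%:MP].@[fun i => (v i)%:A]
    = (map_mpoly (meval (fun i => (v i)%:A)) P).@[fun a => (z a)%:A].
  by rewrite (map_mpoly_meval (meval _)) /=; apply: meval_eq => i; rewrite mevalC.
split=> [WP z v|WP s t].
  rewrite swap; apply: (meval_mem sW) => s; rewrite mcoeff_map_mpoly /=.
  by apply: (meval_mem sW) => t; apply: WP.
apply: (mcoeff_mem chark sW) => v; rewrite -(mcoeff_map_mpoly (meval _)).
by apply: (mcoeff_mem chark sW) => z; rewrite -swap; apply: WP.
Qed.

(** Constants are scalars for pi. *)
Lemma map_linear_meval m n (pi : {linear {mpoly k[m]} -> {mpoly k[m]}})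
    (P : {mpoly {mpoly k[m]}[n]}) (z : 'I_n -> k) :
  (map_mpoly pi P).@[fun a => (z a)%:MP] = pi P.@[fun a => (z a)%:MP].
Proof.
rewrite [in LHS](mpolyE P) [X in X.@[_]]raddf_sum [LHS]raddf_sum mevalE [RHS]raddf_sum.
apply: eq_bigr => t _ /=.
have -> : map_mpoly pi (P@_t *: 'X_[t]) = pi P@_t *: 'X_[t].
  apply/mpolyP => s; rewrite mcoeff_map_mpoly !mcoeffZ !mcoeffX.
  by case: eqP; rewrite ?mulr1 ?mulr0 ?raddf0.
rewrite mevalZ mevalX.
have -> : \prod_i ((z i)%:MP : {mpoly k[m]}) ^+ t i = (\prod_i z i ^+ t i)%:MP.
  by rewrite rmorph_prod; apply: eq_bigr => i _; rewrite rmorphXn.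
by rewrite ![_ * _%:MP]mulrC !mul_mpolyC linearZ.
Qed.

End CoefficientsAndValues.

Section BrillEquations.
Variables (k : fieldType) (chark : [pchar k] =i pred0).

Local Notation Syx := {mpoly k[2 * 3]}.
Local Notation Syxz := {mpoly {mpoly k[2 * 3]}[3]}.
Local Notation Rring := {mpoly k[#|basis 3 3|]}.
Local Notation Runiv := {mpoly {mpoly {mpoly k[#|basis 3 3|]}[2 * 3]}[3]}.
Local Notation X3 := (X3 k).
Local Notation y a := (xvar (ord0 : 'I_2) a : Syx).
Local Notation x a := (xvar (ord_max : 'I_2) a : Syx).

Variables (pi : {linear Syx -> Syx}) (c : k) (c_neq0 : c != 0).
Hypothesis piE : forall (M : 'M[Syx]_3) (f g : {mpoly k[3]}),
    (forall a, M a i0 = y a) -> (forall a, M a i1 = x a) ->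
    f \is 3.-homog -> g \is 3.-homog ->
  pi ((f \mPo [tuple y a | a < 3]) * (g \mPo [tuple x a | a < 3]))
  = c *: transvectant (transc M f) (transc M g).

Definition frame (z : 'I_3 -> k) : 'M[Syx]_3 :=
  \matrix_(a, j) tnth [tuple y a; x a; (z a)%:MP] j.

Lemma brill_value f z : f \is 3.-homog ->
  (map_mpoly pi (brill_tensor 3 f)).@[fun a => (z a)%:MP] = c *: brillB (transc (frame z) f).
Proof.
move=> hf; rewrite map_linear_meval brill_tensorE // mevalM mevalC.
pose theta : {rmorphism Syxz -> Syx} := meval (fun a => (z a)%:MP).
rewrite -[X in pi (_ * X)]/(theta _).
have thetaT i j l : theta (yxz_tensor f i j l) = transc (frame z) f i j l.
  rewrite /yxz_tensor (trans3_map theta) /transc.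
  have -> : map_mx theta (yxz k) = frame z.
    apply/matrixP => a; apply: forall3; rewrite !mxE !(tnth_nth 0) /=;
    by rewrite /theta /= ?mevalC ?mevalXU.
  by apply: eq_trans3 => a b d; rewrite /theta /= mevalC.
have fz a : frame z a i2 = (z a)%:MP by rewrite mxE (tnth_nth 0).
have [g hg gE] := brillQ_polar chark f z; have {}gE := gE _ fz.
have -> : theta (brillQ (yxz_tensor f) i1 i1 i1) = g \mPo [tuple x a | a < 3].
  have -> : theta (brillQ (yxz_tensor f) i1 i1 i1) = brillQ (transc (frame z) f) i1 i1 i1.
    by rewrite brillQ_map; apply: eq_brillQ.
  rewrite -gE /transc; symmetry.
  apply: (polar3_diag chark (iota := @mpolyC (2 * 3) k) (phi := comp_mpoly [tuple x a | a < 3])) => //.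
    by move=> t /=; rewrite comp_mpolyC.
  by move=> a /=; rewrite comp_mpolyXU -tnth_nth tnth_mktuple mxE (tnth_nth 0).
rewrite (piE (M := frame z)) // => [|a|a]; rewrite ?mxE ?(tnth_nth 0) //.
congr (_ *: _); rewrite /brillB /transvectant !gE //.
Qed.

(** Brill's form of the generic cubic, in the frame (u, v, w). *)
Definition brill_at u v w : Rring := brillB (trans3 (map_mx (@mpolyC _ k) (cols u v w)) X3).

Let yv (t : 'I_(2 * 3) -> k) (a : 'I_3) : k := t (mxvec_index ord0 a).
Let xv (t : 'I_(2 * 3) -> k) (a : 'I_3) : k := t (mxvec_index ord_max a).

Lemma brill_value_at f z t : f \is 3.-homog ->
  (map_mpoly pi (brill_tensor 3 f)).@[fun a => (z a)%:MP].@[t]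
  = evalR (c *: brill_at (yv t) (xv t) z) f.
Proof.
move=> hf; rewrite brill_value // mevalZ /evalR mevalZ; congr (_ * _).
rewrite (brillB_map (meval t)) (brillB_map (meval (polar f))); apply: eq_brillB => i j l.
apply: etrans (esym (evalR_trans3 f _ i j l)); rewrite /transc (trans3_map (meval t)).
have -> : map_mx (meval t) (frame z) = cols (yv t) (xv t) z.
  apply/matrixP => a; apply: forall3; rewrite !mxE !(tnth_nth 0) /=;
  by rewrite ?mevalC ?mevalXU.
have -> : map_mx (fun F : Rring => evalR F f) (map_mx (@mpolyC _ k) (cols (yv t) (xv t) z))
    = cols (yv t) (xv t) z.
  by apply/matrixP => a b; rewrite !mxE /evalR mevalC.
by apply: eq_trans3 => a b d /=; rewrite mevalC.
Qed.

(** The tensor (pi (x) id)(f (x) Q_f) of the generic cubic f; its coefficients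
    lie in R. *)
Definition brill_univ : Runiv := c%:MP%:MP%:MP * brillB (trans3
  (\matrix_(a, j) tnth [tuple ('X_(mxvec_index (ord0 : 'I_2) a))%:MP;
     ('X_(mxvec_index (ord_max : 'I_2) a))%:MP; 'X_a] j)
  (fun i j l => (X3 i j l)%:MP%:MP)).

Lemma brill_univ_value z t :
  brill_univ.@[fun a => ((z a)%:A)%:MP].@[fun i => (t i)%:A] = c *: brill_at (yv t) (xv t) z.
Proof.
pose phi : {rmorphism Runiv -> {mpoly Rring[2 * 3]}} := meval (fun a => ((z a)%:A)%:MP).
pose psi : {rmorphism {mpoly Rring[2 * 3]} -> Rring} := meval (fun i => (t i)%:A).
rewrite /brill_univ !mevalM !mevalC mul_mpolyC; congr (_ *: _).
rewrite -[LHS]/(psi (phi _)).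
rewrite (brillB_map phi) (brillB_map psi); apply: eq_brillB => i j l.
rewrite (trans3_map phi) (trans3_map psi).
set M := map_mx psi _; have -> : M = map_mx (@mpolyC _ k) (cols (yv t) (xv t) z).
  apply/matrixP => a; apply: forall3; rewrite !mxE !(tnth_nth 0) /=;
  by rewrite /phi /psi /= ?(mevalC, mevalXU) alg_mpolyC.
by apply: eq_trans3 => a b d; rewrite /phi /psi /= !mevalC.
Qed.

(** An element of R is determined by its values on cubics, and those of the
    coefficients of brill_univ are given by brill_value_at. *)
Lemma brill_eqE F : brill_eq pi F <-> exists mz myx, F = brill_univ@_mz@_myx.
Proof.
have H mz myx f : f \is 3.-homog ->
    evalR (brill_univ@_mz@_myx) f = (map_mpoly pi (brill_tensor 3 f))@_mz@_myx.
  move=> hf; pose eps : {rmorphism Rring -> k} := meval (polar f).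
  suff <- : map_mpoly (map_mpoly eps) brill_univ = map_mpoly pi (brill_tensor 3 f).
    by rewrite !mcoeff_map_mpoly.
  apply: (meval2_inj chark) => z t.
  apply: etrans (esym (brill_value_at z t hf)).
  rewrite -brill_univ_value; move: brill_univ => P.
  apply: etrans (esym (map_mpoly_meval2 eps P _ _)).
  have -> : (fun a => map_mpoly eps ((z a)%:A)%:MP) = (fun a => (z a)%:MP) :> ('I_3 -> Syx).
    by apply: boolp.funext => a; rewrite map_mpolyC /eps /= alg_mpolyC mevalC.
  have -> : (fun i => eps (t i)%:A) = t; last by [].
  by apply: boolp.funext => i; rewrite /eps /= alg_mpolyC mevalC.
split=> [[mz [myx FE]]|[mz [myx ->]]]; exists mz, myx; last by move=> f hf; exact: H.
by apply: (evalR_ext chark) => f hf; rewrite H // FE.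
Qed.

Section Membership.
Variables (W : Rring -> Prop) (sW : subspace W).

Lemma brill_eq_mem : (forall F, brill_eq pi F -> W F) <-> (forall u v w, W (brill_at u v w)).
Proof.
split=> [WF u v w|WG F /brill_eqE[mz [myx ->]]]; last first.
  move: mz myx; apply/(meval2_mem chark sW) => z t; rewrite brill_univ_value.
  exact: subspaceZ.
have : forall mz myx, W brill_univ@_mz@_myx.
  by move=> mz myx; apply: WF; apply/brill_eqE; exists mz, myx.
pose t i := mxvec (\matrix_(q < 2, a < 3) (if q == ord0 then u a else v a)) 0 i.
have yt : yv t = u by apply: boolp.funext => a; rewrite /yv /t mxvecE mxE.
have xt : xv t = v by apply: boolp.funext => a; rewrite /xv /t mxvecE mxE.
move/(meval2_mem chark sW) => /(_ w t).
by rewrite brill_univ_value yt xt => /(subspaceZ sW c^-1); rewrite scalerA mulVf // scale1r.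
Qed.

End Membership.
End BrillEquations.


(** * The ideal of Y is generated by the Brill equations *)

Section IdealSpan.
Variables (k : fieldType) (n : nat) (G : {mpoly k[n]} -> Prop).

Lemma ideal_genP (I : {mpoly k[n]} -> Prop) :
    (forall x, G x -> I x) -> (forall a x, I x -> I (a * x)) ->
    (forall x y, I x -> I y -> I (x + y)) -> I 0 ->
  forall x, ideal_gen G x -> I x.
Proof.
move=> GI IM ID I0 x [r [a [s [Gs ->]]]].
by apply: big_ind => // i _; apply/IM/GI.
Qed.

Lemma ideal_genD x y : ideal_gen G x -> ideal_gen G y -> ideal_gen G (x + y).
Proof.
move=> [r [a [s [Gs ->]]]] [r' [a' [s' [Gs' ->]]]].
exists (r + r')%N, (fun i => match split i with inl j => a j | inr j => a' j end),
  (fun i => match split i with inl j => s j | inr j => s' j end); split.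
  by move=> i; case: (split i).
rewrite big_split_ord /=; congr (_ + _); apply: eq_bigr => i _.
  by rewrite (unsplitK (inl i)).
by rewrite (unsplitK (inr i)).
Qed.

Lemma ideal_genM b x : ideal_gen G x -> ideal_gen G (b * x).
Proof.
move=> [r [a [s [Gs ->]]]]; exists r, (fun i => b * a i), s; split=> //.
by rewrite mulr_sumr; apply: eq_bigr => i _; rewrite mulrA.
Qed.

Lemma ideal_gen0 : ideal_gen G 0.
Proof.
by exists 0%N, (fun=> 0), (fun=> 0); split=> [[]|] //; rewrite big_ord0.
Qed.

Lemma ideal_gen_sum (I : Type) (r : seq I) (F : I -> {mpoly k[n]}) :
  (forall i, ideal_gen G (F i)) -> ideal_gen G (\sum_(i <- r) F i).
Proof. by move=> GF; apply: big_ind => //; [apply: ideal_gen0 | apply: ideal_genD]. Qed.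

Lemma lspan_ideal_gen x : lspan G x -> ideal_gen G x.
Proof.
move=> [r [a [s [Gs ->]]]]; exists r, (fun i => (a i)%:MP), s; split=> //.
by apply: eq_bigr => i _; rewrite mul_mpolyC.
Qed.

End IdealSpan.

Section BrillIdeal.
Variables (k : fieldType) (chark : [pchar k] =i pred0).

Local Notation Rring := {mpoly k[#|basis 3 3|]}.
Local Notation Syx := {mpoly k[2 * 3]}.
Local Notation X3 := (X3 k).
Local Notation bracket := (bracket k).
Implicit Types (a b c u v w : 'I_3 -> k).

(** The bracket of u w^2 and v w^2. *)
Definition bracket_at w u v : Rring :=
  ev3 X3 u w w * ev3 (hess X3) v w w - ev3 X3 v w w * ev3 (hess X3) u w w.

(** brill_hess, in the frame (u, v, w). *)
Lemma brill_at_bracket u v w : brill_at u v w = (27%:R / 2%:R * \det (cols u v w) ^+ 2) *: bracket_at w u v.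
Proof.
apply: (scalerI (natk_neq0 chark 1)); rewrite scalerA [LHS]scaler_nat -[LHS]mulr_natl.
rewrite /brill_at (brillB_hess (trans3_sym _ (X3_sym k))) !hess_cols !ev3_cols !(tnth_nth u) /=.
rewrite [X in _ = X *: _]mulrA [2%:R * (_ / _)]mulrC mulfVK ?natk_neq0 // -mul_mpolyC.
by rewrite /bracket_at !rmorphM !rmorph_nat; ring.
Qed.

Lemma bracket_at_Dl w u u' v : bracket_at w (fun i => 1 * u i + u' i) v = bracket_at w u v + bracket_at w u' v.
Proof. by rewrite /bracket_at !ev3_Dl !scale1r; ring. Qed.

Lemma bracket_at_Phi a b : bracket_at a a b = Phi a b.
Proof.
have s F : sym3 F -> ev3 F b a a = ev3 F a a b :> Rring.
  by move=> sF; rewrite (ev3_sym sF _ _ _).1 (ev3_sym sF _ _ _).2.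
by rewrite /bracket_at /Phi (s _ (X3_sym k)) (s _ (@hess_sym _ X3)).
Qed.

Section Membership.
Variables (W : Rring -> Prop) (sW : subspace W).

Lemma brackets_brill_at : (forall l l', W (bracket l l')) -> forall u v w, W (brill_at u v w).
Proof.
by move=> WB u v w; rewrite brill_at_bracket; apply: subspaceZ => //; apply: brackets_ev3.
Qed.

(** The factor det(u, v, w)^2 in brill_at_bracket vanishes for u = w; so replace
    a by a + c and by c, with c outside of the plane of a and b. *)
Lemma brill_at_Phi : (forall u v w, W (brill_at u v w)) -> forall a b, W (Phi a b).
Proof.
move=> WG a b; case: (dependent_or a b) => [[c nd]|[s [t [w [-> ->]]]]]; last first.
  have -> : Phi (fun i => s * w i) (fun i => t * w i) = 0; last exact: sW.1.
  by rewrite /Phi !ev3Z -!mul_mpolyC !mpolyCM; ring.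
have WK u v : \det (cols u v a) != 0 -> W (bracket_at a u v).
  move=> ndu; have := subspaceZ sW (27%:R / 2%:R * \det (cols u v a) ^+ 2)^-1 (WG u v a).
  rewrite brill_at_bracket scalerA mulVf ?scale1r //.
  by rewrite !mulf_neq0 ?invr_eq0 ?expf_neq0 ?natk_neq0.
have dE u v u' : \det (cols u v u') = - \det (cols u' v u).
  by rewrite !det3 !mxE !(tnth_nth 0) /=; ring.
have -> : Phi a b = bracket_at a (fun i => 1 * a i + c i) b - bracket_at a c b.
  by rewrite bracket_at_Dl addrK bracket_at_Phi.
apply: subspaceB => //; apply: WK; last by rewrite dE oppr_eq0.
have -> : \det (cols (fun i => 1 * a i + c i) b a) = - \det (cols a b c).
  by rewrite !det3 !mxE !(tnth_nth 0) /=; ring.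
by rewrite oppr_eq0.
Qed.

End Membership.

Variables (U : vectType k) (e : 3.-tuple U) (eU : basis_of {:U} e).
Variables (pi : {linear Syx -> Syx}) (piP : brill_projection 3 e pi).

Lemma brill_membership (W : Rring -> Prop) : subspace W ->
  (forall F, brill_eq pi F -> W F) <-> (forall a b, W (Phi a b)).
Proof.
move=> sW; have [c c0 piE] := brill_projectionE chark eU piP.
apply: (iff_trans (brill_eq_mem chark c0 piE sW)); split=> [WG|WP]; first exact: brill_at_Phi.
by apply: brackets_brill_at => //; apply: Phi_brackets.
Qed.

Lemma brill_kernel (F : Rring) : brill_eq pi F -> RtoA F = 0.
Proof.
have sW : subspace (fun F : Rring => RtoA F = 0).
  by split=> [|t G H G0 H0]; rewrite ?linear0 // linearP /= G0 H0 scaler0 addr0.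
move: F; apply/(brill_membership sW); apply: (brill_at_Phi sW); apply: (brackets_brill_at sW).
exact: RtoA_bracket.
Qed.

Lemma bracket_brill l l' : lspan (@brill_eq k 3 3 pi) (bracket l l').
Proof.
move: l l'; apply: (Phi_brackets chark (lspan_subspace _)).
apply/(brill_membership (lspan_subspace _)); exact: lspan_mem.
Qed.

(** J is generated by the brackets, by kernel_bracket, and these have the same
    span as the Brill equations. *)
Lemma J_brill (F : Rring) : J e F <-> ideal_gen (@brill_eq k 3 3 pi) F.
Proof.
apply: (iff_trans (J_kernel chark eU F)); split=> [/(kernel_bracket chark)[c ->]|].
  apply: ideal_gen_sum => i; apply: ideal_gen_sum => j.
  by apply: ideal_genM; apply: lspan_ideal_gen; apply: bracket_brill.
move: F; apply: ideal_genP => [F /brill_kernel //|a F F0|F G F0 G0|]; last exact: rmorph0.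
  by rewrite rmorphM /= F0 mulr0.
by rewrite rmorphD /= F0 G0 addr0.
Qed.

Lemma brill_homog (F : Rring) : lspan (@brill_eq k 3 3 pi) F -> F \is 4.-homog.
Proof.
have sW : subspace (fun F : Rring => is_true (F \is 4.-homog)).
  by split=> [|t G H hG hH]; rewrite ?rpred0 // rpredD ?rpredZ.
apply: (lspan_min sW); apply/(brill_membership sW); apply: (brill_at_Phi sW).
apply: (brackets_brill_at sW) => l l'; apply: rpredB.
  by apply: (dhomogM (d := 1) (e := 3)); rewrite ?hX_homog // dhomogX /= mdeg1.
by apply: (dhomogM (d := 1) (e := 3)); rewrite ?hX_homog // dhomogX /= mdeg1.
Qed.

Lemma brill_Phi (F : Rring) : lspan (@brill_eq k 3 3 pi) F <-> lspan (fun G => exists a b, G = Phi a b) F.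
Proof.
split; apply: lspan_min; try exact: lspan_subspace.
  by apply/(brill_membership (lspan_subspace _)) => a b; apply: lspan_mem; exists a, b.
move=> _ [a [b ->]]; move: a b; apply/(brill_membership (lspan_subspace _)).
exact: lspan_mem.
Qed.

End BrillIdeal.


(** * The Schur functor S_(7,3,2) *)

Section SchurSpan.
Variables (k : fieldType) (chark : [pchar k] =i pred0).

Local Notation T := {mpoly k[3 * 3]}.
Local Notation X9 := (X9 k).
Local Notation l0 := (@row_lin k 3 3 i0).
Local Notation l1 := (@row_lin k 3 3 i1).
Local Notation S732 := (@schur k 3 [:: 7; 3; 2]%N).
Implicit Types (a b c u : 'I_3 -> k) (W : T -> Prop).

(** A translate of the highest weight vector of S_(7,3,2)U, which is the case
    a = e_0, b = e_1. *)
Definition psi a b : T := \det X9 ^+ 2 * (l0 a ^+ 4 * (l0 a * l1 b - l0 b * l1 a)).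

Let psi_curve (D U C V U1 C1 V1 : T) (m : 'I_6) : T := tnth [tuple
  D * (U ^+ 4 * (U * V1 - V * U1));
  D * (U ^+ 4 * (C * V1 - V * C1) + 4 * U ^+ 3 * C * (U * V1 - V * U1));
  D * (4 * U ^+ 3 * C * (C * V1 - V * C1) + 6 * U ^+ 2 * C ^+ 2 * (U * V1 - V * U1));
  D * (6 * U ^+ 2 * C ^+ 2 * (C * V1 - V * C1) + 4 * U * C ^+ 3 * (U * V1 - V * U1));
  D * (4 * U * C ^+ 3 * (C * V1 - V * C1) + C ^+ 4 * (U * V1 - V * U1));
  D * (C ^+ 4 * (C * V1 - V * C1))] m.

Let psi_curveE (D U C V U1 C1 V1 : T) t :
  \sum_(i < 6) t ^+ i *: psi_curve D U C V U1 C1 V1 i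
  = D * ((t *: C + U) ^+ 4 * ((t *: C + U) * V1 - V * (t *: C1 + U1))).
Proof.
rewrite !big_ord_recl big_ord0 /psi_curve !(tnth_nth 0) /= /bump /= expr0 expr1 scale1r addr0.
by rewrite -!mul_mpolyC ?rmorphXn /=; ring.
Qed.

(** The coefficient of t in psi (u + t c) d, antisymmetrized in c and d, is
    6 u^4 (c /\ d) by the Pluecker relation. *)
Lemma psi_polarization W : subspace W -> (forall a b, W (psi a b)) ->
  forall u c d, W (\det X9 ^+ 2 * (l0 u ^+ 4 * (l0 c * l1 d - l0 d * l1 c))).
Proof.
move=> sW Wpsi u c d.
have lin c' d' : W (\det X9 ^+ 2 * (l0 u ^+ 4 * (l0 c' * l1 d' - l0 d' * l1 c')
    + 4 * l0 u ^+ 3 * l0 c' * (l0 u * l1 d' - l0 d' * l1 u))).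
  pose w := psi_curve (\det X9 ^+ 2) (l0 u) (l0 c') (l0 d') (l1 u) (l1 c') (l1 d').
  suff : W (w (@Ordinal 6 1 isT)) by rewrite /w /psi_curve (tnth_nth 0).
  apply: (curve_coef_mem chark sW (w := w)) => t _; rewrite psi_curveE -!row_linD.
  exact: Wpsi.
have := subspaceZ sW 6%:R^-1 (subspaceB sW (lin c d) (lin d c)).
congr W; apply: (scalerI (natk_neq0 chark 5)); rewrite scalerA divff ?natk_neq0 // scale1r.
rewrite scaler_nat -[RHS]mulr_natl.
by move: (\det X9 ^+ 2) (l0 u) (l0 c) (l0 d) (l1 u) (l1 c) (l1 d) => ? ? ? ? ? ? ?; ring.
Qed.

Lemma comp_lin_form d n (q : 'I_d) (u : 'I_n -> k) :
  lin_form u \mPo [tuple (xvar q a : {mpoly k[d * n]}) | a < n] = row_lin q u.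
Proof.
rewrite /lin_form linear_sum; apply: eq_bigr => i _ /=.
by rewrite linearZ /= comp_mpolyXU -tnth_nth tnth_mktuple.
Qed.

Let det_cols (c : nat -> 'I_3) (D := \det (\matrix_(i < 3, i' < 3) (xvar (inord i : 'I_3) (c i') : T))) :
  (exists s : k, D = s *: \det X9) /\ ((forall i : 'I_3, c i = i) -> D = \det X9).
Proof.
rewrite {}/D; split=> [|cE].
  exists (\det (\matrix_(a < 3, i' < 3) (a == c i')%:R : 'M[k]_3)).
  rewrite -mul_mpolyC mulrC -det_map_mx -det_mulmx; congr (\det _).
  apply/matrixP => i j; rewrite !mxE (bigD1 (c j)) //= big1 => [|a na].
    by rewrite !mxE eqxx mulr1 addr0 inord_val.
  by rewrite !mxE (negbTE na) mpolyC0 mulr0.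
by congr (\det _); apply/matrixP => i j; rewrite !mxE inord_val cE.
Qed.

Let x0 (a : 'I_3) : T := xvar i0 a.
Let x1 (a : 'I_3) : T := xvar i1 a.

Let schur_prod (t : nat -> nat -> 'I_3) :
  \prod_(j < head 0%N [:: 7; 3; 2]%N) colminor k [:: 7; 3; 2]%N j (t j)
  = \det (\matrix_(i < 3, i' < 3) (xvar (inord i : 'I_3) (t 0%N i') : T))
    * \det (\matrix_(i < 3, i' < 3) (xvar (inord i : 'I_3) (t 1%N i') : T))
    * (x0 (t 2 0) * x1 (t 2 1) - x0 (t 2 1) * x1 (t 2 0))
    * (x0 (t 3 0) * x0 (t 4 0) * x0 (t 5 0) * x0 (t 6 0)).
Proof.
have col1 j : colheight [:: 7; 3; 2]%N j = 1%N -> colminor k [:: 7; 3; 2]%N j (t j) = x0 (t j 0).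
  move=> h; rewrite (colminorE _ _ h) det_mx11 mxE; congr (xvar _ _).
  by apply: val_inj; rewrite /= inordK.
have col2 : colminor k [:: 7; 3; 2]%N 2 (t 2) = x0 (t 2 0) * x1 (t 2 1) - x0 (t 2 1) * x1 (t 2 0).
  rewrite (@colminorE _ _ _ _ _ _ 2) // det_mx22 !mxE /=; congr (_ * _ - _ * _);
  by congr (xvar _ _); apply: val_inj; rewrite /= inordK.
have col3 j : colheight [:: 7; 3; 2]%N j = 3%N -> colminor k [:: 7; 3; 2]%N j (t j)
    = \det (\matrix_(i < 3, i' < 3) (xvar (inord i : 'I_3) (t j i') : T)).
  by move=> h; rewrite (colminorE _ _ h).
rewrite /= !big_ord_recl big_ord0 /= /bump /= !addn0 !add1n.
rewrite (col3 0%N) // (col3 1%N) // col2 (col1 3%N) // (col1 4%N) // (col1 5%N) // (col1 6%N) //.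
by rewrite mulr1 !mulrA.
Qed.

Lemma psi_schur a b : S732 (psi a b).
Proof.
have sW : subspace (S732 : T -> Prop) by apply: lspan_subspace.
have gen p0 p1 p2 p3 i j : S732 (\det X9 ^+ 2 *
    (x0 p0 * x0 p1 * x0 p2 * x0 p3 * (x0 i * x1 j - x0 j * x1 i))).
  apply: lspan_mem.
  pose t (q r : nat) : 'I_3 := match q with
    | 0 | 1 => nth i0 [:: i0; i1; i2] r | 2 => if r == 0%N then i else j
    | 3 => p0 | 4 => p1 | 5 => p2 | _ => p3 end%N.
  exists t.
  rewrite schur_prod /t /=.
  have d0 := (det_cols (fun r => nth i0 [:: i0; i1; i2] r)).2; rewrite d0; first by ring.
  by apply: forall3; apply: val_inj.
rewrite /psi.
have E : l0 a ^+ 4 = \sum_p0 \sum_p1 \sum_p2 \sum_p3 (a p0 * a p1 * a p2 * a p3) *: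
    (x0 p0 * x0 p1 * x0 p2 * x0 p3).
  rewrite !exprS expr0 mulr1 {1}/row_lin mulr_suml; apply: eq_bigr => p0 _.
  rewrite {1}/row_lin mulr_suml mulr_sumr; apply: eq_bigr => p1 _.
  rewrite {1}/row_lin mulr_suml !mulr_sumr; apply: eq_bigr => p2 _.
  rewrite {1}/row_lin !mulr_sumr; apply: eq_bigr => p3 _.
  by rewrite -!mul_mpolyC !mpolyCM /x0; ring.
have E' : l0 a * l1 b - l0 b * l1 a = \sum_i \sum_j (a i * b j) *: (x0 i * x1 j - x0 j * x1 i).
  rewrite /row_lin !big_distrlr /= [X in _ - X]exchange_big -sumrB; apply: eq_bigr => i _ /=.
  rewrite -sumrB; apply: eq_bigr => j _ /=.
  by rewrite -!mul_mpolyC mpolyCM /x0 /x1; ring.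
rewrite E E' mulr_suml mulr_sumr; apply: (subspace_sum sW) => p0 _.
rewrite mulr_suml mulr_sumr; apply: (subspace_sum sW) => p1 _.
rewrite mulr_suml mulr_sumr; apply: (subspace_sum sW) => p2 _.
rewrite mulr_suml mulr_sumr; apply: (subspace_sum sW) => p3 _.
rewrite mulr_sumr mulr_sumr; apply: (subspace_sum sW) => i _.
rewrite mulr_sumr mulr_sumr; apply: (subspace_sum sW) => j _.
have := subspaceZ sW (a p0 * a p1 * a p2 * a p3 * (a i * b j)) (gen p0 p1 p2 p3 i j).
by congr schur; rewrite -!mul_mpolyC !mpolyCM; ring.
Qed.

(** A product of columns of heights 3, 3, 2, 1, 1, 1, 1 is a multiple of
    det^2 * (c /\ d) * g, where g is a monomial of degree 4, hence a combination
    of fourth powers. *)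
Lemma schur_psi W : subspace W -> (forall a b, W (psi a b)) -> forall v, S732 v -> W v.
Proof.
move=> sW Wpsi; apply: (lspan_min sW) => _ [t ->]; rewrite schur_prod.
have [[s ->] _] := det_cols (t 0%N); have [[s' ->] _] := det_cols (t 1%N).
have H (g : {mpoly k[3]}) : g \is 4.-homog -> W (\det X9 ^+ 2 *
    ((g \mPo [tuple x0 a | a < 3]) * (x0 (t 2 0) * x1 (t 2 1) - x0 (t 2 1) * x1 (t 2 0)))).
  move: g; apply: (powers_span chark) => [|u].
    split=> [|r g g' Wg Wg']; first by rewrite comp_mpoly0 mul0r mulr0; exact: sW.1.
    rewrite comp_mpolyD comp_mpolyZ; have := sW.2 r _ _ Wg Wg'.
    by congr W; rewrite -!mul_mpolyC; ring.
  rewrite rmorphXn /= comp_lin_form /x0 /x1 -!row_lin_unit.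
  exact: psi_polarization.
have := subspaceZ sW (s * s') (H ('X_(t 3 0) * 'X_(t 4 0) * 'X_(t 5 0) * 'X_(t 6 0)) _).
rewrite !rmorphM /= !comp_mpolyXU -!tnth_nth !tnth_mktuple => WH.
have /WH : ('X_(t 3 0) * 'X_(t 4 0) * 'X_(t 5 0) * 'X_(t 6 0) : {mpoly k[3]}) \is 4.-homog.
  by rewrite -!mpolyXD dhomogX /= !mdegD !mdeg1.
by congr W; rewrite -!mul_mpolyC mpolyCM; ring.
Qed.

End SchurSpan.


(** * The intertwiner from S_(7,3,2) to the Brill equations *)

Section Intertwiner.
Variables (k : fieldType) (chark : [pchar k] =i pred0).

Local Notation T := {mpoly k[3 * 3]}.
Local Notation Rring := {mpoly k[#|basis 3 3|]}.
Local Notation X3 := (X3 k).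
Local Notation X9 := (X9 k).
Local Notation l0 := (@row_lin k 3 3 i0).
Implicit Types (a b c u v z : 'I_3 -> k).

Definition dot u v : k := \sum_i u i * v i.

(** These are all polynomial maps of degree 5 in a and degree 1 in b;
    in this form they can be compared with psi. *)
Definition power_form (F : ('I_3 -> k) -> ('I_3 -> k) -> Rring) : Prop :=
  exists (n : nat) (z v : 'I_n -> 'I_3 -> k) (r : 'I_n -> Rring),
    forall a b, F a b = \sum_(p < n) (dot a (z p) ^+ 5 * dot b (v p)) *: r p.

Lemma power_form_add F G : power_form F -> power_form G -> power_form (fun a b => F a b + G a b).
Proof.
move=> [n [z [v [r E]]]] [n' [z' [v' [r' E']]]].
exists (n + n')%N, (fun i => match split i with inl j => z j | inr j => z' j end),
  (fun i => match split i with inl j => v j | inr j => v' j end),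
  (fun i => match split i with inl j => r j | inr j => r' j end) => a b.
rewrite E E' big_split_ord /=; congr (_ + _); apply: eq_bigr => i _.
  by rewrite (unsplitK (inl i)).
by rewrite (unsplitK (inr i)).
Qed.

Lemma power_formN F : power_form F -> power_form (fun a b => - F a b).
Proof.
move=> [n [z [v [r E]]]]; exists n, z, v, (fun i => - r i) => a b; rewrite E -sumrN.
by apply: eq_bigr => i _; rewrite scalerN.
Qed.

Lemma power_form_ext F G : power_form F -> (forall a b, G a b = F a b) -> power_form G.
Proof. by move=> [n [z [v [r E]]]] FG; exists n, z, v, r => a b; rewrite FG E. Qed.

Lemma power_form0 : power_form (fun _ _ => 0).
Proof. by exists 0%N, (fun _ _ => 0), (fun _ _ => 0), (fun=> 0) => a b; rewrite big_ord0. Qed.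

Lemma power_form_sum (I : finType) (F : I -> ('I_3 -> k) -> ('I_3 -> k) -> Rring) :
  (forall i, power_form (F i)) -> power_form (fun a b => \sum_i F i a b).
Proof.
move=> HF; elim: (index_enum I) => [|i s [n [z [v [r E]]]]].
  have [n [z [v [r E]]]] := power_form0; exists n, z, v, r => a b.
  by rewrite big_nil; exact: E.
have [|n' [z' [v' [r' E']]]] := power_form_add (HF i) (G := fun a b => \sum_(j <- s) F j a b).
  by exists n, z, v, r.
by exists n', z', v', r' => a b; rewrite big_cons E'.
Qed.

Lemma power_form_mono (g : {mpoly k[3]}) j (r : Rring) : g \is 5.-homog ->
  power_form (fun a b => (g.@[a] * b j) *: r).
Proof.
move: g; apply: (powers_span chark) => [|z].
  split=> [|t g g' [n [z [v [s E]]]] Hg'].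
    have [n [z [v [s E]]]] := power_form0; exists n, z, v, s => a b.
    by rewrite meval0 mul0r scale0r; exact: E.
  have [|n' [z' [v' [s' E']]]] := power_form_add (F := fun a b => (t * g.@[a] * b j) *: r) _ Hg'.
    exists n, z, v, (fun i => t *: s i) => a b; rewrite -mulrA -scalerA E scaler_sumr.
    by apply: eq_bigr => i _; rewrite !scalerA mulrC.
  by exists n', z', v', s' => a b; rewrite -E' mevalD mevalZ mulrDl scalerDl.
exists 1%N, (fun=> z), (fun _ i => (i == j)%:R), (fun=> r) => a b.
rewrite big_ord1 rmorphXn /=; congr ((_ ^+ 5 * _) *: r).
  by rewrite /lin_form /dot rmorph_sum; apply: eq_bigr => i _ /=; rewrite mevalZ mevalXU mulrC.
by rewrite /dot (bigD1 j) //= eqxx mulr1 big1 ?addr0 // => i /negbTE ->; rewrite mulr0.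
Qed.

(** Monomials of degree 5 in a are combinations of fifth powers. *)
Lemma Phi_power_form : power_form (@Phi k).
Proof.
have H5 x1 x2 x3 x4 x5 : ('X_x1 * 'X_x2 * 'X_x3 * 'X_x4 * 'X_x5 : {mpoly k[3]}) \is 5.-homog.
  by rewrite -!mpolyXD dhomogX /= !mdegD !mdeg1.
have P1 F G : power_form (fun a b => ev3 F a a a * ev3 G a a b).
  have : power_form (fun a b => \sum_i \sum_j \sum_l \sum_i' \sum_j' \sum_l'
      (('X_i * 'X_j * 'X_l * 'X_i' * 'X_j').@[a] * b l') *: (F i j l * G i' j' l')).
    by do 6 apply: power_form_sum => ?; apply: power_form_mono.
  move=> [n [z [v [r E]]]]; exists n, z, v, r => a b; rewrite -E /ev3.
  rewrite big_distrl; apply: eq_bigr => i _; rewrite big_distrl; apply: eq_bigr => j _ /=.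
  rewrite big_distrl; apply: eq_bigr => l _ /=; rewrite big_distrr; apply: eq_bigr => i' _ /=.
  rewrite big_distrr; apply: eq_bigr => j' _ /=; rewrite big_distrr; apply: eq_bigr => l' _ /=.
  by rewrite -scalerAl -scalerAr scalerA !mevalM !mevalXU; congr (_ *: _); ring.
have H := power_form_add (P1 X3 (hess X3)) (power_formN (P1 (hess X3) X3)).
apply: (power_form_ext H) => a b.
by rewrite /Phi; congr (_ - _); rewrite mulrC.
Qed.

Lemma dotDl t u u' v : dot (fun i => t * u i + u' i) v = t * dot u v + dot u' v.
Proof.
by rewrite /dot mulr_sumr -big_split; apply: eq_bigr => i _ /=; ring.
Qed.

(** Let Phi(a, b) be the sum of the (a.z)^5 (b.v) r. Differentiating
    Phi(a, a) = 0 in the direction b, the sum of the (a.z)^4 (b.z) (a.v) r is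
    - Phi(a, b) / 5. *)
Lemma Phi_wedge_form : exists (n : nat) (z v : 'I_n -> 'I_3 -> k) (r : 'I_n -> Rring),
  forall a b, \sum_(p < n) (dot a (z p) ^+ 4 * (dot a (z p) * dot b (v p) - dot b (z p) * dot a (v p))) *: r p
    = (6%:R / 5%:R) *: Phi a b.
Proof.
have [n [z [v [r E]]]] := Phi_power_form; exists n, z, v, r => a b.
have Eaa c : \sum_(p < n) (dot c (z p) ^+ 5 * dot c (v p)) *: r p = 0.
  by rewrite -E /Phi subrr.
pose co p (m : 'I_7) : k := let A := dot a (z p) in let B := dot b (z p) in
  let A' := dot a (v p) in let B' := dot b (v p) in
  tnth [tuple A ^+ 5 * A'; 5 * A ^+ 4 * B * A' + A ^+ 5 * B';
    10 * A ^+ 3 * B ^+ 2 * A' + 5 * A ^+ 4 * B * B';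
    10 * A ^+ 2 * B ^+ 3 * A' + 10 * A ^+ 3 * B ^+ 2 * B';
    5 * A * B ^+ 4 * A' + 10 * A ^+ 2 * B ^+ 3 * B';
    B ^+ 5 * A' + 5 * A * B ^+ 4 * B'; B ^+ 5 * B'] m.
pose w m : Rring := \sum_(p < n) co p m *: r p.
have sW : subspace (fun F : Rring => F = 0).
  by split=> // s x y -> ->; rewrite scaler0 addr0.
have w1 : w (@Ordinal 7 1 isT) = 0.
  apply: (curve_coef_mem chark sW (w := w)) => t _.
  rewrite /w; under eq_bigr => m _ do rewrite scaler_sumr.
  rewrite exchange_big /= -[RHS](Eaa (fun i => t * b i + a i)); apply: eq_bigr => p _.
  under eq_bigr => m _ do rewrite scalerA.
  rewrite -scaler_suml !dotDl; congr (_ *: _).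
  by rewrite !big_ord_recl big_ord0 /co !(tnth_nth 0) /= /bump /=; ring.
apply: (scalerI (natk_neq0 chark 4)); rewrite scalerA mulrC mulfVK ?natk_neq0 //.
rewrite E !scaler_sumr -[RHS]subr0 -[X in _ - X]w1 /w -sumrB; apply: eq_bigr => p _.
rewrite !scalerA -scalerBl; congr (_ *: _).
by rewrite /co (tnth_nth 0) /=; ring.
Qed.

Definition mulv (M : 'M[k]_3) a : 'I_3 -> k := fun i => \sum_j M i j * a j.

Lemma gact_psi M a b : gact M (psi a b) = \det M ^+ 2 *: psi (mulv M a) (mulv M b).
Proof.
rewrite /psi !(rmorphXn, rmorphM, rmorphB) /= !gact_row_lin.
have -> : gact M (\det X9) = (\det M)%:MP * \det X9.
  by rewrite -det_map_mx gact_X9 det_mulmx det_map_mx mulrC.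
by rewrite -mul_mpolyC rmorphXn /mulv; ring.
Qed.

Lemma ev3_trans (M : 'M[k]_3) F a b c :
  ev3 (trans3 (map_mx (@mpolyC _ k) M) F) a b c = ev3 F (mulv M a) (mulv M b) (mulv M c).
Proof.
have E : ev3 (trans3 (map_mx (@mpolyC _ k) M) F) a b c = trans3
   (map_mx (@mpolyC _ k) (cols a b c)) (trans3 (map_mx (@mpolyC _ k) M) F) i0 i1 i2.
  by rewrite ev3_cols !(tnth_nth a).
have E' : ev3 F (mulv M a) (mulv M b) (mulv M c) =
   trans3 (map_mx (@mpolyC _ k) (cols (mulv M a) (mulv M b) (mulv M c))) F i0 i1 i2.
  by rewrite ev3_cols !(tnth_nth a).
rewrite E E' trans3_comp -map_mxM.
have -> : M *m cols a b c = cols (mulv M a) (mulv M b) (mulv M c); last by [].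
apply/matrixP => i; apply: forall3; rewrite !mxE !(tnth_nth 0) /=;
by apply: eq_bigr => j _; rewrite !mxE (tnth_nth 0).
Qed.

Lemma gactR_Phi M a b : gactR M (Phi a b) = (\det M ^+ 2) *: Phi (mulv M a) (mulv M b).
Proof.
have gev F u v w : gactR M (ev3 F u v w) = ev3 (fun i j l => gactR M (F i j l)) u v w.
  rewrite /ev3 linear_sum; apply: eq_bigr => i _; rewrite linear_sum; apply: eq_bigr => j _ /=.
  by rewrite linear_sum; apply: eq_bigr => l _ /=; rewrite linearZ.
have eq_ev F G u v w : (forall i j l, F i j l = G i j l) -> ev3 F u v w = ev3 G u v w :> Rring.
  move=> E; apply: eq_bigr => i _; apply: eq_bigr => j _; apply: eq_bigr => l _.
  by rewrite E.
have gX u v w : gactR M (ev3 X3 u v w) = ev3 X3 (mulv M u) (mulv M v) (mulv M w).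
  by rewrite gev -ev3_trans; apply: eq_ev => i j l; rewrite gactR_X3.
have gH u v w : gactR M (ev3 (hess X3) u v w)
    = (\det M ^+ 2) *: ev3 (hess X3) (mulv M u) (mulv M v) (mulv M w).
  rewrite gev -ev3_trans.
  rewrite (eq_ev _ (fun i j l => (\det M ^+ 2)%:MP * trans3 (map_mx (@mpolyC _ k) M) (hess X3) i j l)).
    rewrite /ev3 scaler_sumr; apply: eq_bigr => i _; rewrite scaler_sumr; apply: eq_bigr => j _.
    by rewrite scaler_sumr; apply: eq_bigr => l _; rewrite mul_mpolyC !scalerA mulrC.
  move=> i j l; rewrite (hess_map (gactR M)).
  rewrite (@eq_hess _ _ (trans3 (map_mx (@mpolyC _ k) M) X3)) => [|x y z]; last exact: gactR_X3.
  by rewrite hess_trans3 det_map_mx -rmorphXn.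
by rewrite /Phi rmorphB !rmorphM /= !gX !gH -!scalerAr scalerBr.
Qed.

(** Both sides vanish if z and v are dependent; otherwise a third vector
    completes them to a frame of determinant 1. *)
Lemma frame_completion (z v : 'I_3 -> k) : exists pt : 'I_(3 * 3) -> k, forall a b,
  (psi a b).@[pt] = dot a z ^+ 4 * (dot a z * dot b v - dot b z * dot a v).
Proof.
have val (y : 'I_3 -> k) (pt := fun t => mxvec (\matrix_(q, a) tnth [tuple z; v; y] q a) 0 t) a b :
    (psi a b).@[pt] = \det (cols z v y) ^+ 2 * (dot a z ^+ 4 * (dot a z * dot b v - dot b z * dot a v)).
  have lE (q : 'I_3) u : (row_lin q u : T).@[pt] = dot u (tnth [tuple z; v; y] q).
    rewrite /row_lin /dot rmorph_sum; apply: eq_bigr => i _ /=.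
    by rewrite mevalZ mevalXU /pt mxvecE mxE.
  rewrite /psi !(rmorphXn, rmorphM, rmorphB) /= !lE !(tnth_nth z) /=; congr (_ ^+ 2 * _).
  rewrite -det_map_mx -det_tr; congr (\det _); apply/matrixP => i j.
  rewrite !mxE /= mevalXU /pt mxvecE mxE; move: j; apply: forall3;
  by rewrite !(tnth_nth 0) ?(tnth_nth z).
have [[c nd]|[s [t [w [-> ->]]]]] := dependent_or z v; last first.
  exists (fun=> 0) => a b.
  have -> : dot a (fun i => s * w i) * dot b (fun i => t * w i)
      - dot b (fun i => s * w i) * dot a (fun i => t * w i) = 0.
    have d r u : dot u (fun i => r * w i) = r * dot u w.
      by rewrite /dot mulr_sumr; apply: eq_bigr => i _; rewrite mulrCA.
    by rewrite !d; ring.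
  have l00 u : (l0 u).@[fun=> 0] = 0.
    by rewrite /row_lin rmorph_sum big1 // => i _ /=; rewrite mevalZ mevalXU mulr0.
  by rewrite /psi !(rmorphXn, rmorphM) /= l00 expr0n mul0r !mulr0.
pose y i := (\det (cols z v c))^-1 * c i.
exists (fun t => mxvec (\matrix_(q, a) tnth [tuple z; v; y] q a) 0 t) => a b.
rewrite val.
have key r : \det (cols z v (fun i => r * c i)) = r * \det (cols z v c).
  by rewrite !det3 !mxE !(tnth_nth 0) /=; ring.
by rewrite key mulVf // expr1n mul1r.
Qed.

(** Evaluation at the frames of frame_completion for the vectors of
    Phi_wedge_form. *)
Lemma intertwiner_ex : exists phi : {linear T -> Rring},
  forall a b, phi (psi a b) = (6%:R / 5%:R) *: Phi a b.
Proof.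
have [n [z [v [r E]]]] := Phi_wedge_form.
have [pt ptE] := boolp.choice (fun p => frame_completion (z p) (v p)).
pose f (t : T) : Rring := \sum_(p < n) t.@[pt p] *: r p.
have lf : linear f.
  move=> s u u'; rewrite /f scaler_sumr -big_split; apply: eq_bigr => p _ /=.
  by rewrite mevalD mevalZ scalerDl scalerA.
pose F := GRing.isLinear.Build k T Rring _ f lf.
pose fl : {linear T -> Rring} := HB.pack f F.
exists fl => a b; rewrite /= /f -E; apply: eq_bigr => p _.
by rewrite ptE.
Qed.

End Intertwiner.


(** * The intertwiner is an isomorphism *)

Section RepresentationIsomorphism.
Variables (k : fieldType) (chark : [pchar k] =i pred0).

Local Notation T := {mpoly k[3 * 3]}.
Local Notation Rring := {mpoly k[#|basis 3 3|]}.
Local Notation X3 := (X3 k).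
Local Notation S732 := (@schur k 3 [:: 7; 3; 2]%N).
Implicit Types (a b c z w : 'I_3 -> k).

(** The cubic z0 (z0 z1 + eps z2^2): a conic with a tangent line. *)
Definition tangent_cubic (eps : k) : tensor3 k := fun i j l =>
  ((i == i0) && (j == i0) && (l == i1))%:R + ((i == i0) && (j == i1) && (l == i0))%:R
  + ((i == i1) && (j == i0) && (l == i0))%:R
  + eps * (((i == i0) && (j == i2) && (l == i2))%:R + ((i == i2) && (j == i0) && (l == i2))%:R
  + ((i == i2) && (j == i2) && (l == i0))%:R).

Lemma tangent_cubic_sym eps : sym3 (tangent_cubic eps).
Proof.
by rewrite /sym3 /tangent_cubic; apply: forall3; apply: forall3; apply: forall3; split; rewrite /=; ring.
Qed.

Lemma tangent_cubicE eps (t := tangent_cubic eps) :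
  (t i0 i0 i0 = 0) * (t i0 i0 i1 = 1) * (t i0 i0 i2 = 0) * (t i0 i1 i1 = 0)
  * (t i0 i1 i2 = 0) * (t i0 i2 i2 = eps) * (t i1 i1 i1 = 0) * (t i1 i1 i2 = 0)
  * (t i1 i2 i2 = 0) * (t i2 i2 i2 = 0).
Proof. by rewrite /t /tangent_cubic /=; do !split; ring. Qed.

Lemma hess_tangent_cubic eps i j l : hess (tangent_cubic eps) i j l =
  (- 6%:R * eps) * ((i == i0) && (j == i0) && (l == i0))%:R.
Proof.
move: i j l; apply: (sym3_ext (G := fun i j l => (- 6%:R * eps) * ((i == i0) && (j == i0) && (l == i0))%:R)).
- exact: hess_sym.
- by apply: forall3; apply: forall3; apply: forall3.
all: rewrite /hess !mixdetE !mxE !(sorted3 (tangent_cubic_sym eps)) !tangent_cubicE /=; ring.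
Qed.

Definition eval_tensor (t : tensor3 k) : Rring -> k :=
  meval (fun l => t (tnth (word l) i0) (tnth (word l) i1) (tnth (word l) i2)).

HB.instance Definition _ t := GRing.LRMorphism.copy (eval_tensor t)
  (meval (fun l => t (tnth (word l) i0) (tnth (word l) i1) (tnth (word l) i2))).

Lemma eval_tensor_ev3 (t : tensor3 k) (F : tensor3 Rring) a b c :
  eval_tensor t (ev3 F a b c) =
  \sum_i \sum_j \sum_l a i * b j * c l * eval_tensor t (F i j l).
Proof.
rewrite /ev3 rmorph_sum; apply: eq_bigr => i _; rewrite rmorph_sum; apply: eq_bigr => j _ /=.
by rewrite rmorph_sum; apply: eq_bigr => l _ /=; rewrite /eval_tensor mevalZ.
Qed.

Lemma eval_tensor_X3 t i j l : sym3 t -> eval_tensor t (X3 i j l) = t i j l.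
Proof. by move=> st; rewrite /eval_tensor /X3 mevalXU sym3_word. Qed.

(** The Hessian of this cubic is - 6 eps z0^3, up to normalization, so that only
    the cubic for eps = 0 enters the coefficient of eps. *)
Lemma Phi_tangent_cubic z w : exists s, forall eps,
  eval_tensor (tangent_cubic eps) (Phi z w) =
  eps * (6%:R * (z i0 ^+ 4 * (z i0 * w i1 - w i0 * z i1))) + eps ^+ 2 * s.
Proof.
exists (- 6%:R * z i0 ^+ 2 * (3%:R * z i0 * z i2 ^+ 2 * w i0
   - z i0 * (w i0 * z i2 ^+ 2 + 2%:R * z i0 * z i2 * w i2))) => eps.
have evX u v u' : eval_tensor (tangent_cubic eps) (ev3 X3 u v u') =
    u i0 * v i0 * u' i1 + u i0 * v i1 * u' i0 + u i1 * v i0 * u' i0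
    + eps * (u i0 * v i2 * u' i2 + u i2 * v i0 * u' i2 + u i2 * v i2 * u' i0).
  rewrite eval_tensor_ev3.
  under eq_bigr => i _ do under eq_bigr => j _ do under eq_bigr => l _ do
    rewrite (eval_tensor_X3 _ _ _ (tangent_cubic_sym eps)).
  by rewrite !sum3 /tangent_cubic /=; ring.
have evH u v u' : eval_tensor (tangent_cubic eps) (ev3 (hess X3) u v u') =
    (- 6%:R * eps) * (u i0 * v i0 * u' i0).
  rewrite eval_tensor_ev3.
  have E i j l : eval_tensor (tangent_cubic eps) (hess X3 i j l)
      = (- 6%:R * eps) * ((i == i0) && (j == i0) && (l == i0))%:R.
    rewrite (hess_map (eval_tensor (tangent_cubic eps))) -hess_tangent_cubic.
    by apply: eq_hess => x y t; apply: eval_tensor_X3; apply: tangent_cubic_sym.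
  under eq_bigr => i _ do under eq_bigr => j _ do under eq_bigr => l _ do rewrite E.
  by rewrite !sum3 /=; ring.
by rewrite /Phi rmorphB !rmorphM /= !evX !evH; ring.
Qed.

Definition id_point (t : 'I_(3 * 3)) : k := mxvec (1%:M : 'M[k]_3) 0 t.

Lemma psi_id_point z w :
  (psi z w).@[id_point] = z i0 ^+ 4 * (z i0 * w i1 - w i0 * z i1).
Proof.
have xE (q a : 'I_3) : (xvar q a : T).@[id_point] = (q == a)%:R by rewrite mevalXU /id_point mxvecE mxE.
have lE (q : 'I_3) u : (row_lin q u : T).@[id_point] = u q.
  rewrite /row_lin rmorph_sum (bigD1 q) //= big1 => [|i nq].
    by rewrite mevalZ xE eqxx mulr1 addr0.
  by rewrite mevalZ xE eq_sym (negbTE nq) mulr0.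
rewrite /psi !(rmorphXn, rmorphM, rmorphB) /= !lE -det_map_mx.
have -> : map_mx (meval id_point) (X9 k) = 1%:M.
  by apply/matrixP => i j; rewrite !mxE xE.
by rewrite det1 expr1n mul1r.
Qed.

Lemma gact_id_point (c : 'I_(3 * 3) -> k) (v : T) :
  (gact (\matrix_(i, a) c (mxvec_index i a)) v).@[id_point] = v.@[c].
Proof.
rewrite /gact /bsubst comp_mpoly_meval; apply: meval_eq => t.
rewrite tnth_mktuple; case/mxvec_indexP: t => i a; rewrite mxvecE mxE.
rewrite rmorph_sum (bigD1 i) //= big1 => [|b nb].
  by rewrite mevalZ mevalXU /id_point mxvecE !mxE eqxx mulr1 addr0.
by rewrite mevalZ mevalXU /id_point mxvecE !mxE eq_sym (negbTE nb) mulr0.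
Qed.

Variables (phi : {linear T -> Rring}) (kappa : k) (kappa_neq0 : kappa != 0).
Hypothesis phi_psi : forall a b, phi (psi a b) = kappa *: Phi a b.

Lemma schur_gact M v : S732 v -> S732 (gact M v).
Proof.
have sS : subspace (S732 : T -> Prop) by apply: lspan_subspace.
apply: (schur_psi chark (W := fun v => S732 (gact M v))) => [|a b].
  by split=> [|t u u' Su Su']; rewrite ?linear0; [exact: sS.1 | rewrite linearP; apply: sS.2].
by rewrite gact_psi; apply: (subspaceZ sS); apply: psi_schur.
Qed.

Lemma phi_gact M v : S732 v -> phi (gact M v) = gactR M (phi v).
Proof.
move: v; apply: (schur_psi chark) => [|a b].
  split=> [|t u u' Eu Eu']; first by rewrite !linear0.
  by rewrite !linearP /= Eu Eu'.
have -> : gactR M (phi (psi a b)) = kappa *: gactR M (Phi a b) by rewrite phi_psi linearZ.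
by rewrite gact_psi linearZ /= phi_psi gactR_Phi !scalerA mulrC.
Qed.

Lemma phi_tangent_cubic v : S732 v -> exists s, forall eps,
  eval_tensor (tangent_cubic eps) (phi v) = eps * (6%:R * kappa * v.@[id_point]) + eps ^+ 2 * s.
Proof.
move: v; apply: (schur_psi chark) => [|a b].
  split=> [|t u u' [s E] [s' E']].
    by exists 0 => eps; rewrite meval0 linear0 rmorph0 !mulr0 addr0.
  exists (t * s + s') => eps.
  by rewrite linearP /= rmorphD /= /eval_tensor mevalZ -!/(eval_tensor _ _) E E' mevalD mevalZ; ring.
have [s E] := Phi_tangent_cubic a b; exists (kappa * s) => eps.
by rewrite phi_psi psi_id_point /eval_tensor mevalZ -/(eval_tensor _ _) E; ring.
Qed.

(** If phi v = 0, then phi vanishes on all translates of v, and so does the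
    coefficient of eps, a non-zero multiple of the value of v at the
    corresponding point. *)
Lemma phi_inj v : S732 v -> phi v = 0 -> v = 0.
Proof.
move=> Sv v0; apply: (meval_inj chark) => c; rewrite -gact_id_point meval0.
set M := \matrix_(i, a) _.
have [s E] := phi_tangent_cubic (schur_gact M Sv).
have F eps : eps * (6%:R * kappa * (gact M v).@[id_point]) + eps ^+ 2 * s = 0.
  by rewrite -E phi_gact // v0 !rmorph0.
have /eqP : 12%:R * kappa * (gact M v).@[id_point] = 0.
  by have := F 1; have := F (-1) => Fm Fp; rewrite -[RHS](subr0 0) -{1}Fp -Fm; ring.
by rewrite !mulf_eq0 (negbTE kappa_neq0) (negbTE (natk_neq0 chark 11)) /= => /eqP.
Qed.

Variables (U : vectType k) (e : 3.-tuple U) (eU : basis_of {:U} e).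
Variables (pi : {linear {mpoly k[2 * 3]} -> {mpoly k[2 * 3]}}) (piP : brill_projection 3 e pi).

Lemma brill_rep_iso_phi (G : Type) (GL : G -> Prop) (mx : G -> 'M[k]_3) :
  rep_iso GL (fun g => gact (mx g)) (fun g => gactR (mx g))
    (@schur k 3 [:: 7; 3; 2]%N) (lspan (@brill_eq k 3 3 pi)).
Proof.
have sB : subspace (lspan (@brill_eq k 3 3 pi)) by apply: lspan_subspace.
have sS : subspace (S732 : T -> Prop) by apply: lspan_subspace.
exists phi; split=> [t u v _ _|u|u v Su Sv E|w|g u _ Su].
- by rewrite linearP.
- move: u; apply: (schur_psi chark) => [|a b].
    by split=> [|t u u' Bu Bu']; rewrite ?linear0; [exact: sB.1 | rewrite linearP; apply: sB.2].
  rewrite phi_psi; apply: (subspaceZ sB); apply/(brill_Phi chark eU piP).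
  by apply: lspan_mem; exists a, b.
- apply/eqP; rewrite -subr_eq0; apply/eqP; apply: phi_inj; first exact: (subspaceB sS).
  by rewrite linearB /= E subrr.
- move/(brill_Phi chark eU piP); move: w; apply: lspan_min => [|_ [a [b ->]]].
    split; first by exists 0; [exact: sS.1 | rewrite linear0].
    move=> t _ _ [u Su <-] [u' Su' <-]; exists (t *: u + u'); first exact: sS.2.
    by rewrite linearP.
  exists (kappa^-1 *: psi a b); first by apply: (subspaceZ sS); apply: psi_schur.
  by rewrite linearZ /= phi_psi scalerA mulVf // scale1r.
exact: phi_gact.
Qed.

End RepresentationIsomorphism.

Lemma brill_rep_iso (k : fieldType) (chark : [pchar k] =i pred0) (U : vectType k)
    (e : 3.-tuple U) (eU : basis_of {:U} e)
    (pi : {linear {mpoly k[2 * 3]} -> {mpoly k[2 * 3]}}) (piP : brill_projection 3 e pi)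
    (G : Type) (GL : G -> Prop) (mx : G -> 'M[k]_3) :
  rep_iso GL (fun g => gact (mx g)) (fun g => gactR (mx g))
    (@schur k 3 [:: 7; 3; 2]%N) (lspan (@brill_eq k 3 3 pi)).
Proof.
have [phi phiE] := intertwiner_ex chark.
apply: (brill_rep_iso_phi chark _ phiE eU piP).
by rewrite mulf_neq0 ?invr_eq0 ?(natk_neq0 chark).
Qed.

Theorem corollary4p6 (k : closedFieldType) (chark : [pchar k] =i pred0)
    (U : vectType k) (dimU : \dim {:U} = 3%N) (e : 3.-tuple U)
    (eU : basis_of {:U} e) :
  (* (a) *)
  (exists phi : {linear Cmod k 3 3 -> det2 k 3 3},
     [/\ bijective phi,
         forall (g : 'End(U)) (b : Bring k 3 3), inGL g ->
           phi (toC (gactB (gl_mx e g) b)) =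
             gact_det2 (gl_mx e g) (phi (toC b))
       & forall (m : nat) (c : Cmod k 3 3),
           Cgraded m c <-> det2_graded m (phi c)])
  /\
  (* (b) *)
  (forall pi : {linear {mpoly k[2 * 3]} -> {mpoly k[2 * 3]}},
     brill_projection 3 e pi ->
     [/\ forall F : {mpoly k[#|basis 3 3|]}, J e F <-> ideal_gen (brill_eq pi) F,
         forall F : {mpoly k[#|basis 3 3|]},
           lspan (brill_eq pi) F -> F \is 4.-homog
       & rep_iso (@inGL k U)
           (fun g => gact (gl_mx e g)) (fun g => gactR (gl_mx e g))
           (@schur k 3 [:: 7; 3; 2]%N) (lspan (@brill_eq k 3 3 pi))]).
Proof.
split; last first.
  move=> pi piP; split; first exact: (J_brill chark eU piP).
    exact: (brill_homog chark eU piP).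
  exact: (brill_rep_iso chark eU piP).
exists (phiC chark); split; first exact: phiC_bij.
  by move=> g b _; apply: phiC_gact.
exact: phiC_graded.
Qed.
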